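(* Let $X=(X_t)_{t\ge 0}$ be a subordinator with zero drift and infinite Lévy measure $\Pi$, and suppose that $$\liminf_{\delta\to 0}\frac{I(2\delta)}{I(\delta)}>1,\qquad\text{where } I(u):=\int_0^u\overline{\Pi}(x)\,dx,\quad \overline{\Pi}(x):=\Pi((x,\infty)).$$ Then for every $t>0$, $$\frac{N(t,\delta)-t\,a(\delta)}{t^{1/2}\,b(\delta)}\ \overset{d}{\longrightarrow}\ \mathcal{N}(0,1)\qquad\text{as }\delta\to 0,$$ where $a(\delta):=U(\delta)^{-1}$ and $b(\delta):=U(\delta)^{-3/2}\,\mathrm{Var}(T_\delta)^{1/2}$.
   Context: A subordinator is a non-decreasing real-valued Lévy process started at $0$ (càdlàg paths, stationary independent increments). Its law is determined by $\mathbb{E}[e^{-\lambda X_1}]=e^{-\Phi(\lambda)}$, $\lambda\ge0$, with Laplace exponent $\Phi(\lambda)=\mathrm{d}\lambda+\int_0^\infty(1-e^{-\lambda x})\,\Pi(dx)$, where $\mathrm{d}\ge 0$ is the drift and $\Pi$ is the Lévy measure on $(0,\infty)$, satisfying $\int_0^\infty(1\wedge x)\,\Pi(dx)<\infty$. ''Infinite Lévy measure'' means $\Pi((0,\infty))=\infty$; zero drift means $\mathrm{d}=0$. $N(t,\delta)$ is the minimal number of (closed) intervals of length at most $\delta$ needed to cover the range $\{X_s:0\le s\le t\}$. $T_\delta:=\int_0^\infty \mathbf{1}_{\{X_t\le\delta\}}\,dt$ is the first passage time above $\delta$, and $U(\delta):=\mathbb{E}[T_\delta]$ is the renewal function. $\overset{d}{\to}$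 denotes convergence in distribution. *)

(* Defs.v *)
From HB Require Import structures.
From mathcomp Require Import all_boot all_order all_algebra finmap.
From mathcomp Require Import all_classical all_reals all_analysis.

Set Implicit Arguments.
Unset Strict Implicit.
Unset Printing Implicit Defensive.

Import Order.TTheory GRing.Theory Num.Theory.
Import numFieldNormedType.Exports.

Local Open Scope classical_set_scope.
Local Open Scope ring_scope.

Section processes.
Context {R : realType} {d : measure_display} {Omega : measurableType d}.
Variable P : probability Omega R.

Definition mutually_independent (I : choiceType) (Y : I -> Omega -> R) : Prop :=
  forall (J : {fset I}) (B : I -> set R),
    (forall i, i \in J -> measurable (B i)) ->
    P (\bigcap_(i in [set` J]) (Y i @^-1` B i)) =
    (\big[*%E/1]_(i <- J) P (Y i @^-1` B i))%E.

(* Processes are indexed by all of [R], but only the times [t >= 0] are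
   constrained, and only those times are used below. Path properties hold for
   every outcome. *)
Record levy_process (X : R -> Omega -> R) : Prop := LevyProcess {
  levy_measurable : forall t : R, 0 <= t -> measurable_fun setT (X t) ;
  levy_start0 : forall w, X 0 w = 0 ;
  levy_right_continuous : forall w (t : R), 0 <= t ->
    X s w @[s --> t^'+] --> X t w ;
  levy_left_limits : forall w (t : R), 0 < t -> cvg (X s w @[s --> t^'-]) ;
  levy_stationary : forall (s t : R) (B : set R), 0 <= s -> s <= t ->
    measurable B ->
    P ((fun w => X t w - X s w) @^-1` B) = P (X (t - s) @^-1` B) ;
  levy_independent : forall t : nat -> R, 0 <= t 0%N ->
    {homo t : m n / (m <= n)%N >-> m <= n} ->
    mutually_independent (fun n w => X (t n.+1) w - X (t n) w) }.

Definition subordinator (X : R -> Omega -> R) : Prop :=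
  levy_process X /\
  (forall w (s t : R), 0 <= s -> s <= t -> X s w <= X t w).

End processes.

(* A measure on (0, +oo), encoded as a Borel measure on [R] that does not
   charge (-oo, 0]. *)
Definition levy_measure {R : realType}
    (Pi : {measure set (measurableTypeR R) -> \bar R}) : Prop :=
  Pi `]-oo, 0%R]%classic = 0%E /\
  (\int[Pi]_(x in `]0%R, +oo[) (Num.min 1 x)%:E < +oo)%E.

Definition laplace_exponent {R : realType} (drift : R)
    (Pi : {measure set (measurableTypeR R) -> \bar R}) (lambda : R) : \bar R :=
  ((drift * lambda)%:E +
   \int[Pi]_(x in `]0%R, +oo[) (1 - expR (- (lambda * x)))%:E)%E.

Definition has_characteristics {R : realType} {d : measure_display}
    {Omega : measurableType d} (P : probability Omega R)
    (X : R -> Omega -> R) (drift : R)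
    (Pi : {measure set (measurableTypeR R) -> \bar R}) : Prop :=
  [/\ 0 <= drift, levy_measure Pi &
    forall lambda : R, 0 <= lambda ->
      'E_P[fun w => expR (- (lambda * X 1%R w))]%E =
      expeR (- laplace_exponent drift Pi lambda)%E].

Definition levy_tail {R : realType}
    (Pi : {measure set (measurableTypeR R) -> \bar R}) (x : R) : \bar R :=
  Pi `]x, +oo[%classic.

Definition integrated_tail {R : realType}
    (Pi : {measure set (measurableTypeR R) -> \bar R}) (u : R) : \bar R :=
  (\int[lebesgue_measure]_(x in `]0%R, u]) levy_tail Pi x)%E.

Definition interval_cover {R : realType} (A : set R) (delta : R) (n : nat)
    : Prop :=
  exists a b : 'I_n -> R,
    (forall i, a i <= b i /\ b i - a i <= delta) /\
    A `<=` \bigcup_i `[a i, b i]%classic.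

(* The infimum is a minimum whenever [A] has a finite cover, in particular for
   bounded [A] and [delta > 0]. *)
Definition covering_number {R : realType} (A : set R) (delta : R) : R :=
  inf [set n%:R | n in [set n : nat | interval_cover A delta n]].

Section passage.
Context {R : realType} {d : measure_display} {Omega : measurableType d}.
Variables (P : probability Omega R) (X : R -> Omega -> R).

Definition range_covering_number (t delta : R) (w : Omega) : R :=
  covering_number [set X s w | s in `[0, t]%classic] delta.

Definition passage_time (delta : R) (w : Omega) : \bar R :=
  (\int[lebesgue_measure]_(t in `[0%R, +oo[)
     (\1_[set s | X s w <= delta] t)%:E)%E.

Definition renewal_function (delta : R) : \bar R :=
  (\int[P]_w passage_time delta w)%E.

(* ['V_P] takes real-valued variables; [fine] only alters [passage_time] where
   it is infinite, a null event when the process tends to +oo almost surely. *)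
Definition passage_variance (delta : R) : \bar R :=
  'V_P[fun w => fine (passage_time delta w)]%E.

Definition centering (delta : R) : R := (fine (renewal_function delta))^-1.

Definition scaling (delta : R) : R :=
  fine (renewal_function delta) `^ (- (3 / 2)) *
  Num.sqrt (fine (passage_variance delta)).

End passage.

Definition cvg_in_distribution {R : realType} {d : measure_display}
    {Omega : measurableType d} (P : probability Omega R) {I : Type}
    (F : set_system I) (Z : I -> Omega -> R)
    (mu : probability (measurableTypeR R) R) : Prop :=
  (\forall i \near F, measurable_fun setT (Z i)) /\
  forall f : R -> R, continuous f -> bounded_fun f ->
    ('E_P[f \o Z i])%E @[i --> F] --> (\int[mu]_x (f x)%:E)%E.

(* Main.v *)
(* Let T be the passage time above delta, U its mean and V its variance. The
   left endpoints of the greedy cover of the range regenerate, so N(t, delta) > n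
   iff T_1 + ... + T_n <= t for independent copies T_i of T. Instead of the strong
   Markov property, the process is sampled along the meshes t / 2^k, on which the
   greedy count satisfies a renewal recursion by independence of increments; the
   law of T_1 + ... + T_n then appears when the mesh vanishes, by sandwiching
   between expectations of monotone test functions.

   Chernoff bounds at lambda = 1 / delta give U ~ 1 / Phi(1 / delta) up to
   constants and E T^3 <= K U^3. The condition on I makes Phi(A / delta) at least
   32 A Phi(1 / delta) for some A, so T <= U / 2 has probability bounded away from
   0 and V >= c U^2. Hence the Lyapunov ratio of n summands is O(n^(-1/2)) with
   n ~ t / U -> oo, Lindeberg's replacement argument against a spline gives the
   normal limit of T_1 + ... + T_n, and inverting n against t gives that of N. *)

Require Import Defs.
From HB Require Import structures.
From mathcomp Require Import all_boot all_order all_algebra finmap.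
From mathcomp Require Import all_classical all_reals all_analysis.
From mathcomp Require Import measurable_realfun.
From mathcomp Require Import ring lra.

Set Implicit Arguments.
Unset Strict Implicit.
Unset Printing Implicit Defensive.

Import Order.TTheory GRing.Theory Num.Theory.
Import numFieldNormedType.Exports.

Local Open Scope classical_set_scope.
Local Open Scope ring_scope.

(** * Lindeberg replacement *)

(** The law of T changes with delta, so no limit theorem for one fixed sequence applies. Every
    estimate is made at a fixed delta, with constants that do not depend on it, and the only limit
    taken is U -> 0, which follows from U <= K / Phi(1 / delta) and the infinite Lévy measure.

    Independent copies of T are never constructed: a sum of n of them enters only through the n-th
    iterate of f -> E f(x + T). This operator is a contraction for the uniform distance and
    preserves both monotonicity and Taylor bounds; the replacement argument and the comparison with
    grids rest on these properties alone.

    The test function has to be monotone for the sandwich and to have a third-order Taylor bound for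
    the replacement. A cubic spline rising over a length 3 a has both, and the smoothing costs O(a)
    because the normal tail is Lipschitz.

    The number A in the growth of Phi is a power of 1 / 2: the gain is that Phi shrinks much less
    than linearly between 1 / delta and A / delta. *)

Section bounded_expectation.
Context {R : realType} {d : measure_display} {T : measurableType d}.
Variable P : probability T R.

Lemma bounded_integrable (f : T -> R) (K : R) :
  measurable_fun setT f -> (forall x, `|f x| <= K) ->
  P.-integrable setT (EFin \o f).
Proof.
move=> mf fK; apply: measurable_bounded_integrable => //.
  by rewrite [X in (X < _)%E]probability_setT ltry.
by exists K; split; [exact: num_real|move=> M KM x _; exact: le_trans (fK x) (ltW KM)].
Qed.

Lemma integrableZl_EFin (k : R) (f : T -> R) :
  P.-integrable setT (EFin \o f) ->
  P.-integrable setT (EFin \o (fun w => k * f w)).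
Proof. exact: (@integrableZl _ _ _ _ _ measurableT k (EFin \o f)). Qed.

Lemma integrableD_EFin (f g : T -> R) :
  P.-integrable setT (EFin \o f) -> P.-integrable setT (EFin \o g) ->
  P.-integrable setT (EFin \o (fun w => f w + g w)).
Proof. exact: (@integrableD _ _ _ _ _ measurableT (EFin \o f) (EFin \o g)). Qed.

Lemma integrableB_EFin (f g : T -> R) :
  P.-integrable setT (EFin \o f) -> P.-integrable setT (EFin \o g) ->
  P.-integrable setT (EFin \o (fun w => f w - g w)).
Proof. exact: (@integrableB _ _ _ _ _ measurableT (EFin \o f) (EFin \o g)). Qed.

Lemma RintegralT_cst (r : R) : \int[P]_x r = r.
Proof. by rewrite Rintegral_cst// [X in fine X]probability_setT mulr1. Qed.

Lemma ler_norm_Rintegral (f : T -> R) (K : R) :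
  measurable_fun setT f -> (forall x, `|f x| <= K) -> `|\int[P]_x f x| <= K.
Proof.
move=> mf fK; have If := @bounded_integrable f K mf fK.
rewrite (le_trans (le_normr_Rintegral _ If))// -[leRHS]RintegralT_cst.
apply: le_Rintegral => //; first exact: integrable_norm.
exact: finite_measure_integrable_cst.
Qed.

(* [iter n (shift_mean P Y) f x] is E f(x + Y_1 + ... + Y_n) for independent
   copies Y_i of Y, which need not be constructed. *)
Definition shift_mean (Y : T -> R) (f : R -> R) (x : R) : R :=
  \int[P]_w f (x + Y w).

Variable Y : T -> R.
Hypothesis mY : measurable_fun setT Y.
Local Notation A := (shift_mean Y).

Lemma measurable_shiftr (f : R -> R) (x : R) : measurable_fun setT f ->
  measurable_fun setT (fun w => f (x + Y w)).
Proof. by move=> mf; apply: measurableT_comp => //; exact: measurable_funD. Qed.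

Lemma integrable_shiftr (f : R -> R) (K x : R) : measurable_fun setT f ->
  (forall x, `|f x| <= K) -> P.-integrable setT (EFin \o (fun w => f (x + Y w))).
Proof.
by move=> mf fK; apply: (@bounded_integrable _ K) => //; exact: measurable_shiftr.
Qed.

Lemma shift_mean_bounded (f : R -> R) (K : R) : measurable_fun setT f ->
  (forall x, `|f x| <= K) -> forall x, `|A f x| <= K.
Proof.
by move=> mf fK x; apply: ler_norm_Rintegral => //; exact: measurable_shiftr.
Qed.

(** Tonelli's theorem gives measurability in [x] for nonnegative integrands; adding [K] makes the
    integrand nonnegative and the constant is subtracted afterwards. *)
Lemma measurable_shift_mean (f : R -> R) (K : R) : measurable_fun setT f ->
  (forall x, `|f x| <= K) -> measurable_fun setT (A f).
Proof.
move=> mf fK.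
have mg : measurable_fun setT (fun z : R * T => (f (z.1 + Y z.2) + K)%:E).
  apply/measurable_EFinP; apply: measurable_funD => //.
  apply: measurableT_comp => //; apply: measurable_funD => //.
  exact: measurableT_comp.
have g0 z : (0 <= (fun z : R * T => (f (z.1 + Y z.2) + K)%:E) z)%E.
  by rewrite lee_fin -lerBlDr sub0r; have := fK (z.1 + Y z.2); rewrite ler_norml => /andP[].
have := @measurable_fun_fubini_tonelli_F _ _ _ _ _ P _ mg g0.
rewrite /fubini_F /= => mF.
have -> : A f = (fun x => fine (\int[P]_y (f (x + Y y) + K)%:E)%E - K).
  apply/funext => x; have -> : fine (\int[P]_y (f (x + Y y) + K)%:E)%E = \int[P]_y (f (x + Y y) + K) by [].
  rewrite RintegralD//; last 2 first.
  - exact: (@integrable_shiftr f K).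
  - exact: finite_measure_integrable_cst.
  by rewrite RintegralT_cst addrK.
apply: measurable_funB => //; exact: measurableT_comp.
Qed.

Lemma shift_mean_dist (f g : R -> R) (K e : R) :
  measurable_fun setT f -> (forall x, `|f x| <= K) ->
  measurable_fun setT g -> (forall x, `|g x| <= K) ->
  (forall x, `|f x - g x| <= e) -> forall x, `|A f x - A g x| <= e.
Proof.
move=> mf fK mg gK fg x; rewrite /A -RintegralB//; last 2 first.
- exact: (@integrable_shiftr _ K).
- exact: (@integrable_shiftr _ K).
apply: ler_norm_Rintegral => //.
by apply: measurable_funB; exact: measurable_shiftr.
Qed.

Lemma iter_shift_mean_bounded n (f : R -> R) (K : R) : measurable_fun setT f ->
  (forall x, `|f x| <= K) ->
  measurable_fun setT (iter n A f) /\ (forall x, `|iter n A f x| <= K).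
Proof.
move=> mf fK; elim: n => [//|n [mn Kn]] /=; split.
  exact: (@measurable_shift_mean _ K).
exact: shift_mean_bounded.
Qed.

(** Averaging is a contraction for the uniform distance, so an error made at one replaced summand is
    not amplified by the others. *)
Lemma iter_shift_mean_dist n (f g : R -> R) (K e : R) :
  measurable_fun setT f -> (forall x, `|f x| <= K) ->
  measurable_fun setT g -> (forall x, `|g x| <= K) ->
  (forall x, `|f x - g x| <= e) -> forall x, `|iter n A f x - iter n A g x| <= e.
Proof.
move=> mf fK mg gK fg; elim: n => [//|n IH] /=.
have [mfn fnK] := iter_shift_mean_bounded n mf fK.
have [mgn gnK] := iter_shift_mean_bounded n mg gK.
exact: (@shift_mean_dist _ _ K).
Qed.

End bounded_expectation.

(* A stand-in for being three times differentiable with third derivative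
   bounded by [6 * M], stable under averages of translates. *)
Record taylor3 {R : realType} (M : R) (f f1 f2 : R -> R) : Prop := Taylor3 {
  taylor3_measurable : measurable_fun setT f ;
  taylor3_measurable1 : measurable_fun setT f1 ;
  taylor3_measurable2 : measurable_fun setT f2 ;
  taylor3_bounded : exists K, forall x,
    [/\ `|f x| <= K, `|f1 x| <= K & `|f2 x| <= K] ;
  taylor3_expansion : forall x y,
    `|f (x + y) - f x - y * f1 x - y ^+ 2 / 2 * f2 x| <= M * `|y| ^+ 3 }.

Section lindeberg.
Context {R : realType}.

Section one_summand.
Context {d : measure_display} {T : measurableType d}.
Variables (P : probability T R) (Y : T -> R).
Hypothesis mY : measurable_fun setT Y.

(** The expansion is linear in the triple and commutes with translations, so integrating it at
    [x + Y w] keeps the constant [M]. This is what allows the replacement to be iterated. *)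
Lemma taylor3_shift_mean M f f1 f2 : taylor3 M f f1 f2 ->
  taylor3 M (shift_mean P Y f) (shift_mean P Y f1) (shift_mean P Y f2).
Proof.
move=> [mf mf1 mf2 [K fK] ft].
have K0 x : `|f x| <= K by have [] := fK x.
have K1 x : `|f1 x| <= K by have [] := fK x.
have K2 x : `|f2 x| <= K by have [] := fK x.
split.
- exact: (@measurable_shift_mean _ _ _ _ _ _ _ K).
- exact: (@measurable_shift_mean _ _ _ _ _ _ _ K).
- exact: (@measurable_shift_mean _ _ _ _ _ _ _ K).
- by exists K => x; split; exact: shift_mean_bounded.
- move=> x y; rewrite /shift_mean.
  have I0 z := @integrable_shiftr _ _ _ P _ mY f K z mf K0.
  have I1 := @integrable_shiftr _ _ _ P _ mY f1 K x mf1 K1.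
  have I2 := @integrable_shiftr _ _ _ P _ mY f2 K x mf2 K2.
  rewrite -(RintegralZl y _ I1)// -(RintegralZl (y ^+ 2 / 2) _ I2)//.
  have J1 : P.-integrable setT (EFin \o (fun w => y * f1 (x + Y w))).
    exact: integrableZl_EFin.
  have J2 : P.-integrable setT (EFin \o (fun w => y ^+ 2 / 2 * f2 (x + Y w))).
    exact: (@integrableZl_EFin _ _ _ P (y ^+ 2 / 2) (fun w => f2 (x + Y w))).
  rewrite -RintegralB// -RintegralB//; last exact: integrableB_EFin.
  rewrite -RintegralB//; last exact/integrableB_EFin/J1/integrableB_EFin.
  apply: ler_norm_Rintegral => [|w].
    apply: measurable_funB; last by apply: measurable_funM => //; exact: measurable_shiftr.
    apply: measurable_funB; last by apply: measurable_funM => //; exact: measurable_shiftr.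
    by apply: measurable_funB; exact: measurable_shiftr.
  by rewrite (addrAC x); exact: ft.
Qed.

(** Domination by 1 + |y|^j, according to whether |y| <= 1. *)
Lemma integrable_pow_le (i j : nat) : (i <= j)%N ->
  P.-integrable setT (EFin \o (fun w => `|Y w| ^+ j)) ->
  P.-integrable setT (EFin \o (fun w => Y w ^+ i)).
Proof.
move=> ij Ij; apply: (@le_integrable _ _ _ _ _ measurableT _ (EFin \o (fun w => 1 + `|Y w| ^+ j))).
- by apply/measurable_EFinP; exact: measurable_funX.
- move=> w _ /=; rewrite lee_fin [leRHS]ger0_norm ?addr_ge0// normrX.
  have [Y1|/ltW Y1] := leP `|Y w| 1.
    by rewrite (@le_trans _ _ 1) ?exprn_ile1 ?lerDl ?exprn_ge0.
  by rewrite (@le_trans _ _ (`|Y w| ^+ j)) ?lerDr// ler_weXn2l.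
- have -> : EFin \o (fun w => 1 + `|Y w| ^+ j) = (EFin \o cst 1) \+ (EFin \o (fun w => `|Y w| ^+ j)) by [].
  by apply: integrableD_EFin => //; exact: finite_measure_integrable_cst.
Qed.

(** Only the first two moments of [Y] enter the main term, so two variables sharing them can be
    exchanged at the price of their third absolute moments. *)
Lemma shift_mean_taylor M f f1 f2 x : taylor3 M f f1 f2 ->
  P.-integrable setT (EFin \o (fun w => `|Y w| ^+ 3)) ->
  `|shift_mean P Y f x - (f x + (\int[P]_w Y w) * f1 x
     + (\int[P]_w (Y w) ^+ 2) / 2 * f2 x)|
  <= M * \int[P]_w (`|Y w| ^+ 3).
Proof.
move=> [mf mf1 mf2 [K fK] ft] I3.
have K0 x' : `|f x'| <= K by have [] := fK x'.
have I1 : P.-integrable setT (EFin \o (fun w => Y w ^+ 1)) by exact: (@integrable_pow_le _ 3).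
have I2 : P.-integrable setT (EFin \o (fun w => Y w ^+ 2)) by exact: (@integrable_pow_le _ 3).
have I1' : P.-integrable setT (EFin \o Y) by [].
have I0 := @integrable_shiftr _ _ _ P _ mY f K x mf K0.
have J1 : P.-integrable setT (EFin \o (fun w => Y w * f1 x)).
  by under [X in EFin \o X]funext do rewrite mulrC; exact: integrableZl_EFin.
have J2 : P.-integrable setT (EFin \o (fun w => Y w ^+ 2 * (f2 x / 2))).
  by under [X in EFin \o X]funext do rewrite mulrC; exact: integrableZl_EFin.
rewrite -(RintegralZl M _ I3)// -(RintegralZr (f1 x) _ I1')//.
rewrite -mulrA (mulrC 2^-1) -(RintegralZr (f2 x / 2) _ I2)//.
have C : P.-integrable setT (EFin \o (fun=> f x)) by exact: finite_measure_integrable_cst.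
rewrite -{1}(@RintegralT_cst _ _ _ P (f x)) -RintegralD// -RintegralD//; last exact: integrableD_EFin.
have J : P.-integrable setT (EFin \o (fun w => f x + Y w * f1 x + Y w ^+ 2 * (f2 x / 2))).
  exact/integrableD_EFin/J2/integrableD_EFin.
rewrite /shift_mean -RintegralB// (le_trans (le_normr_Rintegral _ _))//; first exact: integrableB_EFin.
apply: le_Rintegral => //; first exact/integrable_norm/integrableB_EFin.
  exact: integrableZl_EFin.
move=> w _; rewrite (le_trans _ (ft x (Y w)))//.
by rewrite le_eqVlt; apply/orP; left; apply/eqP; congr `| _ |; ring.
Qed.
End one_summand.

Theorem lindeberg {d : measure_display} {T : measurableType d}
    {d' : measure_display} {T' : measurableType d'}
    (P : probability T R) (Q : probability T' R) (Y : T -> R) (G : T' -> R)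
    (M : R) (f f1 f2 : R -> R) (n : nat) (x : R) :
  measurable_fun setT Y -> measurable_fun setT G ->
  P.-integrable setT (EFin \o (fun w => `|Y w| ^+ 3)) ->
  Q.-integrable setT (EFin \o (fun w => `|G w| ^+ 3)) ->
  \int[P]_w Y w = \int[Q]_w G w ->
  \int[P]_w (Y w) ^+ 2 = \int[Q]_w (G w) ^+ 2 ->
  taylor3 M f f1 f2 ->
  `|iter n (shift_mean P Y) f x - iter n (shift_mean Q G) f x|
  <= n%:R * (M * (\int[P]_w (`|Y w| ^+ 3) + \int[Q]_w (`|G w| ^+ 3))).
Proof.
move=> mY mG I3 J3 E1 E2; set e := M * _; elim: n f f1 f2 x => [|n IH] f f1 f2 x tf.
  by rewrite /= subrr normr0 mul0r.
(* The operator next to [f] is the one replaced. The mixed term, [n] averages over [Y] applied to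
   one average over [G], is close to the pure [Y] term by contraction, and to the pure [G] term by
   induction, since the average of [f] over [G] is again [taylor3]. *)
rewrite !iterSr.
have tA := taylor3_shift_mean P mY tf.
have tB := taylor3_shift_mean Q mG tf.
have [mA _ _ [KA AK] _] := tA.
have [mB _ _ [KB BK] _] := tB.
rewrite (le_trans (ler_distD (iter n (shift_mean P Y) (shift_mean Q G f) x) _ _))//.
rewrite -natr1 mulrDl mul1r addrC lerD//; first exact: (IH _ _ _ _ tB).
apply: (iter_shift_mean_dist P mY n (K := Num.max KA KB)) => //.
- by move=> y; have [Ay _ _] := AK y; rewrite le_max Ay.
- by move=> y; have [By _ _] := BK y; rewrite le_max By orbT.
- move=> y; have a := shift_mean_taylor mY y tf I3.
  have b := shift_mean_taylor mG y tf J3.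
  rewrite -E1 -E2 distrC in b.
  by rewrite /e mulrDr; exact: le_trans (ler_distD _ _ _) (lerD a b).
Qed.

End lindeberg.

(** * Gaussian averages *)

Section gaussian.
Context {R : realType}.
Local Notation mu := (@lebesgue_measure R).
Implicit Types (m s t x y z : R).

(** The Radon-Nikodym derivative of the normal law agrees almost everywhere with [normal_pdf], since
    both have the same integral over every measurable set. *)
Lemma ge0_integral_normal_prob m s (f : R -> \bar R) :
  (forall x, 0 <= f x)%E -> measurable_fun setT f ->
  (\int[normal_prob m s]_x f x = \int[mu]_x (f x * (normal_pdf m s x)%:E))%E.
Proof.
move=> f0 mf; set nu := normal_prob m s.
have dom : nu `<< mu := normal_prob_dominates m s.
have mp : measurable_fun setT (fun x : R => (normal_pdf m s x)%:E).
  by apply/measurable_EFinP; exact: measurable_normal_pdf.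
rewrite -(Radon_Nikodym_SigmaFinite.change_of_variables dom f0 measurableT mf).
have IRN := Radon_Nikodym_SigmaFinite.f_integrable dom.
apply: ae_eq_integral => //.
- by apply: emeasurable_funM => //; exact: measurable_int IRN.
- exact: emeasurable_funM.
- apply: ae_eqe_mul2l; apply: integral_ae_eq => //.
  by move=> E _ mE; rewrite -Radon_Nikodym_SigmaFinite.f_integral.
Qed.

Lemma normal_pdf_exp m s x : s != 0 ->
  normal_pdf m s x = normal_peak s * expR (- (x - m) ^+ 2 / (s ^+ 2 *+ 2)).
Proof. by move=> s0; rewrite normal_pdfE. Qed.

Lemma integral_normal_prob_shift x s (f : R -> R) : s != 0 ->
  continuous f -> (forall y, 0 <= f y) ->
  (\int[normal_prob 0 s]_y (f (x + y))%:E = \int[normal_prob x s]_y (f y)%:E)%E.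
Proof.
move=> s0 cf f0.
have mf : measurable_fun setT f := continuous_measurable_fun cf.
rewrite !ge0_integral_normal_prob; last 4 first.
- by move=> y; rewrite lee_fin.
- exact/measurable_EFinP.
- by move=> y; rewrite lee_fin.
- by apply/measurable_EFinP/measurableT_comp => //; exact: measurable_funD.
rewrite [RHS](@increasing_ge0_integration_by_substitutionT _ (fun y : R^o => x + y)
  (fun y => f y * normal_pdf x s y)); last 9 first.
- by move=> a b ab; rewrite ltrD2l.
- have -> : (fun y : R^o => x + y)^`()%classic = cst 1.
    by apply/funext => y; rewrite derive1E deriveD// derive_cst derive_id add0r.
  by move=> y; exact: cvg_cst.
- have -> : (fun y : R^o => x + y)^`()%classic = cst 1.
    by apply/funext => y; rewrite derive1E deriveD// derive_cst derive_id add0r.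
  exact: is_cvg_cst.
- have -> : (fun y : R^o => x + y)^`()%classic = cst 1.
    by apply/funext => y; rewrite derive1E deriveD// derive_cst derive_id add0r.
  exact: is_cvg_cst.
- by move=> y; apply: derivableD.
- exact: cvg_addrl_Ny.
- exact: cvg_addrl.
- by move=> y; apply: cvgM; [exact: cf|exact: continuous_normal_pdf].
- by move=> y; rewrite mulr_ge0// normal_pdf_ge0.
apply: eq_integral => y _; rewrite -EFinM; congr EFin; rewrite /=.
have -> : (fun y : R^o => x + y)^`()%classic = cst 1.
  by apply/funext => z; rewrite derive1E deriveD// derive_cst derive_id add0r.
rewrite !fctE /= mulr1; congr (_ * _); rewrite !normal_pdf_exp//.
by rewrite subr0 addrAC subrr add0r.
Qed.

Lemma normal_peakM s t : 0 < s -> 0 < t ->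
  normal_peak s * normal_peak t =
  normal_peak (Num.sqrt (s ^+ 2 + t ^+ 2)) *
  normal_peak (s * t / Num.sqrt (s ^+ 2 + t ^+ 2)).
Proof.
move=> s0 t0; have r0 : 0 < s ^+ 2 + t ^+ 2 by rewrite addr_gt0// exprn_gt0.
rewrite /normal_peak -!invfM -!sqrtrM ?mulrn_wge0// ?mulr_ge0 ?sqr_ge0 ?pi_ge0//.
rewrite !expr_div_n exprMn sqr_sqrtr ?ltW//; congr (Num.sqrt _)^-1.
- by field; rewrite gt_eqF.
- exact: ltW.
- exact: ltW.
Qed.

(** [S] and [T] are variances and [v] is the centred sum; the last square displays the conditional
    mean S v / (S + T) and variance S T / (S + T) of [z] given [v]. *)
Lemma complete_square (F : realFieldType) (S T v z : F) : 0 < S -> 0 < T ->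
  - (v - z) ^+ 2 / (T *+ 2) + - z ^+ 2 / (S *+ 2) =
  - v ^+ 2 / ((S + T) *+ 2) +
  - (z - S * v / (S + T)) ^+ 2 / (S * T / (S + T) *+ 2).
Proof.
move=> S0 T0; have E (a : F) : a *+ 2 = a * 2 by rewrite mulr_natr.
rewrite (E T) (E S) (E (S + T)) (E (S * T / (S + T))).
have r0 : S + T != 0 by rewrite gt_eqF ?addr_gt0.
have S1 : S != 0 by rewrite gt_eqF.
have T1 : T != 0 by rewrite gt_eqF.
by field; rewrite r0 S1 T1.
Qed.

(** The joint density of the first Gaussian and of the sum, factored as the law of the sum times the
    conditional law of the first variable. The second factor integrates to 1 in [z], which yields
    the convolution formula. *)
Lemma normal_pdf_mul x s t z u : 0 < s -> 0 < t ->
  let r := Num.sqrt (s ^+ 2 + t ^+ 2) in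
  normal_pdf (x + z) t u * normal_pdf 0 s z =
  normal_pdf x r u * normal_pdf (s ^+ 2 * (u - x) / r ^+ 2) (s * t / r) z.
Proof.
move=> s0 t0 r; have r0 : 0 < s ^+ 2 + t ^+ 2 by rewrite addr_gt0// exprn_gt0.
have rp : 0 < r by rewrite sqrtr_gt0.
have r2 : r ^+ 2 = s ^+ 2 + t ^+ 2 by rewrite sqr_sqrtr ?ltW.
rewrite !normal_pdf_exp ?gt_eqF ?divr_gt0 ?mulr_gt0//.
rewrite !subr0 mulrACA [RHS]mulrACA -!expRD -normal_peakM// (mulrC (normal_peak t)).
congr (_ * expR _); rewrite !expr_div_n !exprMn r2.
by rewrite -complete_square ?exprn_gt0// opprD addrA.
Qed.

Lemma normal_convolution x s t (f : R -> R) : 0 < s -> 0 < t ->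
  continuous f -> (forall y, 0 <= f y) ->
  (\int[normal_prob 0 s]_z \int[normal_prob 0 t]_y (f (x + z + y))%:E =
   \int[normal_prob 0 (Num.sqrt (s ^+ 2 + t ^+ 2))]_y (f (x + y))%:E)%E.
Proof.
move=> s0 t0 cf f0.
have mf : measurable_fun setT f := continuous_measurable_fun cf.
have r0 : 0 < Num.sqrt (s ^+ 2 + t ^+ 2) by rewrite sqrtr_gt0 addr_gt0// exprn_gt0.
under eq_integral do rewrite (integral_normal_prob_shift _ (lt0r_neq0 t0) cf f0).
apply/esym; transitivity (\int[normal_prob x (Num.sqrt (s ^+ 2 + t ^+ 2))]_y (f y)%:E)%E.
  exact: (integral_normal_prob_shift x (lt0r_neq0 r0) cf f0).
apply/esym; have mEf : measurable_fun setT (EFin \o f) by exact/measurable_EFinP.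
have Ef0 y : (0 <= (f y)%:E)%E by rewrite lee_fin.
have mp : measurable_fun setT (fun z : R * R => f z.2 * normal_pdf (x + z.1) t z.2).
  apply: measurable_funM; first exact: measurableT_comp.
  under eq_fun do rewrite normal_pdf_exp ?gt_eqF//.
  apply: measurable_funM => //; apply: measurableT_comp => //.
  apply: measurable_funM => //; apply: measurableT_comp => //.
  apply: measurable_funX; apply: measurable_funB => //.
  exact: measurable_funD.
have g0 (z : R * R) : (0 <= (f z.2 * normal_pdf (x + z.1) t z.2)%:E)%E.
  by rewrite lee_fin mulr_ge0 ?normal_pdf_ge0.
have mh : measurable_fun setT (fun z : R => \int[normal_prob (x + z) t]_y (f y)%:E)%E.
  under eq_fun do rewrite ge0_integral_normal_prob//.
  apply: (@measurable_fun_fubini_tonelli_F _ _ _ _ _ mu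
    (fun z : R * R => (f z.2 * normal_pdf (x + z.1) t z.2)%:E)) => //.
  exact/measurable_EFinP.
rewrite [LHS]ge0_integral_normal_prob//; last by move=> z; exact: integral_ge0.
rewrite [RHS](ge0_integral_normal_prob x _ Ef0 mEf).
transitivity (\int[mu]_z \int[mu]_u
   (f u * normal_pdf (x + z) t u * normal_pdf 0 s z)%:E)%E.
  apply: eq_integral => z _; rewrite ge0_integral_normal_prob//.
  rewrite -ge0_integralZr//.
  - apply/measurable_EFinP; apply: measurable_funM => //.
    exact: measurable_normal_pdf.
  - by move=> y _; rewrite -EFinM lee_fin mulr_ge0 ?normal_pdf_ge0.
  - by rewrite lee_fin normal_pdf_ge0.
have -> := (@fubini_tonelli _ _ _ _ _ mu mu
  (fun z : R * R => (f z.2 * normal_pdf (x + z.1) t z.2 * normal_pdf 0 s z.1)%:E)).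
- apply: eq_integral => u _ /=.
  under eq_integral do rewrite -mulrA normal_pdf_mul// mulrA EFinM.
  rewrite ge0_integralZl//.
  + by rewrite integral_normal_pdf mule1.
  + by apply/measurable_EFinP; exact: measurable_normal_pdf.
  + by move=> y _; rewrite lee_fin normal_pdf_ge0.
  + by rewrite lee_fin mulr_ge0 ?normal_pdf_ge0.
- apply/measurable_EFinP; apply: measurable_funM => //.
  by apply: measurableT_comp => //; exact: measurable_normal_pdf.
- by move=> z; rewrite lee_fin !mulr_ge0 ?normal_pdf_ge0.
Qed.

End gaussian.

(** * Gaussian moments read off the Laplace transform *)

Section gaussian_moments.
Context {R : realType}.
Local Notation mu := (@lebesgue_measure R).

(** Each convolution adds the variance s^2. *)
Lemma iter_normal_shift_mean n (s : R) (f : R -> R) (x : R) : 0 < s ->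
  continuous f -> (forall y, 0 <= f y <= 1) ->
  iter n.+1 (shift_mean (normal_prob 0 s) idfun) f x =
  \int[normal_prob 0 (s * Num.sqrt n.+1%:R)]_y f (x + y).
Proof.
move=> s0 cf f01; elim: n x => [|n IH] x.
  by rewrite /= sqrtr1 mulr1.
have f0 y : 0 <= f y by have /andP[] := f01 y.
have mf : measurable_fun setT f := continuous_measurable_fun cf.
rewrite iterS; transitivity (\int[normal_prob 0 s]_z
    \int[normal_prob 0 (s * Num.sqrt n.+1%:R)]_y f (x + z + y)).
  by apply: eq_Rintegral => z _; exact: IH.
have sn0 : 0 < s * Num.sqrt n.+1%:R by rewrite mulr_gt0// sqrtr_gt0 ltr0n.
rewrite /Rintegral; apply: (congr1 (@fine R)).
have -> : s * Num.sqrt n.+2%:R = Num.sqrt (s ^+ 2 + (s * Num.sqrt n.+1%:R) ^+ 2).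
  rewrite exprMn sqr_sqrtr ?ler0n// -[X in X + _]mulr1 -mulrDr.
  by rewrite sqrtrM ?sqr_ge0// sqrtr_sqr gtr0_norm// nat1r.
refine (etrans _ (normal_convolution x s0 sn0 cf f0)).
apply: eq_integral => z _; rewrite fineK//.
apply: (@integrable_fin_num _ _ _ _ setT measurableT).
apply: (@bounded_integrable _ _ _ (normal_prob 0 (s * Num.sqrt n.+1%:R)) (fun y => f (x + z + y)) 1).
- by apply: measurableT_comp => //; exact: measurable_funD.
- by move=> y; rewrite ger0_norm//; have /andP[] := f01 (x + z + y).
Qed.

Section fixed_deviation.
Variable s : R.
Hypothesis s0 : 0 < s.
Local Notation N := (normal_prob 0 s).

(** Exponential tilting: e^(l y) times the density is a constant times the normal density of mean l
    s^2. *)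
Lemma integral_expR_normal (l : R) :
  (\int[N]_y (expR (l * y))%:E = (expR (l ^+ 2 * s ^+ 2 / 2))%:E)%E.
Proof.
rewrite ge0_integral_normal_prob; last 2 first.
- by move=> y; rewrite lee_fin expR_ge0.
- by apply/measurable_EFinP; apply: measurableT_comp => //.
transitivity (\int[mu]_y ((expR (l ^+ 2 * s ^+ 2 / 2))%:E *
    (normal_pdf (l * s ^+ 2) s y)%:E))%E.
  apply: eq_integral => y _; rewrite -!EFinM; congr EFin.
  rewrite !normal_pdf_exp ?gt_eqF// mulrCA [RHS]mulrCA -!expRD.
  congr (_ * expR _); have E (a : R) : a *+ 2 = a * 2 by rewrite mulr_natr.
  by rewrite (E (s ^+ 2)); field; rewrite gt_eqF.
rewrite ge0_integralZl//.
- by rewrite integral_normal_pdf mule1.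
- by apply/measurable_EFinP; exact: measurable_normal_pdf.
- by move=> y _; rewrite lee_fin normal_pdf_ge0.
Qed.

Lemma integrable_expR_normal (l : R) :
  N.-integrable setT (EFin \o (fun y => expR (l * y))).
Proof.
apply/integrableP; split.
  by apply/measurable_EFinP; apply: measurableT_comp => //.
under eq_integral do rewrite /= ger0_norm ?expR_ge0//.
by rewrite integral_expR_normal ltry.
Qed.

Lemma Rintegral_expR_normal (l : R) :
  \int[N]_y expR (l * y) = expR (l ^+ 2 * s ^+ 2 / 2).
Proof. by rewrite /Rintegral integral_expR_normal. Qed.

(** Dominates |y|^3 e^(l |y|) for 0 <= l <= 1 / s: the 6 is 3! from the cubic term of e^(|y| / s),
    and the exponent 2 / s leaves room for e^(l |y|). Its integral is the source of the constant
    [12 * expR 2]. *)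
Let W (y : R) : R := 6 * s ^+ 3 * (expR (2 / s * y) + expR (- (2 / s) * y)).

Let integrableW : N.-integrable setT (EFin \o W).
Proof.
apply: integrableZl_EFin; apply: integrableD_EFin; exact: integrable_expR_normal.
Qed.

Let integralW : \int[N]_y W y = 12 * expR 2 * s ^+ 3.
Proof.
rewrite RintegralZl//; last by apply: integrableD_EFin; exact: integrable_expR_normal.
rewrite RintegralD//; [|exact: integrable_expR_normal|exact: integrable_expR_normal].
rewrite !Rintegral_expR_normal.
have -> : (2 / s) ^+ 2 * s ^+ 2 / 2 = 2 by field; rewrite gt_eqF.
have -> : (- (2 / s)) ^+ 2 * s ^+ 2 / 2 = 2 by field; rewrite gt_eqF.
by ring.
Qed.

Let cube_le_W (l y : R) : 0 <= l <= s^-1 -> `|y| ^+ 3 * expR (l * `|y|) <= W y.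
Proof.
move=> /andP[l0 ls].
have h1 : `|y| ^+ 3 <= 6 * s ^+ 3 * expR (`|y| / s).
  have ys : 0 <= `|y| / s by rewrite divr_ge0// ltW.
  have := expR_ge1Dxn 2 ys.
  rewrite (_ : (3`!)%:R = 6 :> R)//.
  rewrite expr_div_n => h.
  have {}h : `|y| ^+ 3 / s ^+ 3 / 6 <= expR (`|y| / s) by apply: le_trans h; rewrite lerDr.
  move: h; rewrite !ler_pdivrMr ?exprn_gt0// => h; apply: (le_trans h).
  by rewrite le_eqVlt; apply/orP; left; apply/eqP; ring.
apply: (@le_trans _ _ (6 * s ^+ 3 * expR (`|y| / s) * expR (`|y| / s))).
  rewrite ler_pM ?exprn_ge0 ?expR_ge0// ler_expR mulrC ler_wpM2l//.
have s3 : 0 <= 6 * s ^+ 3 by rewrite mulr_ge0// exprn_ge0// ltW.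
rewrite -mulrA -expRD /W ler_wpM2l//.
have [y0|y0] := leP 0 y.
  rewrite (_ : 2 / s * y = `|y| / s + `|y| / s) ?lerDl ?expR_ge0//.
  by rewrite ger0_norm//; field; rewrite gt_eqF.
rewrite (_ : - (2 / s) * y = `|y| / s + `|y| / s) ?lerDr ?expR_ge0//.
by rewrite ltr0_norm//; field; rewrite gt_eqF.
Qed.

Lemma integrable_cube_normal : N.-integrable setT (EFin \o (fun y => `|y| ^+ 3)).
Proof.
apply: (le_integrable measurableT _ _ integrableW).
- by apply/measurable_EFinP; apply: measurable_funX.
- move=> y _ /=; rewrite lee_fin ger0_norm ?exprn_ge0//.
  rewrite (le_trans _ (ler_norm _))//; have := @cube_le_W 0 y.
  by rewrite lexx invr_ge0 ltW// mul0r expR0 mulr1 => /(_ isT).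
Qed.

Lemma Rintegral_cube_normal_le : \int[N]_y (`|y| ^+ 3) <= 12 * expR 2 * s ^+ 3.
Proof.
rewrite -integralW; apply: le_Rintegral => //; first exact: integrable_cube_normal.
move=> y _; have := @cube_le_W 0 y.
by rewrite lexx invr_ge0 ltW// mul0r expR0 mulr1 => /(_ isT).
Qed.

Let integrable_id : N.-integrable setT (EFin \o (fun y : R => y)).
Proof.
have := @integrable_pow_le _ _ _ N idfun (@measurable_id _ _ _) 1 3 isT integrable_cube_normal.
by under [X in EFin \o X]eq_fun do rewrite expr1.
Qed.

Let integrable_sqr : N.-integrable setT (EFin \o (fun y : R => y ^+ 2)).
Proof.
exact: (@integrable_pow_le _ _ _ N idfun (@measurable_id _ _ _) 2 3 isT integrable_cube_normal).
Qed.

Let expR_le_quad (q : R) : 0 <= q <= 2^-1 -> expR q <= 1 + q + 2 * q ^+ 2.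
Proof.
move=> /andP[q0 q2].
have q1 : 0 < 1 - q by lra.
have h : expR q <= (1 - q)^-1.
  rewrite -[leLHS]invrK -expRN lef_pV2 ?posrE ?expR_gt0//.
  exact: expR_ge1Dx.
apply: (le_trans h); rewrite -[leLHS]mul1r ler_pdivrMr//.
rewrite -subr_ge0 (_ : _ - _ = q ^+ 2 * (1 - 2 * q)); last by ring.
by rewrite mulr_ge0 ?sqr_ge0//; lra.
Qed.

Let small_l (e : R) : 0 < e -> exists l, [/\ 0 < l, l <= s^-1 & l <= e].
Proof.
move=> e0; exists (Num.min s^-1 e); split.
- by rewrite lt_min invr_gt0 s0.
- by rewrite ge_min lexx.
- by rewrite ge_min lexx orbT.
Qed.

Let q_le (l : R) : 0 <= l <= s^-1 -> 0 <= l ^+ 2 * s ^+ 2 / 2 <= 2^-1.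
Proof.
move=> /andP[l0 ls]; have h0 : 0 <= l * s by rewrite mulr_ge0// ltW.
have h1 : l * s <= 1 by rewrite -ler_pdivlMr// div1r.
have := exprn_ile1 2 h0 h1; have := sqr_ge0 (l * s); rewrite exprMn.
by move=> ? ?; apply/andP; split; lra.
Qed.

(** From e^z >= 1 + z, l E(Y) <= E(e^(l Y)) - 1 for both signs of l. The right-hand side is O(l^2),
    so dividing by l and letting it tend to 0 squeezes the mean. *)
Lemma Rintegral_id_normal : \int[N]_y y = 0.
Proof.
have key (l : R) : l * \int[N]_y y <= expR (l ^+ 2 * s ^+ 2 / 2) - 1.
  rewrite -Rintegral_expR_normal -[X in _ - X](@RintegralT_cst _ _ _ N 1).
  have I1 := integrable_expR_normal l.
  have I2 : N.-integrable setT (EFin \o (fun=> 1)) by exact: finite_measure_integrable_cst.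
  rewrite -RintegralB// -RintegralZl//; apply: le_Rintegral => //.
  - exact: integrableZl_EFin.
  - exact: integrableB_EFin.
  - by move=> y _; have := expR_ge1Dx (l * y); lra.
have key2 l : 0 < l -> l <= s^-1 -> `| \int[N]_y y | <= l * s ^+ 2.
  move=> l0 ls; have ql : 0 <= l <= s^-1 by rewrite ltW.
  have := key l; have := key (- l); rewrite sqrrN mulNr.
  have /andP[] := q_le ql; set q := _ / 2 => q0 q1.
  have := @expR_le_quad q; rewrite q0 q1 => /(_ isT) hq h1 h2.
  have q2 : 2 * q ^+ 2 <= q by rewrite expr2 mulrA -[leRHS]mul1r ler_wpM2r//; lra.
  have qE : 2 * q = l * (l * s ^+ 2) by rewrite /q; field.
  rewrite ler_norml -(ler_pM2l l0) -(ler_pM2l l0 _ (l * s ^+ 2)).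
  by apply/andP; split; lra.
apply/eqP; rewrite -normr_le0; apply/ler_addgt0Pl => e e0; rewrite addr0.
have es : 0 < e / s ^+ 2 by rewrite divr_gt0// exprn_gt0.
have [l [l0 ls le]] := small_l es.
by apply: (le_trans (key2 l l0 ls)); rewrite -ler_pdivlMr ?exprn_gt0.
Qed.

(** The second difference of the exponential isolates v^2 up to third order. With E = e^v it equals
    (E - 1)^2 / E, so the bounds 1 + v <= E and 1 - v <= 1 / E suffice. *)
Let cosh_bounds (v : R) :
  v ^+ 2 - `|v| ^+ 3 <= expR v + expR (- v) - 2 <= v ^+ 2 + `|v| ^+ 3 * expR `|v|.
Proof.
wlog v0 : v / 0 <= v.
  move=> h; have [|v0] := leP 0 v; first exact: h.
  have := h (- v); rewrite sqrrN normrN opprK addrC (addrC (expR _)); apply.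
  by rewrite oppr_ge0 ltW.
rewrite ger0_norm//; set E := expR v; rewrite expRN -/E.
have E1 : 1 + v <= E by exact: expR_ge1Dx.
have E0 : 0 < E by exact: expR_gt0.
have E2 : 1 - v <= E^-1 by rewrite -expRN expR_ge1Dx.
have -> : E + E^-1 - 2 = (E - 1) ^+ 2 * E^-1 by field; rewrite gt_eqF.
have V2 : v ^+ 2 <= (E - 1) ^+ 2 by rewrite ler_pXn2r ?nnegrE//; lra.
have EV : E * E^-1 = 1 by rewrite mulfV// gt_eqF.
have W0 : 0 <= 1 - E^-1 <= v.
  rewrite subr_ge0 invf_le1//; apply/andP; split; lra.
apply/andP; split.
  apply: (@le_trans _ _ (v ^+ 2 * E^-1)).
    rewrite (_ : _ - _ = v ^+ 2 * (1 - v)); last by ring.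
    by rewrite ler_wpM2l ?sqr_ge0.
  by rewrite ler_wpM2r// invr_ge0 ltW.
have -> : (E - 1) ^+ 2 * E^-1 = E * (1 - E^-1) ^+ 2 by field; rewrite gt_eqF.
apply: (@le_trans _ _ (E * v ^+ 2)).
  by move: W0 => /andP[W0 W1]; rewrite ler_pM2l// ler_pXn2r ?nnegrE.
have h : E <= 1 + v * E.
  have : E * (1 - E^-1) <= E * v by rewrite ler_pM2l//; case/andP: W0.
  by rewrite mulrBr EV mulr1; lra.
rewrite (_ : v ^+ 2 + _ = v ^+ 2 * (1 + v * E)); last by ring.
by rewrite mulrC ler_wpM2l ?sqr_ge0.
Qed.

(** The second difference of the Laplace transform at 0 is divided by l^2; the cubic errors are
    integrated against [W] and vanish with l. *)
Lemma Rintegral_sqr_normal : \int[N]_y y ^+ 2 = s ^+ 2.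
Proof.
set v := \int[N]_y _; set C := 12 * expR 2 * s ^+ 3.
have C0 : 0 <= C by rewrite /C !mulr_ge0 ?expR_ge0 ?exprn_ge0 ?(ltW s0).
have main l : 0 < l -> l <= s^-1 ->
  l ^+ 2 * v - l ^+ 3 * C <= expR (l ^+ 2 * s ^+ 2 / 2) * 2 - 2 <=
  l ^+ 2 * v + l ^+ 3 * C.
  move=> l0 ls.
  have I1 := integrable_expR_normal l.
  have I2 := integrable_expR_normal (- l).
  have Ic : N.-integrable setT (EFin \o (fun=> 2)) by exact: finite_measure_integrable_cst.
  have I3 := integrableD_EFin I1 I2.
  have I4 : N.-integrable setT (EFin \o (fun y => l ^+ 2 * y ^+ 2)) by exact: integrableZl_EFin.
  have I5 : N.-integrable setT (EFin \o (fun y => l ^+ 3 * W y)) by exact: integrableZl_EFin.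
  have <- : \int[N]_y (expR (l * y) + expR (- l * y) - 2) =
            expR (l ^+ 2 * s ^+ 2 / 2) * 2 - 2.
    rewrite RintegralB// RintegralD// RintegralT_cst !Rintegral_expR_normal.
    by rewrite sqrrN; ring.
  rewrite /C -integralW /v -(RintegralZl (l ^+ 2) _ integrable_sqr)//.
  rewrite -(RintegralZl (l ^+ 3) _ integrableW)// -RintegralB// -RintegralD//.
  have l3 y : `|l * y| ^+ 3 = l ^+ 3 * `|y| ^+ 3.
    by rewrite normrM exprMn (gtr0_norm l0).
  have W1 y : `|y| ^+ 3 <= W y.
    have := @cube_le_W 0 y.
    by rewrite lexx invr_ge0 ltW// mul0r expR0 mulr1 => /(_ isT).
  apply/andP; split; apply: le_Rintegral => //.
  - exact: integrableB_EFin.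
  - exact: integrableB_EFin.
  - move=> y _; have /andP[h _] := cosh_bounds (l * y).
    rewrite mulNr (le_trans _ h)// exprMn lerD2l lerN2 l3.
    by rewrite ler_pM2l// exprn_gt0.
  - exact: integrableB_EFin.
  - exact: integrableD_EFin.
  - move=> y _; have /andP[_ h] := cosh_bounds (l * y).
    rewrite mulNr (le_trans h)// exprMn lerD2l l3 -mulrA.
    rewrite ler_pM2l ?exprn_gt0// normrM (gtr0_norm l0) cube_le_W//.
    by rewrite ltW.
have key l : 0 < l -> l <= s^-1 -> `|v - s ^+ 2| <= l * (C + s ^+ 3).
  move=> l0 ls; have /andP[m1 m2] := main l l0 ls.
  have ql : 0 <= l <= s^-1 by rewrite ltW.
  have /andP[] := q_le ql; set q := _ / 2 in m1 m2 * => q0 q1.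
  have := @expR_le_quad q; rewrite q0 q1 => /(_ isT) hq.
  have hq' := expR_ge1Dx q.
  have qE : 2 * q = l ^+ 2 * s ^+ 2 by rewrite /q; field.
  have q2 : 4 * q ^+ 2 <= l ^+ 2 * (l * s ^+ 3).
    rewrite (_ : 4 * q ^+ 2 = l ^+ 2 * (l * s ^+ 3) * (l * s)); last by rewrite /q; field.
    rewrite -[leRHS]mulr1 ler_wpM2l//.
      by rewrite !mulr_ge0 ?sqr_ge0 ?exprn_ge0// ltW.
    by rewrite -ler_pdivlMr// div1r.
  have l2 : 0 < l ^+ 2 by rewrite exprn_gt0.
  have l3 : 0 <= l ^+ 2 * (l * s ^+ 3) by rewrite !mulr_ge0 ?exprn_ge0// ltW.
  have eC : l ^+ 3 * C = l ^+ 2 * (l * C) by ring.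
  rewrite ler_norml -(ler_pM2l l2) -(ler_pM2l l2 (v - _)).
  rewrite !mulrBr mulrN !mulrDr -qE; apply/andP; split; lra.
apply/eqP; rewrite -subr_eq0 -normr_le0; apply/ler_addgt0Pl => e e0; rewrite addr0.
have K0 : 0 < C + s ^+ 3 by rewrite ltr_wpDl// exprn_gt0.
have [l [l0 ls le]] := small_l (divr_gt0 e0 K0).
by apply: (le_trans (key l l0 ls)); rewrite -ler_pdivlMr.
Qed.

End fixed_deviation.
End gaussian_moments.

(** * A spline step function *)

Section spline.
Context {R : realType}.
Implicit Types x y : R.

Definition posp (x : R) : R := Num.max x 0.

Lemma posp_pos x : 0 <= x -> posp x = x.
Proof. by move=> x0; rewrite /posp; apply/max_idPl. Qed.

Lemma posp_neg x : x <= 0 -> posp x = 0.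
Proof. by move=> x0; rewrite /posp; apply/max_idPr. Qed.

Lemma continuous_posp : continuous posp.
Proof. by move=> x; apply: continuous_max; [exact: cvg_id|exact: cvg_cst]. Qed.

(** The cube of the positive part has second derivative 6 x^+, which is Lipschitz with constant 6,
    hence a remainder of at most |y|^3. *)
Lemma posp_cube_taylor x y :
  `|posp (x + y) ^+ 3 - posp x ^+ 3 - y * (3 * posp x ^+ 2)
    - y ^+ 2 / 2 * (6 * posp x)| <= `|y| ^+ 3.
Proof.
have [x0|x0] := leP 0 x; have [xy0|xy0] := leP 0 (x + y).
- rewrite !posp_pos// -normrX (_ : _ - _ = y ^+ 3)//; by field.
- rewrite (posp_pos x0) (posp_neg (ltW xy0)).
  have y0 : y < 0 by lra.
  rewrite (ltr0_norm y0) (_ : _ - _ = (- (x + y)) ^+ 3 - (- y) ^+ 3); last by field.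
  have h1 : (- (x + y)) ^+ 3 <= (- y) ^+ 3 by rewrite lerXn2r ?nnegrE//; lra.
  have h2 : 0 <= (- (x + y)) ^+ 3 by rewrite exprn_ge0//; lra.
  by rewrite ler_norml; apply/andP; split; lra.
- rewrite (posp_neg (ltW x0)) (posp_pos xy0).
  have y0 : 0 < y by lra.
  rewrite (gtr0_norm y0) (_ : _ - _ = (x + y) ^+ 3); last by ring.
  have h2 : 0 <= (x + y) ^+ 3 by rewrite exprn_ge0.
  by rewrite ger0_norm// lerXn2r ?nnegrE//; lra.
- rewrite (posp_neg (ltW x0)) (posp_neg (ltW xy0)).
  by rewrite (_ : _ - _ = 0) ?normr0 ?exprn_ge0//; ring.
Qed.

(* The distribution function of the sum of three independent uniform variables
   on [0, 1]: a twice differentiable step from 0 to 1 across [0, 3]. *)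
Definition step3 x : R :=
  (posp x ^+ 3 - 3 * posp (x - 1) ^+ 3 + 3 * posp (x - 2) ^+ 3
   - posp (x - 3) ^+ 3) / 6.
Definition step3' x : R :=
  (posp x ^+ 2 - 3 * posp (x - 1) ^+ 2 + 3 * posp (x - 2) ^+ 2
   - posp (x - 3) ^+ 2) / 2.
Definition step3'' x : R :=
  posp x - 3 * posp (x - 1) + 3 * posp (x - 2) - posp (x - 3).

Lemma step3_le0 x : x <= 0 -> step3 x = 0.
Proof. by move=> x0; rewrite /step3 !posp_neg ?expr0n/=; [ring|lra..]. Qed.

Lemma step3_le1 x : 0 <= x <= 1 -> step3 x = x ^+ 3 / 6.
Proof.
move=> /andP[x0 x1]; rewrite /step3 (posp_pos x0) !posp_neg ?expr0n/=; [ring|lra..].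
Qed.

Lemma step3_le2 x : 1 <= x <= 2 -> step3 x = (x ^+ 3 - 3 * (x - 1) ^+ 3) / 6.
Proof.
move=> /andP[x1 x2]; rewrite /step3 (@posp_pos x) ?(@posp_pos (x - 1)); [|lra..].
by rewrite !posp_neg ?expr0n/=; [ring|lra..].
Qed.

Lemma step3_le3 x : 2 <= x <= 3 -> step3 x = 1 - (3 - x) ^+ 3 / 6.
Proof.
move=> /andP[x2 x3]; rewrite /step3 (@posp_neg (x - 3)); last by lra.
by rewrite !posp_pos; [field|lra..].
Qed.

Lemma step3_ge3 x : 3 <= x -> step3 x = 1.
Proof. by move=> x3; rewrite /step3 !posp_pos; [field|lra..]. Qed.

Let glue (f : R -> R) (a : R) :
  (forall x y, x <= y -> y <= a -> f x <= f y) ->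
  forall b, (forall x y, a <= x -> x <= y -> y <= b -> f x <= f y) ->
  forall x y, x <= y -> y <= b -> f x <= f y.
Proof.
move=> f1 b f2 x y xy yb; have [ya|ay] := leP y a; first exact: f1.
have [xa|ax] := leP x a; last by apply: f2 => //; exact: ltW.
by rewrite (le_trans (f1 _ _ xa (lexx a)))// f2// ltW.
Qed.

Lemma step3_nondecreasing x y : x <= y -> step3 x <= step3 y.
Proof.
have s0 : forall x y, x <= y -> y <= 0 -> step3 x <= step3 y.
  by move=> a b ab b0; rewrite !step3_le0//; lra.
have s1 := glue s0 (b := 1); have {}s1 : forall x y, x <= y -> y <= 1 -> step3 x <= step3 y.
  apply: s1 => a b a0 ab b1; rewrite !step3_le1 ?a0 ?b1 ?andbT//=; [|lra..].
  by rewrite ler_pM2r ?invr_gt0// lerXn2r ?nnegrE//; lra.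
have s2 := glue s1 (b := 2); have {}s2 : forall x y, x <= y -> y <= 2 -> step3 x <= step3 y.
  apply: s2 => a b a0 ab b1; rewrite !step3_le2; [|lra..].
  rewrite ler_pM2r ?invr_gt0//.
  (* With both variables moved into [0, 1], the difference of the two values factors as [v - u]
     times a sum of nonnegative terms. *)
  pose u := a - 1; pose v := b - 1.
  have uE : a = u + 1 by rewrite /u; ring.
  have vE : b = v + 1 by rewrite /v; ring.
  have u0 : 0 <= u by rewrite /u; lra.
  have uv : 0 <= v - u by rewrite /u /v; lra.
  have v1 : 0 <= 1 - v by rewrite /v; lra.
  have u1 : 0 <= 1 - u by lra.
  have v0 : 0 <= v by lra.
  rewrite uE vE -subr_ge0.
  rewrite (_ : _ - _ = (v - u) * (3 + 2 * (u * (1 - u)) + 2 * (v * (1 - v)) +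
     u * (1 - v) + v * (1 - u))); last by ring.
  by rewrite mulr_ge0// !addr_ge0 ?mulr_ge0.
have s3 := glue s2 (b := 3); have {}s3 : forall x y, x <= y -> y <= 3 -> step3 x <= step3 y.
  apply: s3 => a b a0 ab b1; rewrite !step3_le3; [|lra..].
  by rewrite lerD2l lerN2 ler_pM2r ?invr_gt0// lerXn2r ?nnegrE//; lra.
move=> xy; apply: (glue s3 (b := Num.max 3 y)) => //; last by rewrite le_max lexx orbT.
by move=> a b a3 ab _; rewrite !step3_ge3//; lra.
Qed.

Lemma step3_01 x : 0 <= step3 x <= 1.
Proof.
apply/andP; split.
  have [x0|x0] := leP x 0; first by rewrite step3_le0.
  by rewrite -(step3_le0 (lexx 0)) step3_nondecreasing// ltW.
have [x3|x3] := leP 3 x; first by rewrite step3_ge3.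
by rewrite -(step3_ge3 (lexx 3)) step3_nondecreasing// ltW.
Qed.

Lemma continuous_step3 : continuous step3.
Proof.
have c a : continuous (fun x : R => posp (x - a)).
  move=> x; apply: (@continuous_max _ _ (fun x => x - a) (fun=> 0)).
    by apply: cvgB; [exact: cvg_id|exact: cvg_cst].
  exact: cvg_cst.
have cX (g : R -> R) : continuous g -> continuous (fun x => g x ^+ 3).
  move=> cg; change (continuous (fun x => g x * (g x * g x))) => x.
  by apply: cvgM; [exact: cg|apply: cvgM; exact: cg].
have c3 a : continuous (fun x : R => posp (x - a) ^+ 3) by exact: cX.
have c0 : continuous (fun x : R => posp x ^+ 3) by exact/cX/continuous_posp.
move=> x; apply: cvgM; last exact: cvg_cst.
apply: cvgB; last exact: c3.
apply: cvgD; last by apply: cvgM; [exact: cvg_cst|exact: c3].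
apply: cvgB; last by apply: cvgM; [exact: cvg_cst|exact: c3].
exact: c0.
Qed.

(** The four truncated cubes give the remainder (1 + 3 + 3 + 1) / 6, below 2. Both derivatives
    vanish beyond 3; below 3 every truncated power is at most the same power of 3, and 36 is a crude
    common bound. *)
Lemma taylor3_step3 : taylor3 2 step3 step3' step3''.
Proof.
have mp a : measurable_fun setT (fun x : R => posp (x - a)).
  by apply: measurableT_comp; [exact: (continuous_measurable_fun continuous_posp)|exact: measurable_funB].
have mp0 : measurable_fun setT posp by exact: (continuous_measurable_fun continuous_posp).
split.
- exact: (continuous_measurable_fun continuous_step3).
- have mp2 a : measurable_fun setT (fun x : R => posp (x - a) ^+ 2) by exact: measurable_funX.
  have mp02 : measurable_fun setT (fun x : R => posp x ^+ 2) by exact: measurable_funX.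
  apply: measurable_funM => //; apply: measurable_funB => //.
  apply: measurable_funD; last exact: measurable_funM.
  by apply: measurable_funB => //; exact: measurable_funM.
- apply: measurable_funB => //; apply: measurable_funD; last exact: measurable_funM.
  by apply: measurable_funB => //; exact: measurable_funM.
- exists 36 => x; split.
  + by have /andP[? ?] := step3_01 x; rewrite ler_norml; apply/andP; split; lra.
  + have [x3|x3] := leP 3 x.
      have -> : step3' x = 0 by rewrite /step3' !posp_pos; [field|lra..].
      by rewrite normr0.
    have p0 z : 0 <= posp z by rewrite /posp le_max lexx orbT.
    have p3 z : z <= 3 -> 0 <= posp z ^+ 2 <= 9.
      move=> z3; rewrite sqr_ge0/=.
      have : posp z <= 3 by rewrite /posp ge_max z3 ler0n.
      have -> : (9 : R) = 3 ^+ 2 by ring.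
      by move=> h; rewrite lerXn2r ?nnegrE.
    rewrite /step3'.
    have /andP[] := p3 x (ltW x3).
    have /p3/andP[] : x - 1 <= 3 by lra.
    have /p3/andP[] : x - 2 <= 3 by lra.
    have /p3/andP[] : x - 3 <= 3 by lra.
    by move=> *; rewrite ler_norml; apply/andP; split; lra.
  + have [x3|x3] := leP 3 x.
      have -> : step3'' x = 0 by rewrite /step3'' !posp_pos; [ring|lra..].
      by rewrite normr0.
    have p3 z : z <= 3 -> 0 <= posp z <= 3.
      by move=> z3; rewrite /posp le_max lexx orbT ge_max z3 ler0n.
    rewrite /step3''.
    have /andP[] := p3 x (ltW x3).
    have /p3/andP[] : x - 1 <= 3 by lra.
    have /p3/andP[] : x - 2 <= 3 by lra.
    have /p3/andP[] : x - 3 <= 3 by lra.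
    by move=> *; rewrite ler_norml; apply/andP; split; lra.
- move=> x y; have y3 : 0 <= `|y| ^+ 3 by rewrite exprn_ge0.
  have := posp_cube_taylor x y; rewrite ler_norml => /andP[].
  have := posp_cube_taylor (x - 1) y; rewrite ler_norml => /andP[].
  have := posp_cube_taylor (x - 2) y; rewrite ler_norml => /andP[].
  have := posp_cube_taylor (x - 3) y; rewrite ler_norml => /andP[].
  rewrite /step3 /step3' /step3'' !(addrAC x y).
  by move=> *; rewrite ler_norml; apply/andP; split; lra.
Qed.

Lemma taylor3_affine M (f f1 f2 : R -> R) (a v : R) : 0 < a -> taylor3 M f f1 f2 ->
  taylor3 (M / a ^+ 3) (fun y => f ((y - v) / a)) (fun y => f1 ((y - v) / a) / a)
    (fun y => f2 ((y - v) / a) / a ^+ 2).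
Proof.
move=> a0 [mf mf1 mf2 [K fK] ft].
have ml : measurable_fun setT (fun y : R => (y - v) / a).
  by apply: measurable_funM => //; exact: measurable_funB.
split.
- exact: measurableT_comp.
- by apply: measurable_funM => //; exact: measurableT_comp.
- by apply: measurable_funM => //; exact: measurableT_comp.
- exists (K * (1 + a^-1 + (a ^+ 2)^-1)) => y; have [k0 k1 k2] := fK ((y - v) / a).
  have K0 : 0 <= K by exact: le_trans k0.
  have a1 : 0 <= a^-1 by rewrite invr_ge0 ltW.
  have a2 : 0 <= (a ^+ 2)^-1 by rewrite invr_ge0 exprn_ge0// ltW.
  split.
  + by rewrite (le_trans k0)// -{1}(mulr1 K) ler_wpM2l// -addrA lerDl addr_ge0.
  + rewrite normrM (ger0_norm a1); apply: (@le_trans _ _ (K * a^-1)).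
      by rewrite ler_wpM2r.
    by rewrite ler_wpM2l// addrAC lerDr addr_ge0.
  + rewrite normrM (ger0_norm a2); apply: (@le_trans _ _ (K * (a ^+ 2)^-1)).
      by rewrite ler_wpM2r.
    by rewrite ler_wpM2l// lerDr addr_ge0.
- move=> x y; have := ft ((x - v) / a) (y / a).
  rewrite -mulrDl (addrAC x (- v)) normrM normfV (gtr0_norm a0).
  set A := f _; set B := f _; set C := f1 _; set D := f2 _.
  rewrite (_ : M * (`|y| / a) ^+ 3 = M / a ^+ 3 * `|y| ^+ 3); last by field; rewrite gt_eqF.
  rewrite (_ : A - B - y / a * C - (y / a) ^+ 2 / 2 * D =
    A - B - y * (C / a) - y ^+ 2 / 2 * (D / a ^+ 2))//.
  by field; rewrite gt_eqF.
Qed.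

End spline.

(** * A central limit bound for spline test functions *)

Section clt.
Context {R : realType} {d : measure_display} {T : measurableType d}.

(** The Gaussian partner of each summand has deviation 1 / sqrt(n + 1), so that its n + 1 averages
    compose to the standard normal law. The factor 2 / a^3 is the Taylor constant of the spline
    stretched by [a]. *)
Theorem clt_step3 (P : probability T R) (Y : T -> R) (n : nat) (a v : R) :
  measurable_fun setT Y ->
  P.-integrable setT (EFin \o (fun w => `|Y w| ^+ 3)) ->
  \int[P]_w Y w = 0 -> \int[P]_w (Y w) ^+ 2 = n.+1%:R^-1 -> 0 < a ->
  `|iter n.+1 (shift_mean P Y) (fun y => step3 ((y - v) / a)) 0
    - \int[normal_prob 0 1]_y step3 ((y - v) / a)|
  <= n.+1%:R * (2 / a ^+ 3 * (\int[P]_w (`|Y w| ^+ 3)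
       + 12 * expR 2 * (Num.sqrt n.+1%:R)^-1 ^+ 3)).
Proof.
move=> mY I3 E1 E2 a0; set s := (Num.sqrt n.+1%:R)^-1 : R.
have s0 : 0 < s by rewrite invr_gt0 sqrtr_gt0.
have s2 : s ^+ 2 = n.+1%:R^-1 by rewrite exprVn sqr_sqrtr.
have cf : continuous (fun y : R => step3 ((y - v) / a)).
  move=> y; apply: (@cvg_comp _ _ _ (fun y => (y - v) / a) step3 _ _ _ _ (@continuous_step3 R _)).
  by apply: cvgM; [apply: cvgB; [exact: cvg_id|exact: cvg_cst]|exact: cvg_cst].
have f01 y : 0 <= (fun y : R => step3 ((y - v) / a)) y <= 1 by exact: step3_01.
have := iter_normal_shift_mean n 0 s0 cf f01.
rewrite (_ : s * Num.sqrt n.+1%:R = 1); last by rewrite mulVf// gt_eqF// sqrtr_gt0.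
under eq_Rintegral do rewrite add0r.
move=> <-.
have tf := taylor3_affine v a0 (@taylor3_step3 R).
have h1 : \int[P]_w Y w = \int[normal_prob 0 s]_w idfun w.
  by rewrite E1 Rintegral_id_normal.
have h2 : \int[P]_w (Y w) ^+ 2 = \int[normal_prob 0 s]_w (idfun w) ^+ 2.
  by rewrite E2 Rintegral_sqr_normal.
have := @lindeberg R d T _ _ P (normal_prob 0 s) Y idfun _ _ _ _ n.+1 0 mY
  (@measurable_id _ _ _) I3 (integrable_cube_normal s0) h1 h2 tf.
move=> /le_trans; apply.
rewrite ler_wpM2l// ler_wpM2l//; first by rewrite divr_ge0// exprn_ge0// ltW.
by rewrite lerD2l Rintegral_cube_normal_le.
Qed.

End clt.

(** * Covering numbers and greedy covers *)

Section separated_points.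
Context {R : realType}.
Implicit Types (A : set R) (delta : R) (n : nat).

(** The packing dual to covering: [n] counts the gaps of the chain, which has n + 1 points, so that
    [separated A delta n] will mean that more than [n] intervals are required. *)
Definition separated A delta n : Prop := exists s : nat -> R,
  (forall i, (i <= n)%N -> A (s i)) /\
  (forall i, (i < n)%N -> s i + delta < s i.+1).

Lemma separated_le A delta m n : (m <= n)%N -> separated A delta n -> separated A delta m.
Proof.
move=> mn [s [sA sd]]; exists s; split => i im.
  by apply: sA; exact: leq_trans mn.
by apply: sd; exact: leq_trans mn.
Qed.

Lemma separated_sub A B delta n : A `<=` B -> separated A delta n -> separated B delta n.
Proof. by move=> AB [s [sA sd]]; exists s; split => // i im; apply/AB/sA. Qed.

(** Pigeonhole: among n + 1 chain points, two would share one of [n] intervals of length at most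
    [delta]. *)
Lemma separated_not_cover A delta n : 0 <= delta ->
  separated A delta n -> ~ interval_cover A delta n.
Proof.
move=> d0 [s [sA sd]] [a [b [ab Ab]]].
have inc i j : (i < j)%N -> (j <= n)%N -> s i + delta < s j.
  elim: j => [//|j IH]; rewrite ltnS leq_eqVlt => /predU1P[->|ij] jn; first exact: sd.
  rewrite (lt_trans (IH ij (ltnW jn)))// (le_lt_trans _ (sd _ jn))//.
  by rewrite lerDl.
have : forall i : 'I_n.+1, exists k : 'I_n, a k <= s i <= b k.
  move=> i; have [k _] := Ab _ (sA i (ltn_ord i)).
  by rewrite /= in_itv/= => h; exists k.
move=> /choice[f fP].
have : ~ injective f.
  by move=> /leq_card; rewrite !card_ord ltnn.
have H (i' j' : 'I_n.+1) : f i' = f j' -> ~~ (i' < j')%N.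
  move=> e; apply/negP => ij; have := inc _ _ ij (ltn_ord j').
  have /andP[h1 h2] := fP i'; have /andP[h3 h4] := fP j'.
  by rewrite e in h1 h2; have [h5 h6] := ab (f j'); lra.
apply => i j fij; apply: val_inj; have [ij|ij|//] := ltngtP (i : nat) (j : nat).
- by have /negP := H _ _ fij.
- by have /negP := H _ _ (esym fij).
Qed.

(* Cover the infimum of [A] greedily by [[inf A, inf A + delta]]. *)
Lemma not_cover_separated A delta n : 0 <= delta -> has_lbound A ->
  ~ interval_cover A delta n -> separated A delta n.
Proof.
move=> d0; elim: n A => [|n IH] A lA nc.
  have [[x Ax]|A0] := pselect (A !=set0).
    by exists (fun=> x); split.
  exfalso; apply: nc; exists (fun=> 0), (fun=> 0); split; first by case.
  by move=> x Ax; exfalso; apply: A0; exists x.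
have A0 : A !=set0.
  apply: contrapT => A0; apply: nc; exists (fun=> 0), (fun=> 0); split.
    by move=> _; rewrite subrr.
  by move=> x Ax; exfalso; apply: A0; exists x.
pose A' := [set x | A x /\ inf A + delta < x].
have : separated A' delta n.
  apply: IH.
    by case: lA => l lA; exists l => x [Ax _]; exact: lA.
  move=> [a [b [ab Aab]]]; apply: nc.
  exists (fun i => if unlift ord0 i is Some j then a j else inf A).
  exists (fun i => if unlift ord0 i is Some j then b j else inf A + delta); split.
    move=> i; case: (unlift ord0 i) => [j|]; first exact: ab.
    by rewrite lerDl addrAC subrr add0r.
  move=> x Ax; have [xd|xd] := leP x (inf A + delta).
    exists ord0 => //=; rewrite unlift_none/= in_itv/= xd andbT.
    exact: ge_inf.
  have [j _ abj] := Aab x (conj Ax xd).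
  by exists (lift ord0 j) => //=; rewrite liftK.
move=> [s [sA sd]].
have [_ s0] := sA 0%N (leq0n _).
(* The infimum need not belong to [A]; the strict inequality [inf A + delta < s 0] lets a nearby
   point of [A] head the chain. *)
have [y Ay yd] : exists2 y, A y & y < s 0%N - delta.
  have e0 : 0 < s 0%N - delta - inf A by lra.
  have [y Ay h] := inf_adherent e0 (conj A0 lA).
  by exists y => //; lra.
exists (fun i => if i is j.+1 then s j else y); split.
  by case=> [|i] //; rewrite ltnS => /sA[].
by case=> [|i] /=; [lra|rewrite ltnS; exact: sd].
Qed.

(** Boundedness excludes long chains, hence provides a finite cover and turns the infimum into a
    minimum; the equivalence is then the duality between covers and chains. *)
Lemma covering_number_nat A delta : 0 < delta -> has_lbound A -> has_ubound A ->
  exists m : nat, covering_number A delta = m%:R /\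
    forall n, (n < m)%N <-> separated A delta n.
Proof.
move=> d0 lA [u uA].
have [m0 cm0] : exists m, interval_cover A delta m.
  apply: contrapT => nc.
  have [l lA'] := lA.
  (* A chain with this many gaps would be longer than [u - l]. *)
  pose n := (Num.truncn ((u - l) / delta)).+1.
  have [s [sA sd]] : separated A delta n.
    by apply: not_cover_separated => //; [exact: ltW|move=> c; apply: nc; exists n].
  have inc i : (i <= n)%N -> s 0%N + i%:R * delta <= s i.
    elim: i => [|i IH] in_; first by rewrite mul0r addr0.
    rewrite -natr1 mulrDl mul1r addrA (le_trans _ (ltW (sd _ in_)))// lerD2r.
    by apply: IH; exact: ltnW.
  have h1 := inc n (leqnn _); have h2 := uA _ (sA n (leqnn _)).
  have h3 := lA' _ (sA 0%N (leq0n _)).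
  have : (u - l) / delta < n%:R by exact: Num.Theory.truncnS_gt.
  by rewrite ltr_pdivrMr//; lra.
have := cm0.
have ex : exists m, `[< interval_cover A delta m >] by exists m0; exact/asboolP.
case: (ex_minnP ex) => m /asboolP cm mmin _.
have mle k : interval_cover A delta k -> (m <= k)%N by move=> /asboolP; exact: mmin.
exists m; split.
  apply/le_anti/andP; split.
    by apply: ge_inf; [exists 0 => _ [k _ <-]|exists m].
  apply: lb_le_inf; first by exists m%:R, m.
  by move=> _ [k ck <-]; rewrite ler_nat; exact: mle.
move=> n; split => [nm|sn].
  apply: not_cover_separated => //; first exact: ltW.
  by move=> /mle; rewrite leqNgt nm.
rewrite ltnNge; apply/negP => mn.
by apply: (separated_not_cover (ltW d0) (separated_le mn sn)) cm.
Qed.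

End separated_points.

(** The increments of a nondecreasing boolean sequence are the indicator of its first true index, so
    the sum picks out a single value of [G]. *)
Lemma sum_first {V : pzRingType} (b : nat -> bool) (G : nat -> V) (l : nat) :
  (forall i, b i -> b i.+1) ->
  if b l then
    exists i0, [/\ (i0 <= l)%N, b i0, (forall i, (i < i0)%N -> ~~ b i) &
      \sum_(i < l.+1) ((b i)%:R - (if val i is k.+1 then b k else false)%:R) * G i = G i0]
  else \sum_(i < l.+1) ((b i)%:R - (if val i is k.+1 then b k else false)%:R) * G i = 0.
Proof.
move=> bS; have bmono i j : (i <= j)%N -> b i -> b j.
  elim: j => [|j IH]; first by rewrite leqn0 => /eqP->.
  by rewrite leq_eqVlt => /predU1P[->//|]; rewrite ltnS => /IH ij /ij/bS.
case: ifP => [bl|/negbT nbl]; last first.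
  have nb i : (i <= l)%N -> b i = false.
    by move=> il; apply/negP => /(bmono _ _ il); exact/negP.
  apply: big1 => -[i /= il] _; rewrite nb//; case: i il => [|i] il; first by rewrite subr0 mul0r.
  by rewrite nb ?subr0 ?mul0r// ltnW.
have [i0 bi0 i0min] := ex_minnP (ex_intro _ l bl).
have i0l : (i0 <= l)%N by exact: i0min.
have nb i : (i < i0)%N -> ~~ b i.
  by move=> ii0; apply/negP => /i0min; rewrite leqNgt ii0.
exists i0; split => //.
rewrite (bigD1 (Ordinal (i0l : (i0 < l.+1)%N)))//= [X in _ + X]big1 ?addr0.
  rewrite bi0; case: i0 nb {bi0 i0min i0l} => [|k] nb; first by rewrite subr0 mul1r.
  by rewrite (negbTE (nb k _))// subr0 mul1r.
move=> -[[|k] /= il]; rewrite -val_eqE/= => ne.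
  by rewrite (negbTE (nb _ _)) ?subr0 ?mul0r// lt0n eq_sym.
have [ki|ik] := ltnP k.+1 i0.
  by rewrite (negbTE (nb _ ki)) (negbTE (nb _ (ltnW ki))) subr0 mul0r.
have {}ik : (i0 <= k)%N by rewrite -ltnS ltn_neqAle eq_sym ne.
by rewrite (bmono _ _ ik bi0) (bS _ (bmono _ _ ik bi0)) subrr mul0r.
Qed.

Section greedy.
Context {R : realType}.
Variable delta : R.

(* The pair of the distance covered since the current interval was opened and
   the number of intervals opened after the first one. *)
Definition greedy_step (z : R * nat) (x : R) : R * nat :=
  if z.1 + x <= delta then (z.1 + x, z.2) else (0, z.2.+1).

Fixpoint greedy (xi : nat -> R) (m : nat) : R * nat :=
  if m is p.+1 then greedy_step (greedy xi p) (xi p) else (0, 0%N).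

Hypothesis delta0 : 0 <= delta.
Variable s : nat -> R.
Hypothesis ds : {homo s : i j / (i <= j)%N >-> i <= j}.
Let xi i := s i.+1 - s i.
Let c m := (greedy xi m).2.
(** The left endpoint of the interval open at index [m]. *)
Let base m := s m - (greedy xi m).1.

Let dsS m : s m <= s m.+1. Proof. exact/ds/leqnSn. Qed.

Let greedyS m :
  (s m.+1 <= base m + delta /\ c m.+1 = c m /\ base m.+1 = base m) \/
  (base m + delta < s m.+1 /\ c m.+1 = (c m).+1 /\ base m.+1 = s m.+1).
Proof.
rewrite /c /base /= /greedy_step; set z := greedy xi m.
case: (leP (z.1 + xi m) delta) => h; [left|right]; rewrite /= /xi in h *.
  by split; [lra|split=> [//|]; lra].
by split; [lra|split=> [//|]; lra].
Qed.

Let base_le m : base m <= s m.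
Proof.
elim: m => [|m IH]; first by rewrite /base/= subr0.
by have [[_ [_ ->]]|[_ [_ ->]]] := greedyS m => //; exact: le_trans (dsS m).
Qed.

Let greedy_mono p m : (p <= m)%N ->
  (c p <= c m)%N /\ (c m = c p -> base m = base p).
Proof.
elim: m => [|m IH]; first by rewrite leqn0 => /eqP->.
rewrite leq_eqVlt => /predU1P[->//|]; rewrite ltnS => /IH[h1 h2].
have [[_ [-> ->]]|[_ [-> ->]]] := greedyS m => //.
by split; [exact: leqW|move=> e; move: h1; rewrite -e ltnn].
Qed.

(** The left endpoints chosen by the greedy cover form a chain; conversely greedy stays ahead of any
    chain, because its current left endpoint is never to the right of the corresponding chain
    point. *)
Lemma greedy_separated m n :
  (n <= (greedy (fun i => s i.+1 - s i)%R m).2)%N <->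
  separated [set s j | j in [set j | (j <= m)%N]] delta n.
Proof.
rewrite -/xi -/(c m); split.
  suff : exists x : nat -> R, [/\ forall i, (i <= c m)%N -> [set s j | j in [set j | (j <= m)%N]] (x i),
      forall i, (i < c m)%N -> x i + delta < x i.+1 & x (c m) = base m].
    by move=> [x [x1 x2 _]] nc; apply: separated_le nc _; exists x.
  elim: m => [|m [x [x1 x2 x3]]].
    exists (fun=> s 0%N); split => //.
    + by move=> i _; exists 0%N.
    + by rewrite /base /= subr0.
  have sub : [set s j | j in [set j | (j <= m)%N]] `<=` [set s j | j in [set j | (j <= m.+1)%N]].
    by move=> _ [j /= jm <-]; exists j => //=; exact: leqW.
  have [[_ [ec eb]]|[hb [ec eb]]] := greedyS m.
    exists x; rewrite ec eb; split => // i ic; exact/sub/x1.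
  exists (fun i => if (i <= c m)%N then x i else s m.+1); rewrite ec eb ltnn; split => //.
  + move=> i ic; case: ifP => [/x1/sub//|_]; by exists m.+1 => /=.
  + move=> i; rewrite ltnS => ic; rewrite ic; case: ltnP => [/x2//|ci].
    have -> : i = c m by apply/eqP; rewrite eqn_leq ic.
    by rewrite x3.
move=> [x [x1 x2]].
(* The induction on [n] needs the position of the last left endpoint as well as the count, and only
   when the count is exactly [n]. *)
suff /(_ m x x1 x2)[] : forall m x, (forall i, (i <= n)%N -> [set s j | j in [set j | (j <= m)%N]] (x i)) ->
  (forall i, (i < n)%N -> x i + delta < x i.+1) ->
  (n <= c m)%N /\ (c m = n -> base m <= x n) by [].
move=> {m x x1 x2}; elim: n => [|n IH] m x x1 x2.
  split => // c0; have [j _ <-] := x1 0%N (leqnn _).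
  have [_ h] := greedy_mono (leq0n m); rewrite h//.
  by rewrite /base /= subr0; exact: ds.
have [j /= jm xj] := x1 n.+1 (leqnn _).
(* Distinct indices may carry equal values; the strict gaps of the chain recover the order of the
   indices. *)
have lt_j i p : (i <= n)%N -> s p = x i -> (p < j)%N.
  move=> in_ sp; rewrite ltnNge; apply/negP => jp.
  have : x i < x n.+1.
    elim: n in_ {IH x1 xj} x2 => [|k IHk] ik x2.
      move: ik; rewrite leqn0 => /eqP->; apply: le_lt_trans (x2 0%N isT).
      by rewrite lerDl.
    have xk : x k.+1 < x k.+2 by apply: le_lt_trans (x2 k.+1 (leqnn _)); rewrite lerDl.
    move: ik; rewrite leq_eqVlt => /predU1P[->//|].
    rewrite ltnS => ik; apply: lt_trans xk.
    exact: IHk ik (fun i h => x2 i (leqW h)).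
  by have := ds jp; rewrite sp xj; lra.
case: j => [|j] in jm xj lt_j *.
  by have [p _ sp] := x1 0%N (leq0n _); have := lt_j 0%N p (leq0n _) sp.
have [h1 h2] : (n <= c j)%N /\ (c j = n -> base j <= x n).
  apply: IH => [i in_|i in_]; last by apply: x2; exact: leqW.
  have [p _ sp] := x1 i (leqW in_).
  by exists p => //=; rewrite -ltnS; exact: lt_j in_ sp.
have [m1 m2] := greedy_mono jm.
have [k1 k2] := greedy_mono (ltnW jm).
have [cj|cj] := eqVneq (c j) n.
  have b := h2 cj; have gap := x2 n (leqnn _).
  have [[hb _]|[_ [ec eb]]] := greedyS j; first by rewrite xj in hb; lra.
  rewrite ec cj eb xj in m1 m2; split => // e.
  by rewrite m2.
have cj' : (n.+1 <= c j)%N by rewrite ltn_neqAle eq_sym cj.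
split; first exact: leq_trans k1.
move=> e; have ej : c j = n.+1 by apply/eqP; rewrite eqn_leq cj' andbT -e.
rewrite k2 ?e ?ej// -xj (le_trans (base_le j))//.
Qed.

Let greedy_le m : (greedy xi m).1 <= delta.
Proof.
elim: m => [//|m IH] /=; rewrite /greedy_step.
by case: (leP ((greedy xi m).1 + xi m) delta).
Qed.

(** The difference of indicators singles out the first index [j] with count at least [n]. There the
    walk sits at a left endpoint, so the count is still [n] at [l] exactly when the increment since
    [j] is at most [delta]. The counts involve increments before [j] only, which makes the two
    factors independent. *)
Lemma greedy_count_eq l n :
  ((greedy (fun i => s i.+1 - s i)%R l).2 == n)%:R =
  \sum_(j < l.+1)
    ((n <= (greedy (fun i => s i.+1 - s i)%R j).2)%N%:R
     - (if val j is k.+1 then (n <= (greedy (fun i => s i.+1 - s i)%R k).2)%N else false)%:R)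
    * (s l - s j <= delta)%R%:R :> R.
Proof.
rewrite -/xi; pose b j := (n <= c j)%N.
have bS i : b i -> b i.+1.
  by move=> /leq_trans; apply; have [] := greedy_mono (leqnSn i).
have := sum_first (fun j => (s l - s j <= delta)%R%:R : R) l bS.
case: ifPn => [bl [j [jl bj nb ->]]|nbl ->]; last first.
  by rewrite (_ : _ == _ = false)//; apply/negbTE; move: nbl; rewrite -ltnNge ltn_neqAle => /andP[].
congr (nat_of_bool _)%:R.
have [cj bsj] : c j = n /\ base j = s j.
  case: j {jl} bj nb => [|j] bj nb.
    split; last by rewrite /base/= subr0.
    by apply/eqP; rewrite eqn_leq; apply/andP; split.
  have := nb j (leqnn _); rewrite /b -ltnNge => cjn.
  move: bj; rewrite /b; have [[_ [-> _]]|[_ [-> ->]]] := greedyS j.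
    by move=> nc; move: (leq_trans cjn nc); rewrite ltnn.
  by move=> nc; split=> //; apply/eqP; rewrite eqn_leq cjn.
apply/eqP/idP => [cl|sl].
  have [_ h] := greedy_mono jl.
  have /h : c l = c j by rewrite cj.
  by have := greedy_le l; rewrite bsj /base; lra.
have key p : (j <= p)%N -> (p <= l)%N -> c p = n /\ base p = s j.
  elim: p => [|p IH]; first by rewrite leqn0 => /eqP <- _.
  rewrite leq_eqVlt => /predU1P[<-//|]; rewrite ltnS => jp pl.
  have [cp bp] := IH jp (ltnW pl).
  have [[_ [-> ->]]//|[hb _]] := greedyS p.
  by exfalso; move: hb; rewrite bp; have := ds pl; lra.
by have [] := key l jl (leqnn _).
Qed.

End greedy.

(** * Independence of the greedy state from later increments *)

Lemma measure_eq_rectangles {d1 d2 : measure_display} (T1 : measurableType d1)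
    (T2 : measurableType d2) (R : realType)
    (m1 m2 : {measure set (T1 * T2) -> \bar R}) :
  (m1 setT < +oo)%E ->
  (forall A B, measurable A -> measurable B -> m1 (A `*` B) = m2 (A `*` B)) ->
  forall C, measurable C -> m1 C = m2 C.
Proof.
move=> fin eqAB C mC.
pose G : set (set (T1 * T2)) :=
  [set C | exists A, measurable A /\ exists B, measurable B /\ C = A `*` B].
have GI : setI_closed G.
  move=> /= _ _ [X1 [mX1 [X2 [mX2 ->]]]] [Y1 [mY1 [Y2 [mY2 ->]]]].
  rewrite -setXI; exists (X1 `&` Y1); split; first exact: measurableI.
  by exists (X2 `&` Y2); split => //; exact: measurableI.
apply: (measure_unique G (fun=> setT)) => //.
- rewrite measurable_prod_measurableType //; congr (<<s _ >>).
  rewrite predeqE; split => [[A mA [B mB <-]]|[A [mA [B [mB ->]]]]].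
    by exists A; split => //; exists B.
  by exists A => //; exists B.
- by move=> n; exists setT; split => //; exists setT; split => //; rewrite setXTT.
- by rewrite bigcup_const//; exists 0%N.
- by move=> A [A1 [mA1 [A2 [mA2 ->]]]]; exact: eqAB.
Qed.

Lemma measure_eq_preimage_rectangles {d d1 d2 : measure_display}
    (T : measurableType d) (T1 : measurableType d1)
    (T2 : measurableType d2) (R : realType) (m1 m2 : {measure set T -> \bar R})
    (phi : T -> T1 * T2) :
  measurable_fun setT phi -> (m1 setT < +oo)%E ->
  (forall A B, measurable A -> measurable B ->
     m1 (phi @^-1` (A `*` B)) = m2 (phi @^-1` (A `*` B))) ->
  forall C, measurable C -> m1 (phi @^-1` C) = m2 (phi @^-1` C).
Proof.
move=> mphi fin eqAB C mC.
unshelve refine (@measure_eq_rectangles _ _ _ _ _ (pushforward m1 phi)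
  (pushforward m2 phi) _ eqAB C mC); rewrite //=.
Qed.

Section greedy_independence.
Context {R : realType} {d : measure_display} {Omega : measurableType d}.
Variables (P : probability Omega R) (delta : R) (Y : nat -> Omega -> R).
Hypothesis mY : forall i, measurable_fun setT (Y i).
Hypothesis iY : mutually_independent P Y.

Let G m (w : Omega) : R * nat := greedy delta (Y ^~ w) m.

Let measurable_step : measurable_fun setT
  (fun z : (R * nat) * R => greedy_step delta z.1 z.2).
Proof.
have mS : measurable_fun setT (fun z : (R * nat) * R => z.1.1 + z.2).
  by apply: measurable_funD => //; exact: measurableT_comp.
have mc : measurable_fun setT (fun z : (R * nat) * R => z.1.2).
  exact: measurableT_comp.
apply: measurable_fun_ifT.
- exact: measurable_fun_ler.
- exact: measurable_fun_pair.
- apply: measurable_fun_pair => //.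
  by apply: measurableT_comp mc.
Qed.

Lemma measurable_greedy m : measurable_fun setT (G m).
Proof.
elim: m => [|m IH] /=; first exact: measurable_cst.
apply: (measurableT_comp measurable_step (g := fun w => (G m w, Y m w))).
exact: measurable_fun_pair.
Qed.

Let mbig (J : {fset nat}) (B : nat -> set R) : (forall i, i \in J -> measurable (B i)) ->
  measurable (\bigcap_(i in [set` J]) (Y i @^-1` B i)).
Proof.
move=> mB; apply: fin_bigcap_measurable; first exact: finite_fset.
by move=> i iJ; rewrite -[X in measurable X]setTI; apply: mY => //; exact: mB.
Qed.

(** Induction on [m]: the next state is a function of the current one and of [Y m]. A whole family
    of later increments is carried along so that [Y m] can be taken out of the family and absorbed
    into the state. *)
Lemma greedy_indep_family m (J : {fset nat}) (A : set (R * nat)) (B : nat -> set R) :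
  (forall i, i \in J -> (m <= i)%N) -> measurable A ->
  (forall i, i \in J -> measurable (B i)) ->
  P (G m @^-1` A `&` \bigcap_(i in [set` J]) (Y i @^-1` B i)) =
  (P (G m @^-1` A) * P (\bigcap_(i in [set` J]) (Y i @^-1` B i)))%E.
Proof.
elim: m J A B => [|m IH] J A B Jm mA mB.
  have [A0|A0] := pselect (A (0, 0%N)).
    have -> : G 0%N @^-1` A = setT by apply/seteqP; split.
    by rewrite setTI probability_setT mul1e.
  have -> : G 0%N @^-1` A = set0 by apply/seteqP; split.
  by rewrite set0I measure0 mul0e.
set D := \bigcap_(_ in _) _; have mD : measurable D by exact: mbig.
pose phi (w : Omega) := (G m w, Y m w).
have mphi : measurable_fun setT phi.
  by apply: measurable_fun_pair => //; exact: measurable_greedy.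
have mJ : m \notin J by apply/negP => /Jm; rewrite ltnn.
have one A' B' : measurable A' -> measurable B' ->
    P (G m @^-1` A' `&` Y m @^-1` B') = (P (G m @^-1` A') * P (Y m @^-1` B'))%E.
  move=> mA' mB'; have := IH [fset m]%fset A' (fun=> B').
  rewrite set_fset1 bigcap_set1; apply => // i; rewrite inE => /eqP->//.
have two A' B' : measurable A' -> measurable B' ->
    P (G m @^-1` A' `&` Y m @^-1` B' `&` D) =
    (P (G m @^-1` A') * P (Y m @^-1` B') * P D)%E.
  move=> mA' mB'; pose B2 i := if i == m then B' else B i.
  have eD : \bigcap_(i in [set` J]) (Y i @^-1` B2 i) = D.
    apply: eq_bigcapr => i /= iJ; rewrite /B2; case: eqP => // im.
    by rewrite -im iJ in mJ.
  have B2m : B2 m = B' by rewrite /B2 eqxx.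
  have mB2 i : i \in (m |` J)%fset -> measurable (B2 i).
    by rewrite /B2 !inE; case: eqP => //= _; exact: mB.
  have := IH (m |` J)%fset A' B2.
  rewrite set_fsetU1 bigcap_setU1 eD setIA B2m => ->//; last first.
    by move=> i; rewrite !inE => /predU1P[->//|/Jm/ltnW].
  rewrite -muleA; congr (_ * _)%E.
  have := iY mB2; rewrite set_fsetU1 bigcap_setU1 eD B2m => ->.
  rewrite big_fsetU1//= B2m; congr (_ * _)%E.
  have mB2' i : i \in J -> measurable (B2 i) by move=> iJ; apply: mB2; rewrite !inE iJ orbT.
  by have := iY mB2'; rewrite eD => ->.
have PD : (0 <= fine (P D)) by rewrite fine_ge0.
pose c := NngNum PD.
have finP E : measurable E -> P E \is a fin_num by move=> mE; exact: fin_num_measure.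
(* The restriction of [P] to [D] and the multiple of [P] by [P D] agree on rectangles in (state,
   next increment), hence on the preimage of [A] under one greedy step, which is not a rectangle. *)
have mu1E : forall C, measurable C ->
    mrestr P mD (phi @^-1` C) = mscale c P (phi @^-1` C).
  apply: measure_eq_preimage_rectangles => // [|A' B' mA' mB'].
    by rewrite /= /mrestr setTI -ge0_fin_numE ?finP.
  rewrite /= /mscale /mrestr.
  have -> : phi @^-1` (A' `*` B') = G m @^-1` A' `&` Y m @^-1` B' by [].
  by rewrite two// muleC -one// fineK ?finP.
pose C := [set z : (R * nat) * R | A (greedy_step delta z.1 z.2)].
have mC : measurable C by rewrite -[C]setTI; exact: measurable_step.
have := mu1E C mC; rewrite /mscale/= /mrestr.
have -> : phi @^-1` C = G m.+1 @^-1` A by [].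
by move=> ->; rewrite fineK ?finP// muleC.
Qed.

Lemma greedy_indep m j n (B : set R) : (m <= j)%N -> measurable B ->
  P ([set w | (n <= (greedy delta (Y ^~ w) m).2)%N] `&` Y j @^-1` B) =
  (P [set w | (n <= (greedy delta (Y ^~ w) m).2)%N] * P (Y j @^-1` B))%E.
Proof.
move=> mj mB.
have mA : measurable [set z : R * nat | (n <= z.2)%N].
  have : measurable_fun setT (@snd R nat) by exact: measurable_snd.
  by move=> /(_ measurableT [set k | (n <= k)%N] I); rewrite setTI.
have := @greedy_indep_family m [fset j]%fset [set z : R * nat | (n <= z.2)%N] (fun=> B).
by rewrite set_fset1 bigcap_set1; apply => // i; rewrite inE => /eqP->.
Qed.

End greedy_independence.

(** * Renewal recursions *)

Section sums_of_indicators.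
Context {R : realType} {d : measure_display} {T : measurableType d}.
Variable P : probability T R.

Lemma measurable_fun_boolr (b : T -> bool) : measurable [set w | b w] ->
  measurable_fun setT (fun w => (b w)%:R : R).
Proof.
move=> mb; have -> : (fun w => (b w)%:R : R) = \1_[set w | b w].
  by apply/funext => w; rewrite indicE mem_setE.
exact: measurable_indic.
Qed.

Lemma integrable_boolr (b : T -> bool) : measurable [set w | b w] ->
  P.-integrable setT (EFin \o (fun w => (b w)%:R : R)).
Proof.
move=> mb; apply: (@bounded_integrable _ _ _ P _ 1); first exact: measurable_fun_boolr.
by move=> w; rewrite ger0_norm// lern1 leq_b1.
Qed.

Lemma Rintegral_boolr (b : T -> bool) : measurable [set w | b w] ->
  \int[P]_w (b w)%:R = fine (P [set w | b w]).
Proof.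
move=> mb; have -> : (fun w => (b w)%:R : R) = \1_[set w | b w].
  by apply/funext => w; rewrite indicE mem_setE.
by rewrite /Rintegral integral_indic// setIT.
Qed.

Lemma integrable_sumr n (f : nat -> T -> R) :
  (forall i, (i < n)%N -> P.-integrable setT (EFin \o f i)) ->
  P.-integrable setT (EFin \o (fun w => \sum_(i < n) f i w)).
Proof.
elim: n => [|n IH] fi.
  under [X in EFin \o X]eq_fun do rewrite big_ord0.
  exact: finite_measure_integrable_cst.
under [X in EFin \o X]eq_fun do rewrite big_ord_recr/=.
apply: integrableD_EFin; last exact: fi.
by apply: IH => i ni; apply: fi; exact: ltnW.
Qed.

Lemma Rintegral_sumr n (f : nat -> T -> R) :
  (forall i, (i < n)%N -> P.-integrable setT (EFin \o f i)) ->
  \int[P]_w (\sum_(i < n) f i w) = \sum_(i < n) \int[P]_w f i w.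
Proof.
elim: n => [|n IH] fi.
  under eq_Rintegral do rewrite big_ord0.
  by rewrite RintegralT_cst big_ord0.
under eq_Rintegral do rewrite big_ord_recr/=.
have fi' i : (i < n)%N -> P.-integrable setT (EFin \o f i).
  by move=> ni; apply: fi; exact: ltnW.
rewrite RintegralD//; [|exact: integrable_sumr|exact: fi].
by rewrite IH// big_ord_recr.
Qed.

End sums_of_indicators.

(* Differences of a sequence extended by [0] to the left. *)
Definition bdiff {V : zmodType} (u : nat -> V) (i : nat) : V :=
  u i - (if i is k.+1 then u k else 0).

Lemma sum_bdiff {V : zmodType} (u : nat -> V) l :
  \sum_(i < l.+1) bdiff u i = u l.
Proof.
elim: l => [|l IH]; first by rewrite big_ord1 /bdiff subr0.
by rewrite big_ord_recr /= IH /bdiff /= addrC subrK.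
Qed.

(** Discrete convolution is symmetric: both sides sum [bdiff u i * bdiff v j] over i + j <= l. *)
Lemma sum_bdiffC {V : comPzRingType} (u v : nat -> V) l :
  \sum_(i < l.+1) bdiff u i * v (l - i)%N = \sum_(i < l.+1) bdiff v i * u (l - i)%N.
Proof.
have E (a b : nat -> V) : \sum_(i < l.+1) bdiff a i * b (l - i)%N =
    \sum_(i < l.+1) \sum_(j < l.+1 | (i + j <= l)%N) bdiff a i * bdiff b j.
  apply: eq_bigr => -[i /= il] _; rewrite -mulr_sumr; congr (_ * _).
  rewrite -sum_bdiff (big_ord_widen_cond l.+1 xpredT (bdiff b)); last first.
    by rewrite ltnS leq_subr.
  by apply: eq_bigl => j /=; rewrite ltnS -leq_subRL// addnC.
rewrite !E (exchange_big_dep xpredT)//=; apply: eq_bigr => i _; apply: eq_big => j.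
  by rewrite addnC.
by rewrite mulrC.
Qed.

(* [b i] is the event that the first renewal time [T] is at most [i * h], and
   [F n l] is the probability of [n] renewals within [l] steps when each renewal
   time is rounded up to the grid, hence by at most [h]. *)
Section renewal_sandwich.
Context {R : realType} {d : measure_display} {Omega : measurableType d}.
Variables (P : probability Omega R) (T : Omega -> R) (b : nat -> Omega -> bool).
Variables (F : nat -> nat -> R) (h : R).
Let p i := fine (P [set w | b i w]).
Hypothesis mb : forall i, measurable [set w | b i w].
Hypothesis bS : forall w i, b i w -> b i.+1 w.
Hypothesis F0 : forall l, F 0%N l = 1.
Hypothesis FS : forall n l,
  F n.+1 l = \sum_(i < l.+1) bdiff p i * F n (l - i)%N.
Hypothesis mT : measurable_fun setT T.
Hypothesis T0 : forall w, 0 <= T w.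
Hypothesis T_le : forall i w, b i w -> T w <= i%:R * h.
Hypothesis T_ge : forall i w, ~~ b i w -> (exists j, b j w) -> i%:R * h <= T w.
Hypothesis null : P [set w | forall j, ~~ b j w] = 0%E.
Hypothesis h0 : 0 < h.

Let integrable_step (G : nat -> R) i :
  P.-integrable setT (EFin \o (fun w => bdiff (fun j => (b j w)%:R) i * G i)).
Proof.
under [X in EFin \o X]eq_fun do rewrite mulrC.
apply: integrableZl_EFin; apply: integrableB_EFin; first exact: integrable_boolr.
by case: i => [|i]; [exact: finite_measure_integrable_cst|exact: integrable_boolr].
Qed.

Let Rintegral_step (G : nat -> R) l :
  \int[P]_w (\sum_(i < l.+1) bdiff (fun j => (b j w)%:R) i * G i) =
  \sum_(i < l.+1) bdiff p i * G i.
Proof.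
rewrite (Rintegral_sumr (f := fun i w => bdiff (fun j => (b j w)%:R) i * G i))//.
apply: eq_bigr => -[i /= _] _.
have Ii : P.-integrable setT (EFin \o (fun w => bdiff (fun j => (b j w)%:R : R) i)).
  have := integrable_step (fun=> 1) i.
  by under [X in EFin \o X]eq_fun do rewrite mulr1.
rewrite RintegralZr//; congr (_ * _); rewrite /bdiff RintegralB//.
- rewrite Rintegral_boolr//; congr (_ - _).
  by case: i {Ii} => [|i]; [rewrite RintegralT_cst|rewrite Rintegral_boolr].
- exact: integrable_boolr.
- by case: i {Ii} => [|i]; [exact: finite_measure_integrable_cst|exact: integrable_boolr].
Qed.

Let step_value (G : nat -> R) l w :
  if b l w then exists i0, [/\ (i0 <= l)%N, b i0 w, (forall i, (i < i0)%N -> ~~ b i w) &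
     \sum_(i < l.+1) bdiff (fun j => (b j w)%:R) i * G i = G i0]
  else \sum_(i < l.+1) bdiff (fun j => (b j w)%:R) i * G i = 0.
Proof.
have E : \sum_(i < l.+1) bdiff (fun j => (b j w)%:R) i * G i =
    \sum_(i < l.+1) ((b i w)%:R - (if val i is k.+1 then b k w else false)%:R) * G i.
  by apply: eq_bigr => -[[|i] /= _] _.
by rewrite E; apply: sum_first => i; exact: bS.
Qed.

Local Notation A := (shift_mean P T).

Section test_function.
Variable f : R -> R.
Hypothesis f01 : forall y, 0 <= f y <= 1.
Hypothesis mf : measurable_fun setT f.
Hypothesis df : {homo f : x y / x <= y >-> y <= x}.

Let fB y : `|f y| <= 1. Proof. by have /andP[? ?] := f01 y; rewrite ger0_norm. Qed.

Let iterP n : [/\ measurable_fun setT (iter n A f), (forall y, 0 <= iter n A f y <= 1) &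
  {homo iter n A f : x y / x <= y >-> y <= x}].
Proof.
elim: n => [//|n [mn n01 dn]].
have [mn' nB'] := iter_shift_mean_bounded P mT n.+1 mf fB.
have [_ nB] := iter_shift_mean_bounded P mT n mf fB.
split => // [y|x y xy].
  have := nB' y; rewrite ler_norml => /andP[_ ->]; rewrite andbT.
  by apply: Rintegral_ge0 => w _; have /andP[] := n01 (y + T w).
apply: le_Rintegral => //.
- exact: (integrable_shiftr P mT y mn nB).
- exact: (integrable_shiftr P mT x mn nB).
- by move=> w _; apply: dn; rewrite lerD2r.
Qed.

(** Here [x] is the time already spent. The first index i with [b i] satisfies T <= i h, and the
    averages of [f] are nonincreasing, so passing from the rounded time i h to T can only increase
    them. *)
Lemma renewal_upper n l x : (forall y, y <= x + l%:R * h -> f y = 1) ->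
  F n l <= iter n A f x.
Proof.
elim: n l x => [|n IH] l x f1.
  by rewrite F0 /= f1// lerDl mulr_ge0// ltW.
have [mn n01 dn] := iterP n.
have nB y : `|iter n A f y| <= 1 by have /andP[? ?] := n01 y; rewrite ger0_norm.
rewrite FS; apply: (@le_trans _ _ (\sum_(i < l.+1) bdiff p i * iter n A f (x + i%:R * h))).
  apply: ler_sum => -[i /= il] _; apply: ler_wpM2l.
    rewrite /bdiff subr_ge0; case: i {il} => [|i]; first by rewrite fine_ge0.
    rewrite fine_le ?fin_num_measure// le_measure ?inE// => w; exact: bS.
  apply: IH => y yx; apply: f1; apply: (le_trans yx).
  by rewrite -addrA -mulrDl -natrD subnKC.
rewrite -(Rintegral_step (fun i => iter n A f (x + i%:R * h))); apply: le_Rintegral => //.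
- apply: (integrable_sumr (f := fun i w => bdiff (fun j => (b j w)%:R) i * iter n A f (x + i%:R * h))).
  by move=> i _; exact: (integrable_step (fun i => iter n A f (x + i%:R * h))).
- exact: (integrable_shiftr P mT x mn nB).
move=> w _; have := step_value (fun i => iter n A f (x + i%:R * h)) l w.
case: ifP => [bl [i0 [i0l bi0 _ ->]]|_ ->]; last by have /andP[] := n01 (x + T w).
by apply: dn; rewrite lerD2l; exact: T_le.
Qed.

(** Rounding lengthens a renewal by at most [h]; starting at [x + n h] pays for the [n] roundings in
    advance. *)
Lemma renewal_lower n l x : (forall y, x + l%:R * h < y -> f y = 0) ->
  iter n A f (x + n%:R * h) <= F n l.
Proof.
elim: n l x => [|n IH] l x f0.
  by rewrite F0; have /andP[] := f01 (x + 0%:R * h).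
have [mn n01 dn] := iterP n.
have nB y : `|iter n A f y| <= 1 by have /andP[? ?] := n01 y; rewrite ger0_norm.
have z0 m y : x + l%:R * h < y -> iter m A f y = 0.
  elim: m y => [|m IHm] y xy /=; first exact: f0.
  rewrite /shift_mean (eq_Rintegral _ (g := cst 0)) ?RintegralT_cst// => w _.
  by rewrite IHm// (lt_le_trans xy)// lerDl.
(* On this null event [T_ge] gives nothing. The indicator of [N], of integral 0, is added on the
   right so that the comparison holds at every outcome. *)
pose N := [set w | forall j, ~~ b j w].
have mN : measurable N.
  have -> : N = ~` \bigcup_j [set w | b j w].
    apply/seteqP; split => [w wN [j _ /= bj]|w wN j].
      by have := wN j; rewrite bj.
    by apply/negP => bj; apply: wN; exists j.
  by apply: measurableC; exact: bigcup_measurable.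
have N0 : \int[P]_w (w \in N)%:R = 0 :> R.
  rewrite (Rintegral_boolr P (b := fun w => w \in N)); last by rewrite set_mem_set.
  by rewrite set_mem_set null.
have IN : P.-integrable setT (EFin \o (fun w => (w \in N)%:R : R)).
  by apply: integrable_boolr; rewrite set_mem_set.
have IS : P.-integrable setT (EFin \o (fun w =>
    \sum_(i < l.+1) bdiff (fun j => (b j w)%:R) i * F n (l - i)%N)).
  apply: (integrable_sumr (f := fun i w => bdiff (fun j => (b j w)%:R) i * F n (l - i)%N)).
  by move=> i _; exact: (integrable_step (fun i => F n (l - i)%N)).
rewrite FS -(Rintegral_step (fun i => F n (l - i)%N)) -[leRHS]addr0 -[X in _ <= _ + X]N0.
rewrite -RintegralD//.
apply: (@le_Rintegral _ _ _ P _ (fun w => iter n A f (x + n.+1%:R * h + T w))) => //.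
- exact: (integrable_shiftr P mT (x + n.+1%:R * h) mn nB).
- exact: integrableD_EFin.
move=> w _; have := step_value (fun i => F n (l - i)%N) l w.
have e1 : x + n.+1%:R * h = x + n%:R * h + h by rewrite -natr1 mulrDl mul1r addrA.
case: ifP => [bl [i0 [i0l bi0 nb ->]]|nbl ->].
  apply: (@le_trans _ _ (F n (l - i0)%N)); last by rewrite lerDl.
  have T_i0 : i0%:R * h <= T w + h.
    case: i0 {i0l} bi0 nb => [|k] bi0 nb; first by rewrite mul0r addr_ge0// ltW.
    rewrite -natr1 mulrDl mul1r lerD2r; apply: T_ge; first exact: nb.
    by exists k.+1.
  apply: le_trans (IH (l - i0)%N (x + i0%:R * h) _).
    by apply: dn; rewrite e1; lra.
  move=> y xy; apply: f0; apply: le_lt_trans xy.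
  by rewrite -addrA -mulrDl -natrD subnKC.
rewrite add0r; have [wN|wN] := boolP (w \in N).
  by have /andP[] := n01 (x + n.+1%:R * h + T w).
rewrite z0//.
have [j bj] : exists j, b j w.
  by apply: contrapT => H; move: wN; rewrite notin_setE; apply => j; apply/negP => bj; apply: H; exists j.
have lT : l%:R * h <= T w by apply: T_ge; [rewrite nbl|exists j].
have nh : 0 <= n%:R * h by rewrite mulr_ge0// ltW.
rewrite e1 -!addrA ltrD2l; apply: (le_lt_trans lT).
by rewrite addrA ltrDr ltr_wpDl.
Qed.

End test_function.
End renewal_sandwich.

(** * Sampling a subordinator along a grid *)

Lemma greedy_ext {R : realType} (delta : R) (u v : nat -> R) m :
  (forall i, (i < m)%N -> u i = v i) -> greedy delta u m = greedy delta v m.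
Proof.
elim: m => [//|m IH] uv /=; rewrite IH => [|i im]; last exact/uv/leqW.
by rewrite uv.
Qed.

Section grid.
Context {R : realType} {d : measure_display} {Omega : measurableType d}.
Variables (P : probability Omega R) (X : R -> Omega -> R).
Hypothesis subX : subordinator P X.

Let mX t : 0 <= t -> measurable_fun setT (X t).
Proof. by case: subX => /levy_measurable mX _; exact: mX. Qed.

Let ndX w s t : 0 <= s -> s <= t -> X s w <= X t w.
Proof. by move=> s0 st; case: subX => _ mono; exact: mono. Qed.

Let measurable_preimage (f : Omega -> R) (B : set R) :
  measurable_fun setT f -> measurable B -> measurable (f @^-1` B).
Proof. by move=> mf mB; rewrite -[X in measurable X]setTI; exact: mf. Qed.

Lemma measurable_le_level t delta : 0 <= t -> measurable [set w | X t w <= delta].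
Proof.
move=> t0; have := measurable_preimage (mX t0) (measurable_itv `]-oo, delta]).
by congr measurable; apply/seteqP; split => w; rewrite /= in_itv.
Qed.

Lemma measurable_gt_level t delta : 0 <= t -> measurable [set w | delta < X t w].
Proof.
move=> t0; have := measurable_preimage (mX t0) (measurable_itv `]delta, +oo[).
by congr measurable; apply/seteqP; split => w; rewrite /= in_itv/= andbT.
Qed.

Section mesh.
Variables (delta h : R).
Hypothesis delta0 : 0 <= delta.
Hypothesis h0 : 0 < h.

Definition grid_count (l : nat) (w : Omega) : nat :=
  (greedy delta (fun i => X (i.+1%:R * h) w - X (i%:R * h) w) l).2.

Let ih0 (i : nat) : 0 <= i%:R * h. Proof. by rewrite mulr_ge0// ltW. Qed.

Let ih_le (i j : nat) : (i <= j)%N -> i%:R * h <= j%:R * h.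
Proof. by move=> ij; rewrite ler_pM2r// ler_nat. Qed.

Let ndS w : {homo (fun i => X (i%:R * h) w) : i j / (i <= j)%N >-> i <= j}.
Proof. by move=> i j ij; apply: ndX => //; exact: ih_le. Qed.

Lemma grid_count_separated l n w :
  (n <= grid_count l w)%N <->
  separated [set X (j%:R * h) w | j in [set j | (j <= l)%N]] delta n.
Proof. exact: (greedy_separated delta0 (@ndS w)). Qed.

(** A time sequence following the grid up to index [j], then jumping to [l h] and staying there. Its
    increment number [j] is the whole displacement from [j h] to [l h], so that independence of
    increments applies to it and to the greedy state before [j]. *)
Let t_ (j l i : nat) : R := if (i <= j)%N then i%:R * h else l%:R * h.

Let increments j l : (j <= l)%N ->
  mutually_independent P (fun i w => X (t_ j l i.+1) w - X (t_ j l i) w) /\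
  (forall i, measurable_fun setT (fun w => X (t_ j l i.+1) w - X (t_ j l i) w)).
Proof.
move=> jl; split.
  case: subX => -[_ _ _ _ _ ind] _; apply: ind; first by rewrite /t_ leq0n.
  move=> m n mn; rewrite /t_; case: (leqP n j) => nj.
    by rewrite (leq_trans mn nj); exact: ih_le.
  by case: (leqP m j) => mj; apply: ih_le => //; exact: leq_trans jl.
by move=> i; apply: measurable_funB; apply: mX; rewrite /t_; case: ifP.
Qed.

Lemma measurable_grid_count l n : measurable [set w | (n <= grid_count l w)%N].
Proof.
have [_ mY] := increments (leqnn l).
have mG := measurable_greedy delta mY l.
have -> : [set w | (n <= grid_count l w)%N] =
    (fun w => greedy delta (fun i => X (t_ l l i.+1) w - X (t_ l l i) w) l) @^-1`
      (snd @^-1` [set k | (n <= k)%N]).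
  apply/seteqP; split => w; rewrite /= /grid_count;
    rewrite (@greedy_ext _ _ _ (fun i => X (t_ l l i.+1) w - X (t_ l l i) w))// => i il;
    by rewrite /t_ il ltnW.
rewrite -[X in measurable X]setTI; apply: mG => //.
have : measurable_fun setT (@snd R nat) by exact: measurable_snd.
by move=> /(_ measurableT [set k | (n <= k)%N] I); rewrite setTI.
Qed.

Lemma grid_count_indep m j l n : (m <= j)%N -> (j <= l)%N ->
  P ([set w | (n <= grid_count m w)%N] `&`
     [set w | X (l%:R * h) w - X (j%:R * h) w <= delta]) =
  (P [set w | (n <= grid_count m w)%N] * P [set w | (X ((l - j)%:R * h) w <= delta)%R])%E.
Proof.
move=> mj jl; have [iY mY] := increments jl.
have mB : measurable (`]-oo, delta]%classic : set R) by exact: measurable_itv.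
have := greedy_indep delta mY iY n mj mB.
have -> : [set w | (n <= (greedy delta (fun i => (X (t_ j l i.+1) w - X (t_ j l i) w)%R) m).2)%N]
   = [set w | (n <= grid_count m w)%N].
  apply/seteqP; split => w; rewrite /= /grid_count;
    rewrite (@greedy_ext _ _ (fun i => X (i.+1%:R * h) w - X (i%:R * h) w) (fun i => X (t_ j l i.+1) w - X (t_ j l i) w))// => i im;
    by rewrite /t_ (leq_trans im mj) (ltnW (leq_trans im mj)).
have tj : t_ j l j = j%:R * h by rewrite /t_ leqnn.
have tj1 : t_ j l j.+1 = l%:R * h by rewrite /t_ ltnn.
rewrite tj tj1.
have -> : (fun w => X (l%:R * h) w - X (j%:R * h) w) @^-1` `]-oo, delta]%classic
  = [set w | X (l%:R * h) w - X (j%:R * h) w <= delta].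
  by apply/seteqP; split => w; rewrite /= in_itv.
move=> ->; congr (_ * _)%E.
case: subX => -[_ _ _ _ stat _] _.
have := stat (j%:R * h) (l%:R * h) _ (ih0 j) (ih_le jl) mB.
have -> : (fun w => X (l%:R * h) w - X (j%:R * h) w) @^-1` `]-oo, delta]%classic
  = [set w | X (l%:R * h) w - X (j%:R * h) w <= delta].
  by apply/seteqP; split => w; rewrite /= in_itv.
move=> ->; rewrite -mulrBl -natrB//; congr (P _).
Qed.

Definition grid_prob (n l : nat) : R := fine (P [set w | (n <= grid_count l w)%N]).

Lemma grid_prob0 l : grid_prob 0 l = 1.
Proof.
rewrite /grid_prob (_ : [set w | _] = setT) ?probability_setT//.
by apply/seteqP; split.
Qed.

Let q i := fine (P [set w | X (i%:R * h) w <= delta]).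
Let p i := fine (P [set w | delta < X (i%:R * h) w]).

Let pq i : p i = 1 - q i.
Proof.
rewrite /p /q (_ : [set w | _ < _] = ~` [set w | X (i%:R * h) w <= delta]); last first.
  by apply/seteqP; split => w /=; rewrite ltNge => /negP.
have mq := measurable_le_level delta (ih0 i).
by rewrite probability_setC// fineB// fin_num_measure.
Qed.

Let integral_pair n m j l : (m <= j)%N -> (j <= l)%N ->
  \int[P]_w ((n <= grid_count m w)%N%:R * (X (l%:R * h) w - X (j%:R * h) w <= delta)%R%:R) =
  grid_prob n m * q (l - j).
Proof.
move=> mj jl.
have mc := measurable_grid_count m n.
have ml : measurable [set w | X (l%:R * h) w - X (j%:R * h) w <= delta].
  have := measurable_preimage (measurable_funB (mX (ih0 l)) (mX (ih0 j))) (measurable_itv `]-oo, delta]).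
  by congr measurable; apply/seteqP; split => w; rewrite /= in_itv.
under eq_Rintegral do rewrite -natrM mulnb.
rewrite Rintegral_boolr.
  rewrite -fineM ?fin_num_measure//; last exact: measurable_le_level.
  rewrite -grid_count_indep//; congr (fine (P _)).
  by apply/seteqP; split => w /= => [/andP[]|[-> ->]].
have -> : [set w | (n <= grid_count m w)%N && (X (l%:R * h) w - X (j%:R * h) w <= delta)] =
    [set w | (n <= grid_count m w)%N] `&` [set w | X (l%:R * h) w - X (j%:R * h) w <= delta].
  by apply/seteqP; split => w /= => [/andP[]|[-> ->]].
exact: measurableI.
Qed.

Let integrable_pair n m j l :
  P.-integrable setT (EFin \o (fun w =>
     (n <= grid_count m w)%N%:R * (X (l%:R * h) w - X (j%:R * h) w <= delta)%R%:R)).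
Proof.
apply: (@bounded_integrable _ _ _ P _ 1) => [|w].
  apply: measurable_funM; apply: measurable_fun_boolr.
    exact: measurable_grid_count.
  have := measurable_preimage (measurable_funB (mX (ih0 l)) (mX (ih0 j))) (measurable_itv `]-oo, delta]).
  by congr measurable; apply/seteqP; split => v; rewrite /= in_itv.
by rewrite -natrM mulnb ger0_norm// lern1 leq_b1.
Qed.

Let grid_prob_first_step n l :
  grid_prob n l - grid_prob n.+1 l =
  \sum_(j < l.+1) bdiff (grid_prob n) j * q (l - j).
Proof.
have -> : grid_prob n l - grid_prob n.+1 l = \int[P]_w (grid_count l w == n)%:R.
  rewrite /grid_prob -!Rintegral_boolr; try exact: measurable_grid_count.
  rewrite -RintegralB//; try (apply: integrable_boolr; exact: measurable_grid_count).
  apply: eq_Rintegral => w _; case: (ltngtP n (grid_count l w)) => nc.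
  - by rewrite subrr.
  - by rewrite subrr.
  - by rewrite subr0.
pose f j w : R := ((n <= grid_count j w)%N%:R
   - (if j is k.+1 then (n <= grid_count k w)%N else false)%:R)
   * (X (l%:R * h) w - X (j%:R * h) w <= delta)%R%:R.
transitivity (\int[P]_w (\sum_(j < l.+1) f j w)).
  by apply: eq_Rintegral => w _; rewrite /grid_count (greedy_count_eq delta0 (@ndS w)).
have If j : P.-integrable setT (EFin \o f j).
  rewrite /f; under [X in EFin \o X]eq_fun do rewrite mulrBl.
  apply: integrableB_EFin => //; case: j => [|k]; last exact: integrable_pair.
  under [X in EFin \o X]eq_fun do rewrite mul0r.
  exact: finite_measure_integrable_cst.
rewrite Rintegral_sumr//; apply: eq_bigr => -[j /= jl] _.
rewrite ltnS in jl; rewrite /f /bdiff.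
under eq_Rintegral do rewrite mulrBl.
case: j jl => [|j] jl.
  rewrite subr0 -integral_pair//; apply: eq_Rintegral => w _.
  by rewrite mulr0n !mul0r subr0.
by rewrite RintegralB// !integral_pair// mulrBl.
Qed.

(* Independence of increments gives the decomposition at the opening of the last
   interval; [sum_bdiffC] transfers it to the first one. *)
Lemma grid_probS n l :
  grid_prob n.+1 l = \sum_(i < l.+1) bdiff p i * grid_prob n (l - i).
Proof.
rewrite sum_bdiffC; under eq_bigr do rewrite pq mulrBr mulr1.
rewrite sumrB sum_bdiff -grid_prob_first_step; ring.
Qed.

End mesh.
End grid.

(** * The range as the limit of dyadic grids *)

Section range.
Context {R : realType} {d : measure_display} {Omega : measurableType d}.
Variables (P : probability Omega R) (X : R -> Omega -> R).
Hypothesis subX : subordinator P X.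
Variables (t delta : R).
Hypothesis t0 : 0 < t.
Hypothesis delta0 : 0 < delta.

Let ndX w s u : 0 <= s -> s <= u -> X s w <= X u w.
Proof. by move=> s0 su; case: subX => _ mono; exact: mono. Qed.

(** Dyadic grids are nested, so the counts increase with [k] and the tail events increase to their
    union. *)
Let mesh k : R := t / (2 ^ k)%:R.

Let mesh0 k : 0 < mesh k.
Proof. by rewrite divr_gt0// ltr0n expn_gt0. Qed.

Let meshE k : (2 ^ k)%:R * mesh k = t.
Proof. by rewrite /mesh mulrC divfK// pnatr_eq0 -lt0n expn_gt0. Qed.

Let range w := [set X s w | s in `[0, t]%classic].

Definition range_count k w := grid_count X delta (mesh k) (2 ^ k) w.

Let range_count_sep k n w : (n <= range_count k w)%N <->
  separated [set X (j%:R * mesh k) w | j in [set j | (j <= 2 ^ k)%N]] delta n.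
Proof. exact: (grid_count_separated subX (ltW delta0) (mesh0 k)). Qed.

Let range_count_le k n w : (n <= range_count k w)%N -> (n <= range_count k.+1 w)%N.
Proof.
rewrite !range_count_sep; apply: separated_sub => _ [j /= jk <-].
exists (j * 2)%N => /=; first by rewrite expnSr leq_mul2r jk orbT.
congr (X _ w); rewrite /mesh expnSr !natrM.
by field; rewrite pnatr_eq0 -lt0n expn_gt0.
Qed.

(** The gaps of a chain are strict, so by right continuity each of its times can be moved right to a
    grid time without closing a gap; with finitely many gaps one [k] serves them all. *)
Lemma range_separated n w :
  separated (range w) delta n <-> exists k, (n <= range_count k w)%N.
Proof.
split; last first.
  move=> [k /range_count_sep]; apply: separated_sub => _ [j /= jk <-].
  exists (j%:R * mesh k) => //=; rewrite in_itv/=; apply/andP; split.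
    by rewrite mulr_ge0// ltW.
  by rewrite -[leRHS](meshE k) ler_pM2r// ler_nat.
move=> [x [xr xgap]].
have : forall i, exists u, (i <= n)%N -> 0 <= u <= t /\ X u w = x i.
  move=> i; have [ni|ni] := leqP i n; last by exists 0.
  by have [u /=] := xr i ni; rewrite in_itv/= => u0 <-; exists u.
move=> /choice[u uP].
(* Every time but the last precedes [t], as a larger value is still to come; hence the grid time
   that replaces it does not pass [t]. *)
have ut i : (i < n)%N -> u i < t.
  move=> ni; have [/andP[ui0 uit] uix] := uP i (ltnW ni).
  have [/andP[uj0 ujt] ujx] := uP i.+1 ni.
  rewrite lt_neqAle uit andbT; apply/eqP => uitE.
  have := xgap i ni; rewrite -uix -ujx uitE.
  by have := ndX w uj0 ujt; have := delta0; lra.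
pose j k i := (Num.truncn (u i / mesh k)).+1.
have jP k i : 0 <= u i -> u i < (j k i)%:R * mesh k <= u i + mesh k.
  move=> ui0; have um : 0 <= u i / mesh k by rewrite divr_ge0// ltW.
  have /andP[h1 h2] := truncn_itv um.
  rewrite -ltr_pdivrMr// h2/= /j -natr1 mulrDl mul1r lerD2r.
  by rewrite -ler_pdivlMr.
have : forall i, exists k, (i < n)%N -> forall k', (k <= k')%N ->
    X ((j k' i)%:R * mesh k') w + delta < x i.+1.
  move=> i; have [ni|ni] := ltnP i n; last by exists 0%N.
  have [/andP[ui0 uit] uix] := uP i (ltnW ni).
  have := levy_right_continuous (proj1 subX) (w := w) ui0.
  have gap0 : 0 < x i.+1 - delta - X (u i) w by rewrite uix; have := xgap i ni; lra.
  move=> /cvgrPdist_lt /(_ _ gap0)[e /= e0 He].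
  have [k ke] : exists k, mesh k < e.
    exists (Num.truncn (t / e)).+1; rewrite /mesh ltr_pdivrMr ?ltr0n ?expn_gt0//.
    rewrite mulrC -ltr_pdivrMr// (lt_le_trans (Num.Theory.truncnS_gt _))// ler_nat.
    exact/ltnW/ltn_expl.
  exists k => _ k' kk'.
  have mk : mesh k' < e.
    apply: le_lt_trans ke; rewrite /mesh ler_pM2l// lef_pV2 ?posrE ?ltr0n ?expn_gt0//.
    by rewrite ler_nat leq_exp2l.
  have /andP[h1 h2] := jP k' i ui0.
  have := He ((j k' i)%:R * mesh k'); rewrite /ball_ /=.
  rewrite distrC gtr0_norm ?subr_gt0// => /(_ _ h1).
  have Xle := ndX w ui0 (ltW h1).
  rewrite distrC ger0_norm ?subr_ge0// => H.
  have {}H : X ((j k' i)%:R * mesh k') w - X (u i) w < x i.+1 - delta - X (u i) w.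
    by apply: H; lra.
  by lra.
move=> /choice[K KP].
pose k := (\max_(i < n) K i)%N.
exists k; apply/range_count_sep.
(* The last point has no later grid time to rely on; [t] itself lies on every grid and has the
   largest value. *)
exists (fun i => if (i < n)%N then X ((j k i)%:R * mesh k) w else X t w); split.
  move=> i ni; case: ltnP => [ni'|_].
    have [/andP[ui0 uit] _] := uP i ni.
    have um : 0 <= u i / mesh k by rewrite divr_ge0// ltW.
    exists (j k i) => //=; rewrite /j truncn_lt_nat//.
    by rewrite ltr_pdivrMr// meshE ut.
  by exists (2 ^ k)%N => /=; rewrite ?meshE.
move=> i ni; rewrite ni.
have kK : (K i <= k)%N by exact: (leq_bigmax (Ordinal ni)).
apply: (lt_le_trans (KP i ni k kK)).
have [/andP[ui0 uit] <-] := uP i.+1 ni.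
case: ifP => _; last exact: ndX.
by apply: ndX => //; apply: ltW; have /andP[] := jP k i.+1 ui0.
Qed.

Lemma range_covering_number_nat w : exists m : nat,
  range_covering_number X t delta w = m%:R /\
  forall n, (n < m)%N <-> exists k, (n <= range_count k w)%N.
Proof.
have [||m [mE H]] := @covering_number_nat R (range w) delta delta0.
- exists (X 0 w) => y [s /=]; rewrite in_itv/= => /andP[s0 _] <-.
  exact: ndX.
- exists (X t w) => y [s /=]; rewrite in_itv/= => /andP[s0 st] <-.
  exact: ndX.
by exists m; split; [exact: mE|move=> n; rewrite H range_separated].
Qed.

Lemma range_covering_number_gt y : 0 <= y ->
  [set w | y < range_covering_number X t delta w] =
  \bigcup_k [set w | (Num.truncn y <= range_count k w)%N].
Proof.
move=> y0; apply/seteqP; split => w /=.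
  have [m [-> H]] := range_covering_number_nat w.
  by rewrite -truncn_lt_nat// => /H[k hk]; exists k.
move=> [k _ /= hk]; have [m [-> H]] := range_covering_number_nat w.
by rewrite -truncn_lt_nat//; apply/H; exists k.
Qed.

Let measurable_range_count k n : measurable [set w | (n <= range_count k w)%N].
Proof. exact: (measurable_grid_count subX). Qed.

Lemma measurable_range_covering_number :
  measurable_fun setT (range_covering_number X t delta).
Proof.
move=> _; apply: (measurability _ (RGenOInfty.measurableE R)) => //.
move=> _ [_ [y ->]] <-; rewrite setTI preimage_itvoy.
have [y0|y0] := leP 0 y.
  by rewrite range_covering_number_gt//; exact: bigcup_measurable.
rewrite (_ : [set _ | _] = setT)//; apply/seteqP; split => // w _ /=.
by have [m [-> _]] := range_covering_number_nat w; rewrite (lt_le_trans y0).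
Qed.

Lemma grid_prob_le_range y k : 0 <= y ->
  grid_prob P X delta (mesh k) (Num.truncn y) (2 ^ k) <=
  fine (P [set w | y < range_covering_number X t delta w]).
Proof.
move=> y0; rewrite range_covering_number_gt// fine_le ?fin_num_measure//.
- exact: measurable_range_count.
- exact: bigcup_measurable.
- apply: le_measure; rewrite ?inE//; [exact: measurable_range_count|exact: bigcup_measurable|].
  by move=> w; exists k.
Qed.

Lemma range_prob_le y u : 0 <= y ->
  (forall k, grid_prob P X delta (mesh k) (Num.truncn y) (2 ^ k) <= u) ->
  fine (P [set w | y < range_covering_number X t delta w]) <= u.
Proof.
move=> y0 gu; rewrite range_covering_number_gt//.
have mU : measurable (\bigcup_k [set w | (Num.truncn y <= range_count k w)%N]).
  exact: bigcup_measurable.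
rewrite -lee_fin fineK ?fin_num_measure//.
have := @nondecreasing_cvg_mu _ _ _ P (fun k => [set w | (Num.truncn y <= range_count k w)%N])
  (fun k => measurable_range_count k _) mU.
move=> H; have {}H := H _.
have nd : nondecreasing_seq (fun k => [set w | (Num.truncn y <= range_count k w)%N]).
  by apply/nondecreasing_seqP => k; apply/subsetPset => w; exact: range_count_le.
have c := H nd; rewrite -(cvg_lim _ c)//.
apply: lime_le; first by apply/cvg_ex; eexists; exact: c.
apply: nearW => k /=; rewrite -[leLHS]fineK ?fin_num_measure//.
  by rewrite lee_fin; exact: gu.
Qed.

End range.

(** * Passage times *)

Section passage.
Context {R : realType} {d : measure_display} {Omega : measurableType d}.
Variables (P : probability Omega R) (X : R -> Omega -> R).
Hypothesis subX : subordinator P X.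
Variable delta : R.

Let ndX w s u : 0 <= s -> s <= u -> X s w <= X u w.
Proof. by move=> s0 su; case: subX => _ mono; exact: mono. Qed.

Let level w : set R := `[0, +oo[%classic `&` [set s | X s w <= delta].

Let measurable_level w : measurable (level w).
Proof.
apply: is_interval_measurable => a b [/= a0 aX] [/= b0 bX] c /andP[ac cb].
rewrite !in_itv/= !andbT in a0 b0.
have c0 : 0 <= c by exact: le_trans ac.
by split; [rewrite /= in_itv/= c0|exact: le_trans (ndX w c0 cb) bX].
Qed.

Lemma passage_timeE w : passage_time X delta w = lebesgue_measure (level w).
Proof.
transitivity (\int[lebesgue_measure]_s (\1_(level w) s)%:E)%E; last first.
  by rewrite integral_indic ?setIT//; exact: measurable_level.
rewrite /passage_time integral_mkcond; apply: eq_integral => s _.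
rewrite patchE [in RHS]indicE; case: ifPn => [/set_mem sI|sI].
  by rewrite indicE in_setI (mem_set sI).
by rewrite in_setI (memNset (fun h => negP sI (mem_set h))).
Qed.

Lemma passage_time_le s w : 0 <= s -> delta < X s w -> (passage_time X delta w <= s%:E)%E.
Proof.
move=> s0 sX; rewrite passage_timeE.
have -> : s%:E = lebesgue_measure (`[0, s]%classic : set R).
  by rewrite lebesgue_measure_itv/= lte_fin; case: ltP => [_|h]; rewrite ?oppr0 ?adde0//; congr EFin; lra.
apply: le_measure; rewrite ?inE//; first exact: measurable_level.
move=> u [/=]; rewrite !in_itv/= andbT => u0 uX; rewrite u0/=.
by rewrite leNgt; apply/negP => su; have := ndX w s0 (ltW su); lra.
Qed.

Lemma passage_time_ge s w : 0 <= s -> X s w <= delta -> (s%:E <= passage_time X delta w)%E.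
Proof.
move=> s0 sX; rewrite passage_timeE.
have -> : s%:E = lebesgue_measure (`[0, s]%classic : set R).
  by rewrite lebesgue_measure_itv/= lte_fin; case: ltP => [_|h]; rewrite ?oppr0 ?adde0//; congr EFin; lra.
apply: le_measure; rewrite ?inE//; first exact: measurable_level.
move=> u /=; rewrite !in_itv/= => /andP[u0 us]; split; rewrite /= ?in_itv/= ?u0//.
exact: le_trans (ndX w u0 us) sX.
Qed.

Lemma passage_time_ge0 w : (0 <= passage_time X delta w)%E.
Proof. by rewrite passage_timeE. Qed.

(** Monotone paths reduce [a < T] to the existence of a rational time beyond [a] at which the level
    is not yet exceeded, a countable union. *)
Lemma measurable_passage_time : measurable_fun setT (passage_time X delta).
Proof.
move=> _; apply: (measurability _ (ErealGenOInfty.measurableE R)) => //.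
move=> _ [_ [a ->]] <-; rewrite setTI preimage_itvoy.
have [a0|a0] := ltP a 0.
  rewrite (_ : [set _ | _] = setT)//; apply/seteqP; split => // w _ /=.
  by rewrite (lt_le_trans _ (passage_time_ge0 w))// lte_fin.
have -> : [set w | a%:E < passage_time X delta w]%E =
    \bigcup_(q : rat) (if a < ratr q then [set w | X (ratr q) w <= delta] else set0).
  apply/seteqP; split => w /=; last first.
    move=> [q _]; case: ifPn => // aq /= qX.
    by rewrite (lt_le_trans _ (passage_time_ge _ qX))// ?lte_fin// (le_trans a0)// ltW.
  move=> ap; apply: contrapT => H.
  have Xq q : a < ratr q -> (passage_time X delta w <= (ratr q)%:E)%E.
    move=> aq; apply: passage_time_le; first by rewrite (le_trans a0)// ltW.
    by rewrite ltNge; apply/negP => qX; apply: H; exists q => //; rewrite aq.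
  have aa1 : a < a + 1 by rewrite ltrDl.
  have [q0] := rat_in_itvoo aa1; rewrite in_itv/= => /andP[aq0 _].
  have pfin : passage_time X delta w \is a fin_num.
    by rewrite ge0_fin_numE ?passage_time_ge0// (le_lt_trans (Xq _ aq0))// ltry.
  rewrite -(fineK pfin) lte_fin in ap.
  have [q] := rat_in_itvoo ap; rewrite in_itv/= => /andP[aq qr].
  by have := Xq _ aq; rewrite -(fineK pfin) lee_fin leNgt qr.
apply: bigcupT_measurable_rat => q; case: ifPn => // aq.
by apply: (measurable_le_level subX); rewrite (le_trans a0)// ltW.
Qed.

End passage.

(** * Laplace transforms at all times and Chernoff bounds *)

Lemma ge0_integral_indep {R : realType} {d : measure_display} {Omega : measurableType d}
    (P : probability Omega R) (A B : Omega -> R) (F G : R -> R) :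
  measurable_fun setT A -> measurable_fun setT B ->
  (forall C D, measurable C -> measurable D ->
    P (A @^-1` C `&` B @^-1` D) = (P (A @^-1` C) * P (B @^-1` D))%E) ->
  measurable_fun setT F -> measurable_fun setT G ->
  (forall x, 0 <= F x) -> (forall x, 0 <= G x) ->
  (\int[P]_w (F (A w) * G (B w))%:E =
   (\int[P]_w (F (A w))%:E) * (\int[P]_w (G (B w))%:E))%E.
Proof.
move=> mA mB indep mF mG F0 G0.
pose A' : {RV P >-> R} := mfun_Sub (mem_set mA).
pose B' : {RV P >-> R} := mfun_Sub (mem_set mB).
pose m1 := distribution P A'; pose m2 := distribution P B'.
pose phi w := (A w, B w).
have mphi : measurable_fun setT phi by exact: measurable_fun_pair.
pose C' : {RV P >-> (R * R)%type} := mfun_Sub (mem_set mphi).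
pose h (z : R * R) : \bar R := (F z.1 * G z.2)%:E.
have mh : measurable_fun setT h.
  apply/measurable_EFinP; apply: measurable_funM; exact: measurableT_comp.
have h0 z : (0 <= h z)%E by rewrite lee_fin mulr_ge0.
transitivity (\int[distribution P C']_z h z)%E.
  by rewrite ge0_integral_distribution.
transitivity (\int[m1 \x m2]_z h z)%E.
  apply: eq_measure_integral => S mS _; apply/esym.
  apply: product_measure_unique; last exact: mS.
  move=> C D mC mD.
  by rewrite /m1 /m2 /distribution /pushforward/= -(indep C D mC mD).
rewrite fubini_tonelli1// /fubini_F/=.
under eq_integral => x _.
  rewrite /h/=; under eq_integral do rewrite EFinM.
  rewrite ge0_integralZl//; [|exact/measurable_EFinP|by move=> y _; rewrite lee_fin|by rewrite lee_fin].
  over.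
rewrite ge0_integralZr//; [|exact/measurable_EFinP|by move=> y _; rewrite lee_fin|by apply: integral_ge0 => y _; rewrite lee_fin].
rewrite (ge0_integral_distribution A' (f := EFin \o F)); [|exact/measurable_EFinP|by move=> y; rewrite lee_fin].
by rewrite (ge0_integral_distribution B' (f := EFin \o G)); [|exact/measurable_EFinP|by move=> y; rewrite lee_fin].
Qed.

Section laplace_transform.
Context {R : realType} {d : measure_display} {Omega : measurableType d}.
Variables (P : probability Omega R) (X : R -> Omega -> R).
Hypothesis subX : subordinator P X.

Let mX t : 0 <= t -> measurable_fun setT (X t).
Proof. by case: subX => /levy_measurable mX _; exact: mX. Qed.

Let ndX w s u : 0 <= s -> s <= u -> X s w <= X u w.
Proof. by move=> s0 su; case: subX => _ mono; exact: mono. Qed.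

Lemma subordinator_ge0 t w : 0 <= t -> 0 <= X t w.
Proof.
by move=> t0; rewrite -(levy_start0 (proj1 subX) w); exact: ndX.
Qed.

Variables (lambda phi : R).
Hypothesis lambda0 : 0 <= lambda.
Hypothesis phi0 : 0 <= phi.
Hypothesis laplace1 : \int[P]_w expR (- (lambda * X 1 w)) = expR (- phi).

Let f (x : R) := expR (- (lambda * x)).

Let mf : measurable_fun setT f.
Proof. by apply: measurableT_comp => //; apply: measurableT_comp. Qed.

Let f01 t w : 0 <= t -> `|f (X t w)| <= 1.
Proof.
move=> t0; rewrite ger0_norm ?expR_ge0// expR_le1 oppr_le0 mulr_ge0//.
exact: subordinator_ge0.
Qed.

Let g t := \int[P]_w f (X t w).

Lemma integrable_laplace t : 0 <= t ->
  P.-integrable setT (EFin \o (fun w => expR (- (lambda * X t w)))).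
Proof.
move=> t0; apply: (@bounded_integrable _ _ _ P _ 1).
  exact: measurableT_comp mf (mX t0).
by move=> w; exact: f01.
Qed.

Let gD s t : 0 <= s -> 0 <= t -> g (s + t) = g s * g t.
Proof.
move=> s0 t0; have st0 : 0 <= s + t by rewrite addr_ge0.
have sst : s <= s + t by rewrite lerDl.
pose Dst w := X (s + t) w - X s w.
have mD : measurable_fun setT Dst.
  exact: measurable_funB (mX st0) (mX s0).
have start0 w : X 0 w = 0 := levy_start0 (proj1 subX) w.
have indep C D : measurable C -> measurable D ->
    P (X s @^-1` C `&` Dst @^-1` D) =
    (P (X s @^-1` C) * P (Dst @^-1` D))%E.
  move=> mC mD'.
  (* Times 0, s, s + t, then constant: the first two increments are [X s] and [Dst]. *)
  pose u (n : nat) := if n is k.+1 then (if k is 0%N then s else s + t) else 0.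
  have u_nd : {homo u : m n / (m <= n)%N >-> m <= n}.
    by move=> [|[|m]] [|[|n]].
  have := levy_independent (proj1 subX) (t := u) (lexx 0) u_nd.
  move=> /(_ [fset 0; 1]%fset (fun i => if i is 0%N then C else D)).
  rewrite set_fsetU1 set_fset1 bigcap_setU1 bigcap_set1 big_fsetU1 ?inE//= big_seq_fset1/=.
  have -> : (fun w => X s w - X 0 w) = X s by apply/funext => w; rewrite start0 subr0.
  by apply=> -[|i].
have stat D : measurable D -> P (Dst @^-1` D) = P (X t @^-1` D).
  move=> mD'; rewrite (levy_stationary (proj1 subX) s0 sst mD').
  by rewrite addrAC subrr add0r.
rewrite /g /Rintegral -fineM; last 2 first.
- exact: (integrable_fin_num measurableT (integrable_laplace s0)).
- exact: (integrable_fin_num measurableT (integrable_laplace t0)).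
apply: (congr1 (@fine R)).
have -> : (\int[P]_w (f (X t w))%:E = \int[P]_w (f (Dst w))%:E)%E.
  pose A' : {RV P >-> R} := mfun_Sub (mem_set (mX t0)).
  pose B' : {RV P >-> R} := mfun_Sub (mem_set mD).
  have mEf : measurable_fun setT (EFin \o f) by exact/measurable_EFinP.
  have Ef0 y : (0 <= (EFin \o f) y)%E by rewrite lee_fin expR_ge0.
  transitivity (\int[distribution P A']_y (EFin \o f) y)%E.
    by rewrite ge0_integral_distribution.
  transitivity (\int[distribution P B']_y (EFin \o f) y)%E.
    apply: eq_measure_integral => D mD' _; apply/esym; exact: stat.
  by rewrite ge0_integral_distribution.
rewrite -(ge0_integral_indep (mX s0) mD indep mf mf); last 2 first.
- by move=> x; exact: expR_ge0.
- by move=> x; exact: expR_ge0.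
apply: eq_integral => w _; congr EFin; rewrite /f /Dst -expRD; congr expR; ring.
Qed.

Let g0 : g 0 = 1.
Proof.
rewrite /g -[RHS](RintegralT_cst P); apply: eq_Rintegral => w _.
by rewrite /f (levy_start0 (proj1 subX)) mulr0 oppr0 expR0.
Qed.

Let gM h n : 0 <= h -> g (n%:R * h) = g h ^+ n.
Proof.
move=> h0; elim: n => [|n IH]; first by rewrite mul0r g0.
by rewrite -natr1 mulrDl mul1r gD ?mulr_ge0// IH exprSr.
Qed.

Let g_ge0 t : 0 <= g t.
Proof. by apply: Rintegral_ge0 => w _; exact: expR_ge0. Qed.

Let g_frac m n : g (m%:R / n.+1%:R) = expR (- (m%:R / n.+1%:R * phi)).
Proof.
have h0 : 0 <= n.+1%:R^-1 :> R by rewrite invr_ge0.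
have E : g (n.+1%:R^-1) = expR (- (phi / n.+1%:R)).
  have : g (n.+1%:R^-1) ^+ n.+1 = expR (- (phi / n.+1%:R)) ^+ n.+1.
    rewrite -gM// divff ?pnatr_eq0// -expRM_natl.
    by rewrite mulrN mulrC divfK ?pnatr_eq0.
  by move=> /pexpIrn; apply; rewrite ?nnegrE ?expR_ge0.
rewrite gM// E -expRM_natl; congr expR; ring.
Qed.

Let g_noninc s t : 0 <= s -> s <= t -> g t <= g s.
Proof.
move=> s0 st; have t0 : 0 <= t by exact: le_trans st.
apply: le_Rintegral => //; [exact: integrable_laplace|exact: integrable_laplace|].
by move=> w _; rewrite ler_expR lerN2 ler_wpM2l// ndX.
Qed.

(** Multiplicativity in time settles the fractions with denominator n + 1, and monotonicity squeezes
    a real [t] between two consecutive ones; the logarithms then differ by at most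
    [phi / (n + 1)]. *)
Lemma laplace_at t : 0 <= t ->
  \int[P]_w expR (- (lambda * X t w)) = expR (- (t * phi)).
Proof.
move=> t0; rewrite -/(g t).
have bounds n : expR (- ((t + n.+1%:R^-1) * phi)) <= g t <= expR (- ((t - n.+1%:R^-1) * phi)).
  have tn0 : 0 <= t * n.+1%:R by rewrite mulr_ge0.
  have := truncn_itv tn0; set m := Num.truncn _ => /andP[m1 m2].
  have n0 : 0 < n.+1%:R :> R by rewrite ltr0n.
  have nn : t * n.+1%:R / n.+1%:R = t by rewrite mulfK// gt_eqF.
  have h1 : m%:R / n.+1%:R <= t by rewrite ler_pdivrMr.
  have h2 : t <= m.+1%:R / n.+1%:R by rewrite ler_pdivlMr// ltW.
  have h3 : m.+1%:R / n.+1%:R = m%:R / n.+1%:R + n.+1%:R^-1 :> R by rewrite -natr1 mulrDl div1r.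
  have m0 : 0 <= m%:R / n.+1%:R :> R by rewrite divr_ge0.
  apply/andP; split.
    apply: le_trans (g_noninc t0 h2); rewrite g_frac ler_expR lerN2 ler_wpM2r//.
    by rewrite h3 lerD2r.
  apply: (le_trans (g_noninc m0 h1)); rewrite g_frac ler_expR lerN2 ler_wpM2r//.
  by rewrite lerBlDr -h3.
have gp : 0 < g t by have /andP[+ _] := bounds 0%N; apply: lt_le_trans; exact: expR_gt0.
apply: ln_inj; rewrite ?posrE ?expR_gt0// expRK.
apply/eqP; rewrite -subr_eq0 -normr_le0; apply/ler_addgt0Pl => e e0; rewrite addr0.
pose n := Num.truncn (phi / e).
have ne : n.+1%:R^-1 * phi <= e.
  rewrite mulrC ler_pdivrMr ?ltr0n// mulrC -ler_pdivrMr//.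
  exact/ltW/Num.Theory.truncnS_gt.
have /andP[b1 b2] := bounds n.
have {}b1 : - ((t + n.+1%:R^-1) * phi) <= ln (g t).
  by rewrite -[leLHS]expRK ler_ln ?posrE ?expR_gt0.
have {}b2 : ln (g t) <= - ((t - n.+1%:R^-1) * phi).
  by rewrite -[leRHS]expRK ler_ln ?posrE ?expR_gt0.
move: ne b1 b2; rewrite (mulrDl t) (mulrDl t) mulNr; move: (_^-1 * phi) (t * phi) => z tp.
by rewrite ler_norml => *; apply/andP; split; lra.
Qed.

(** Chernoff: the indicator is at most e^(lambda (delta - X_t)). *)
Lemma prob_le_laplace t delta : 0 <= t ->
  fine (P [set w | X t w <= delta]) <= expR (lambda * delta - t * phi).
Proof.
move=> t0; have ml := measurable_le_level subX delta t0.
rewrite -Rintegral_boolr// expRD -(laplace_at t0).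
rewrite -(RintegralZl _ _ (integrable_laplace t0))//; apply: le_Rintegral => //.
- exact: integrable_boolr.
- exact: integrableZl_EFin (integrable_laplace t0).
move=> w _; rewrite -expRD; case: (leP (X t w) delta) => h; last exact: expR_ge0.
rewrite -expR0 ler_expR -mulrBr mulr_ge0// subr_ge0//.
Qed.

(** Markov's inequality for 1 - e^(-lambda X_t), which is nonnegative, and at least 1 - e^(-lambda
    delta) beyond [delta]. *)
Lemma prob_gt_laplace t delta : 0 <= t ->
  (1 - expR (- (lambda * delta))) * fine (P [set w | delta < X t w]) <= 1 - expR (- (t * phi)).
Proof.
move=> t0; have ml := measurable_gt_level subX delta t0.
rewrite -Rintegral_boolr// -(RintegralZl _ _ (integrable_boolr P ml))//.
rewrite -(laplace_at t0) -[X in _ <= X - _](RintegralT_cst P).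
rewrite -RintegralB//; [|exact: finite_measure_integrable_cst|exact: integrable_laplace].
apply: le_Rintegral => //.
- exact: integrableZl_EFin (integrable_boolr P ml).
- by apply: integrableB_EFin; [exact: finite_measure_integrable_cst|exact: integrable_laplace].
move=> w _; case: (ltP delta (X t w)) => h.
  by rewrite mulr1 lerD2l lerN2 ler_expR lerN2 ler_wpM2l// ltW.
rewrite mulr0 subr_ge0 expR_le1 oppr_le0 mulr_ge0//.
exact: subordinator_ge0.
Qed.

End laplace_transform.

(** * Laplace exponents *)

Section laplace_exponent.
Context {R : realType}.
Variable Pi : {measure set (measurableTypeR R) -> \bar R}.
Hypothesis levyPi : levy_measure Pi.
Local Notation mu := (@lebesgue_measure R).
Implicit Types x y z u lambda a : R.

Let min_le (a x : R) : 0 < a -> a < x -> Num.min 1 a <= Num.min 1 x.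
Proof. by move=> a0 ax; rewrite le_min !ge_min lexx/= (ltW ax) orbT. Qed.

Let measurable_min u : measurable_fun setT (fun x : R => (Num.min x u)%:E).
Proof. by apply/measurable_EFinP; exact: measurable_minr. Qed.

Lemma levy_tail_fin a : 0 < a -> (levy_tail Pi a < +oo)%E.
Proof.
move=> a0; have m0 : 0 < Num.min 1 a by rewrite lt_min ltr01.
have : ((Num.min 1 a)%:E * levy_tail Pi a <= \int[Pi]_(x in `]0%R, +oo[) (Num.min 1 x)%:E)%E.
  rewrite /levy_tail -integral_cst//.
  apply: (@le_trans _ _ (\int[Pi]_(x in `]a, +oo[) (Num.min 1 x)%:E)%E).
    apply: ge0_le_integral => //.
    - by move=> x _; rewrite lee_fin ltW.
    - apply/measurable_funTS/measurable_EFinP; exact: measurable_minr.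
    - by move=> x /=; rewrite in_itv/= andbT => ax; rewrite lee_fin min_le.
  apply: ge0_subset_integral => //.
  - by apply/measurable_funTS/measurable_EFinP; exact: measurable_minr.
  - move=> x /=; rewrite in_itv/= andbT => x0.
    by rewrite lee_fin le_min ler01 ltW.
  - by move=> x /=; rewrite !in_itv/= !andbT; exact: lt_trans.
move=> /le_lt_trans /(_ (proj2 levyPi)).
case: (levy_tail Pi a) => [r _| |_]; [by rewrite ltry| |by []].
by rewrite gt0_muley// lte_fin.
Qed.

Let sigma_finite_Pi : sigma_finite setT Pi.
Proof.
exists (fun n => `]-oo, 0]%classic `|` `]n.+1%:R^-1, +oo[%classic).
  apply/seteqP; split => // x _.
  have [x0|x0] := leP x 0; first by exists 0%N => //; left; rewrite /= in_itv.
  exists (Num.truncn x^-1) => //; right; rewrite /= in_itv/= andbT.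
  rewrite -[ltRHS]invrK ltf_pV2 ?posrE ?invr_gt0//.
  exact: Num.Theory.truncnS_gt.
move=> n; split; first exact: measurableU.
apply: (le_lt_trans (measureU2 _ _ _)) => //.
by rewrite [X in (X + _)%E](proj1 levyPi) add0e; apply: levy_tail_fin.
Qed.

(** Tonelli on the region 0 < x <= u, x < y: the section at y > 0 has length min(y, u). *)
Lemma integrated_tailE u : 0 <= u ->
  integrated_tail Pi u = (\int[Pi]_(x in `]0%R, +oo[) (Num.min x u)%:E)%E.
Proof.
move=> u0.
(* [Pi] is equipped with its sigma-finite structure so that Tonelli's theorem applies to it. *)
pose H1 := isSFinite.Build _ _ _ _ (sfinite_measure_sigma_finite sigma_finite_Pi).
pose H2 := isSigmaFinite.Build _ _ _ _ sigma_finite_Pi.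
pose Pi' := HB.pack_for (SigmaFiniteMeasure.type (measurableTypeR R) R) (Measure.sort Pi) H1 H2.
pose D := [set z : R * R | 0 < z.1 <= u /\ z.1 < z.2].
have mD : measurable D.
  have m1 : measurable [set z : R * R | 0 < z.1 <= u].
    have : measurable_fun setT (@fst R R) by exact: measurable_fst.
    move=> /(_ measurableT `]0, u]%classic (measurable_itv _)); rewrite setTI.
    by congr measurable; apply/seteqP; split => z /=; rewrite in_itv.
  have m2 : measurable [set z : R * R | z.1 < z.2].
    have := @measurable_fun_ltr _ (R * R)%type R setT fst snd measurable_fst measurable_snd.
    by move=> /(_ measurableT [set true] I); rewrite setTI.
  have -> : D = [set z : R * R | 0 < z.1 <= u] `&` [set z : R * R | z.1 < z.2] by [].
  exact: measurableI.
pose f (z : R * R) : \bar R := (\1_D z)%:E.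
have mf : measurable_fun setT f by apply/measurable_EFinP; exact: measurable_indic.
have f0 (z : R * R) : (0 <= f z)%E by rewrite lee_fin.
have := @fubini_tonelli _ _ _ _ R mu Pi' f mf f0.
rewrite [LHS](_ : _ = integrated_tail Pi u); last first.
  rewrite /integrated_tail [RHS]integral_mkcond; apply: eq_integral => x _.
  rewrite patchE; case: ifPn => [|xu].
    rewrite inE/= in_itv/= => xu.
    transitivity (\int[Pi]_y (\1_(`]x, +oo[%classic) y)%:E)%E.
      apply: eq_integral => y _; rewrite /f !indicE; congr ((nat_of_bool _)%:R%:E).
      apply/idP/idP; rewrite !inE /D/= in_itv/= andbT; first by case.
      by move=> xy; split.
    by rewrite integral_indic// setIT.
  apply: integral0_eq => y _; rewrite /f indicE memNset// => -[h _].
  by move/negP: xu; apply; rewrite inE/= in_itv.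
move=> ->; rewrite [RHS]integral_mkcond; apply: eq_integral => y _.
rewrite patchE; case: ifPn => [|y0].
  rewrite inE/= in_itv/= andbT => y0.
  transitivity (mu [set x | 0 < x <= u /\ x < y]).
    transitivity (\int[mu]_x (\1_[set x | 0 < x <= u /\ x < y] x)%:E)%E; last first.
      rewrite integral_indic ?setIT//.
      have := measurable_ysection y mD; congr measurable.
      by apply/seteqP; split => x /=; rewrite /ysection/= inE.
    by apply: eq_integral => x _; rewrite /f !indicE; congr ((nat_of_bool _)%:R%:E); apply/idP/idP; rewrite !inE.
  have [yu|uy] := leP y u.
    have -> : [set x | 0 < x <= u /\ x < y] = `]0, y[%classic.
      apply/seteqP; split => x /=; rewrite in_itv/=.
        by move=> [/andP[-> _] ->].
      by move=> /andP[-> xy]; split => //=; rewrite (le_trans (ltW xy)).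
    by rewrite lebesgue_measure_itv/= lte_fin y0 oppr0 adde0.
  have -> : [set x | 0 < x <= u /\ x < y] = `]0, u]%classic.
    apply/seteqP; split => x /=; rewrite in_itv/=; first by case.
    by move=> /[dup] h /andP[_ xu]; split => //; exact: le_lt_trans uy.
  rewrite lebesgue_measure_itv/= lte_fin; case: ltP => h; first by rewrite oppr0 adde0.
  by congr EFin; apply/le_anti; rewrite u0.
apply: integral0_eq => x _; rewrite /f indicE memNset// => -[/andP[x0 _] xy].
by move/negP: y0; apply; rewrite inE/= in_itv/= andbT (lt_trans x0).
Qed.

Lemma integrated_tail_fin u : 0 <= u -> integrated_tail Pi u \is a fin_num.
Proof.
move=> u0; rewrite integrated_tailE//.
have mpos (v x : R) : 0 <= v -> `]0%R, +oo[%classic x -> (0 <= (Num.min x v)%:E)%E.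
  by move=> v0 /=; rewrite in_itv/= andbT => x0; rewrite lee_fin le_min v0 ltW.
rewrite ge0_fin_numE; last by apply: integral_ge0 => x; exact: mpos.
(* The bound min(x, u) <= (1 + u) min(1, x) reduces finiteness to the integrability condition on
   Lévy measures. *)
have K : (\int[Pi]_(x in `]0%R, +oo[) ((1 + u)%:E * (Num.min 1 x)%:E) < +oo)%E.
  rewrite ge0_integralZl//.
  - by rewrite lte_mul_pinfty//; [rewrite lee_fin addr_ge0|exact: (proj2 levyPi)].
  - by apply/measurable_funTS/measurable_EFinP; exact: measurable_minr.
  - by move=> x x0; rewrite minC; exact: mpos.
  - by rewrite lee_fin addr_ge0.
apply: le_lt_trans K; apply: ge0_le_integral => //.
- by move=> x; exact: mpos.
- by apply/measurable_funTS/measurable_EFinP; exact: measurable_minr.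
- apply: emeasurable_funM => //; apply/measurable_funTS/measurable_EFinP.
  exact: measurable_minr.
- move=> x /=; rewrite in_itv/= andbT => x0; rewrite -EFinM lee_fin.
  have xu : 0 <= x * u by rewrite mulr_ge0// ltW.
  by case: (leP 1 x) => x1; case: (leP x u) => xu'; rewrite ?mulr1; lra.
Qed.

Let exp_min z : 0 <= z -> 2^-1 * Num.min z 1 <= 1 - expR (- z) <= Num.min z 1.
Proof.
move=> z0; have e0 := expR_gt0 (- z); have e1 := expR_ge1Dx (- z).
apply/andP; split; last by rewrite le_min; apply/andP; split; lra.
have ez : expR (- z) <= (1 + z)^-1.
  by rewrite expRN lef_pV2 ?posrE ?expR_gt0 ?expR_ge1Dx//; lra.
case: (leP z 1) => z1.
  suff : (1 + z)^-1 <= 1 - z / 2 by lra.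
  have z1' : 0 < 1 + z by lra.
  rewrite -[leLHS]mul1r ler_pdivrMr//.
  have : 0 <= z * (1 - z) by rewrite mulr_ge0//; lra.
  by lra.
suff : (1 + z)^-1 <= 2^-1 by lra.
by rewrite lef_pV2 ?posrE//; lra.
Qed.

(** 1 - e^(-z) lies between min(z, 1) / 2 and min(z, 1), and lambda min(x, 1 / lambda) = min(lambda
    x, 1). This carries conditions on I over to Phi. *)
Lemma laplace_exponent_bounds lambda : 0 < lambda ->
  ((2^-1 * lambda)%:E * integrated_tail Pi lambda^-1 <= laplace_exponent 0 Pi lambda /\
   laplace_exponent 0 Pi lambda <= lambda%:E * integrated_tail Pi lambda^-1)%E.
Proof.
move=> l0; have li0 : 0 <= lambda^-1 by rewrite invr_ge0 ltW.
rewrite /laplace_exponent mul0r add0e integrated_tailE//.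
have mpos (x : R) : `]0%R, +oo[%classic x -> (0 <= (Num.min x lambda^-1)%:E)%E.
  by move=> /=; rewrite in_itv/= andbT => x0; rewrite lee_fin le_min li0 ltW.
have mE : measurable_fun setT (fun x : R => (1 - expR (- (lambda * x)))%:E).
  apply/measurable_EFinP; apply: measurable_funB => //.
  by apply: measurableT_comp => //; apply: measurableT_comp.
have minE x : lambda * Num.min x lambda^-1 = Num.min (lambda * x) 1.
  by rewrite minr_pMr ?ltW// divff// gt_eqF.
rewrite -!ge0_integralZl//; first last.
- by rewrite lee_fin mulr_ge0 ?ltW.
- first [exact: (measurable_funTS (measurable_min _))|exact: (measurable_funTS mE)].
- by rewrite lee_fin ltW.
- first [exact: (measurable_funTS (measurable_min _))|exact: (measurable_funTS mE)].
have Epos x : `]0%R, +oo[%classic x -> (0 <= (1 - expR (- (lambda * x)))%:E)%E.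
  move=> /=; rewrite in_itv/= andbT => x0.
  by rewrite lee_fin subr_ge0 expR_le1 oppr_le0 mulr_ge0// ltW.
split; apply: ge0_le_integral => //.
- move=> x x0; rewrite mule_ge0//; last exact: mpos.
  by rewrite lee_fin mulr_ge0 ?ltW.
- apply: emeasurable_funM => //; first [exact: (measurable_funTS (measurable_min _))|exact: (measurable_funTS mE)].
- first [exact: (measurable_funTS (measurable_min _))|exact: (measurable_funTS mE)].
- move=> x /=; rewrite in_itv/= andbT => x0; rewrite -EFinM lee_fin -mulrA minE.
  by have /andP[] := exp_min (ltW (mulr_gt0 l0 x0)).
- first [exact: (measurable_funTS (measurable_min _))|exact: (measurable_funTS mE)].
- by apply: emeasurable_funM => //; first [exact: (measurable_funTS (measurable_min _))|exact: (measurable_funTS mE)].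
- move=> x /=; rewrite in_itv/= andbT => x0; rewrite -EFinM lee_fin minE.
  by have /andP[] := exp_min (ltW (mulr_gt0 l0 x0)).
Qed.

Let I u := fine (integrated_tail Pi u).
Let phi lambda := fine (laplace_exponent 0 Pi lambda).

Lemma laplace_exponent_fin lambda : 0 < lambda -> laplace_exponent 0 Pi lambda \is a fin_num.
Proof.
move=> l0; have [h1 h2] := laplace_exponent_bounds l0.
have li0 : 0 <= lambda^-1 by rewrite invr_ge0 ltW.
have I0 := integrated_tail_fin li0.
rewrite fin_numElt; apply/andP; split.
  apply: lt_le_trans h1; rewrite -(fineK I0) -EFinM; exact: ltNyr.
by apply: (le_lt_trans h2); rewrite -(fineK I0) -EFinM ltry.
Qed.

Let phi_bounds lambda : 0 < lambda ->
  2^-1 * lambda * I lambda^-1 <= phi lambda <= lambda * I lambda^-1.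
Proof.
move=> l0; have [h1 h2] := laplace_exponent_bounds l0.
have li0 : 0 <= lambda^-1 by rewrite invr_ge0 ltW.
have I0 := integrated_tail_fin li0; have L0 := laplace_exponent_fin l0.
rewrite -!lee_fin !EFinM /I /phi !fineK//.
by apply/andP; split; [rewrite -EFinM|].
Qed.

Hypothesis Pi_infinite : Pi `]0%R, +oo[%classic = +oo%E.

(** For x > delta, 1 - e^(-x / delta) is at least 1 / 2, so the exponent is at least half the tail
    at any level above [delta]; these tails increase to the infinite total mass. *)
Lemma laplace_exponent_large (M : R) :
  exists2 e, 0 < e & forall delta, 0 < delta -> delta < e ->
    M <= fine (laplace_exponent 0 Pi delta^-1).
Proof.
pose F (n : nat) : set (measurableTypeR R) := `]n.+1%:R^-1, +oo[%classic.
have UF : \bigcup_n F n = `]0, +oo[%classic.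
  apply/seteqP; split => x /=.
    move=> [n _]; rewrite /F/= !in_itv/= !andbT; apply: le_lt_trans.
    by rewrite invr_ge0.
  rewrite in_itv/= andbT => x0.
  exists (Num.truncn x^-1) => //; rewrite /F/= in_itv/= andbT.
  rewrite -[ltRHS]invrK ltf_pV2 ?posrE ?invr_gt0//.
  exact: Num.Theory.truncnS_gt.
have ndF : nondecreasing_seq F.
  apply/nondecreasing_seqP => n; apply/subsetPset => x; rewrite /F/= !in_itv/= !andbT.
  by apply: le_lt_trans; rewrite lef_pV2 ?posrE// ler_nat.
have mF n : measurable (F n) by exact: measurable_itv.
have : (Pi \o F) n @[n --> \oo] --> +oo%E.
  rewrite -Pi_infinite -UF; apply: nondecreasing_cvg_mu => //.
  by rewrite UF; exact: measurable_itv.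
move=> /cvgeyPge /(_ (2 * M)) [n _ Hn].
have {}Hn : ((2 * M)%:E <= Pi (F n))%E by exact: Hn n (leqnn n).
have n0 : 0 < n.+1%:R^-1 :> R by rewrite invr_gt0.
exists n.+1%:R^-1 => // delta d0 dn.
have di0 : 0 < delta^-1 by rewrite invr_gt0.
rewrite -lee_fin fineK ?laplace_exponent_fin//.
rewrite /laplace_exponent mul0r add0e.
apply: (@le_trans _ _ (2^-1%:E * Pi (F n))%E).
  have -> : M%:E = (2^-1%:E * (2 * M)%:E)%E by rewrite -EFinM mulrA mulVf// mul1r.
  by rewrite lee_pmul2l// lte_fin.
have mE : measurable_fun setT (fun x : R => (1 - expR (- (delta^-1 * x)))%:E).
  apply/measurable_EFinP; apply: measurable_funB => //.
  by apply: measurableT_comp => //; apply: measurableT_comp.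
rewrite -(integral_cst _ (mF n)); apply: (@le_trans _ _ (\int[Pi]_(x in F n) (1 - expR (- (delta^-1 * x)))%:E)%E).
  apply: ge0_le_integral => //.
  - by move=> x _; rewrite lee_fin.
  - exact: measurable_funTS.
  - move=> x; rewrite /F/= in_itv/= andbT => nx; rewrite lee_fin.
    have dx : delta < x by exact: lt_trans nx.
    have x1 : 1 <= delta^-1 * x by rewrite mulrC ler_pdivlMr// mul1r ltW.
    have := exp_min (le_trans ler01 x1).
    by rewrite (min_idPr x1) mulr1 => /andP[].
apply: ge0_subset_integral => //.
- exact: measurable_funTS.
- move=> x /=; rewrite in_itv/= andbT => x0.
  by rewrite lee_fin subr_ge0 expR_le1 oppr_le0 mulr_ge0// ltW.
- by rewrite -UF => x Fx; exists n.
Qed.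

Hypothesis tail_growth : (1 < limf_einf (fun delta : R =>
  integrated_tail Pi (2 * delta)%R / integrated_tail Pi delta) (0^'+))%E.

Let I_ge0 u : 0 <= u -> 0 <= I u.
Proof.
move=> u0; apply: fine_ge0; apply: integral_ge0 => x _; exact: measure_ge0.
Qed.

Let doubling : exists rho, 1 < rho /\ exists2 e, 0 < e & forall delta,
  0 < delta -> delta < e -> rho * I delta <= I (2 * delta).
Proof.
move: tail_growth; rewrite limf_einfE => /ereal_sup_gt[_ [V V0 <-]] V1.
have [rho rho1 rhoV] : exists2 rho : R, 1 < rho & (rho%:E <= ereal_inf
    ((fun delta : R => integrated_tail Pi (2 * delta)%R / integrated_tail Pi delta) @` V))%E.
  move: V1; case: (ereal_inf _) => [r| |] // h; first by exists r; rewrite -?lte_fin.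
  by exists 2; rewrite ?leey// ltr1n.
exists rho; split=> //.
have [e /= e0 He] := V0.
exists e => // delta d0 de; have Vd : V delta.
  by apply: He => //=; rewrite sub0r normrN gtr0_norm.
have : (rho%:E <= integrated_tail Pi (2 * delta)%R / integrated_tail Pi delta)%E.
  by apply: (le_trans rhoV); apply: ereal_inf_lbound; exists delta.
have d2 : 0 <= 2 * delta by rewrite mulr_ge0// ltW.
rewrite -(fineK (integrated_tail_fin d2)) -(fineK (integrated_tail_fin (ltW d0))) -!/(I _).
(* If [I delta] vanishes the claim is trivial; otherwise the extended quotient is an ordinary
   one. *)
have := I_ge0 (ltW d0); rewrite le_eqVlt => /predU1P[<- _|Ip]; first by rewrite mulr0 I_ge0.
by rewrite inver gt_eqF// -EFinM lee_fin ler_pdivlMr.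
Qed.

(** With A = 2^(-k), k doublings give I(delta / A) >= rho^k I(delta). The comparison of Phi(lambda)
    with lambda I(1 / lambda) loses a factor 2, so [k] is chosen with rho^k >= 2 C. *)
Lemma laplace_exponent_growth (C : R) : 0 <= C ->
  exists2 A, 0 < A & exists2 e, 0 < e & forall delta, 0 < delta -> delta < e ->
    C * A * fine (laplace_exponent 0 Pi delta^-1) <=
    fine (laplace_exponent 0 Pi (A / delta)).
Proof.
move=> C0; have [rho [rho1 [e e0 dbl]]] := doubling.
have rho0 : 0 <= rho by exact: le_trans (ltW rho1).
have [k Ck] : exists k, 2 * C <= rho ^+ k.
  pose k := Num.truncn (2 * C / (rho - 1)); exists k.+1.
  have r1 : 0 < rho - 1 by rewrite subr_gt0.
  have h : 2 * C <= k.+1%:R * (rho - 1).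
    by rewrite -ler_pdivrMr//; exact/ltW/Num.Theory.truncnS_gt.
  apply: (le_trans h).
  have bern n : 1 + n%:R * (rho - 1) <= rho ^+ n.
    elim: n => [|n IH]; first by rewrite mul0r addr0.
    rewrite exprS -natr1 mulrDl mul1r.
    apply: (@le_trans _ _ (rho * (1 + n%:R * (rho - 1)))); last by rewrite ler_wpM2l.
    have : 0 <= n%:R * (rho - 1) * (rho - 1) by rewrite !mulr_ge0// ltW.
    by move: (n%:R) => nn; lra.
  by apply: le_trans (bern k.+1); rewrite lerDr.
have iter_dbl j delta : 0 < delta -> delta < e / 2 ^+ j ->
    rho ^+ j * I delta <= I (2 ^+ j * delta).
  elim: j delta => [|j IH] delta d0 de; first by rewrite !expr0 !mul1r.
  have h2 : delta < e / 2 ^+ j.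
    apply: (lt_le_trans de); rewrite ler_pM2l// lef_pV2 ?posrE ?exprn_gt0//.
    by rewrite ler_weXn2l// ler1n.
  rewrite exprS -mulrA; apply: (@le_trans _ _ (rho * I (2 ^+ j * delta))).
    by rewrite ler_wpM2l// IH.
  rewrite exprS -mulrA; apply: dbl; first by rewrite mulr_gt0// exprn_gt0.
  by rewrite mulrC -ltr_pdivlMr ?exprn_gt0.
have A0 : 0 < (2 ^+ k)^-1 :> R by rewrite invr_gt0 exprn_gt0.
exists (2 ^+ k)^-1 => //; exists (e / 2 ^+ k); first by rewrite mulr_gt0.
move=> delta d0 de; set A := _^-1 in A0 *.
have di0 : 0 < delta^-1 by rewrite invr_gt0.
have Ad : 0 < A / delta by rewrite mulr_gt0.
have /andP[_ up] := phi_bounds di0; have /andP[lo _] := phi_bounds Ad.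
rewrite invrK in up.
have e1 : (A / delta)^-1 = 2 ^+ k * delta by rewrite invf_div /A invrK mulrC.
rewrite e1 in lo; apply: le_trans lo.
apply: (@le_trans _ _ (C * A * (delta^-1 * I delta))).
  by rewrite ler_wpM2l// mulr_ge0// ltW.
apply: (@le_trans _ _ (2^-1 * (A / delta) * (rho ^+ k * I delta))); last first.
  by rewrite ler_wpM2l ?iter_dbl// mulr_ge0// ltW.
have h : 0 <= A * delta^-1 * I delta by rewrite mulr_ge0 ?I_ge0 ?(ltW d0)// mulr_ge0 ?ltW.
have := ler_wpM2r h Ck; move: (A) (delta^-1) (I delta) (rho ^+ k) => a b c r.
by lra.
Qed.

End laplace_exponent.

(** * Moments of the passage time *)

(* From (i + 1)^3 <= 48 e^((i + 1) / 2) and a geometric series. *)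
Definition cube_const {R : realType} : R :=
  48 * expR (3 / 2) / (1 - expR (- 2^-1)).

Lemma cube_sum_le {R : realType} n :
  \sum_(i < n) i.+1%:R ^+ 3 * expR (1 - i%:R) <=
  @cube_const R.
Proof.
rewrite /cube_const; set r := expR (- 2^-1); have r1 : r < 1 by rewrite -expR0 ltr_expR oppr_lt0 invr_gt0.
have r0 : 0 <= r by exact: expR_ge0.
rewrite ler_pdivlMr ?subr_gt0//.
apply: (@le_trans _ _ ((\sum_(i < n) 48 * expR (3 / 2) * r ^+ i) * (1 - r))).
  apply: ler_wpM2r; first by rewrite subr_ge0 ltW.
  apply: ler_sum => -[i /= _] _.
  have := @expR_ge1Dxn R (i.+1%:R / 2) 2%N; rewrite divr_ge0// => /(_ isT).
  rewrite (_ : 3%N`! = 6%N)// => H.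
  apply: (@le_trans _ _ (48 * expR (i.+1%:R / 2) * expR (1 - i%:R))).
    apply: ler_wpM2r; first exact: expR_ge0.
    move: H; move: (expR _) => E; rewrite exprMn; set c := _ ^+ 3.
    rewrite (_ : 2^-1 ^+ 3 = 8^-1 :> R); last by rewrite exprVn; congr (_^-1); ring.
    by move=> ?; lra.
  rewrite -expRM_natl -!mulrA -!expRD; apply: ler_wpM2l => //; rewrite ler_expR.
  by rewrite -natr1; lra.
rewrite -mulr_sumr -mulrA; apply: ler_piMr; first by rewrite mulr_ge0// expR_ge0.
have -> : (\sum_(i < n) r ^+ i) * (1 - r) = 1 - r ^+ n.
  by rewrite -(opprB (r ^+ n)) subrX1 -mulNr opprB mulrC.
by rewrite lerBlDr lerDl exprn_ge0.
Qed.

Section passage_moments.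
Context {R : realType} {d : measure_display} {Omega : measurableType d}.
Variables (P : probability Omega R) (X : R -> Omega -> R).
Hypothesis subX : subordinator P X.
Variables delta phi : R.
Hypothesis phi0 : 0 < phi.
Let T w := fine (passage_time X delta w).
Let q s := fine (P [set w | X s w <= delta]).
Hypothesis q_decay : forall s, 0 <= s -> q s <= expR (1 - s * phi).

Lemma fine_passage_time_ge0 w : 0 <= T w.
Proof. apply: fine_ge0; exact: (passage_time_ge0 subX). Qed.

Lemma passage_time_fin s w : 0 <= s -> delta < X s w ->
  passage_time X delta w \is a fin_num.
Proof.
move=> s0 sX; rewrite ge0_fin_numE; last exact: (passage_time_ge0 subX).
by apply: (le_lt_trans (passage_time_le subX s0 sX)); rewrite ltry.
Qed.

Lemma fine_passage_time_le s w : 0 <= s -> delta < X s w -> T w <= s.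
Proof.
move=> s0 sX; rewrite -lee_fin fineK; first exact: (passage_time_le subX).
exact: passage_time_fin sX.
Qed.

Lemma fine_passage_time_ge s w : 0 <= s -> X s w <= delta ->
  passage_time X delta w \is a fin_num -> s <= T w.
Proof. by move=> s0 sX pf; rewrite -lee_fin fineK//; exact: (passage_time_ge subX). Qed.

Lemma measurable_fine_passage_time : measurable_fun setT T.
Proof.
by apply: measurableT_comp (measurable_passage_time subX delta); exact: fine_measurable.
Qed.

Lemma measurable_never_passing h : 0 < h ->
  measurable [set w | forall j, ~~ (delta < X (j%:R * h) w)].
Proof.
move=> h0; have -> : [set w | forall j, ~~ (delta < X (j%:R * h) w)] =
    \bigcap_j [set w | X (j%:R * h) w <= delta].
  apply/seteqP; split => w wN j; first by move=> _; rewrite /= leNgt; exact: wN.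
  by rewrite -leNgt; exact: wN.
apply: bigcapT_measurable => j; apply: (measurable_le_level subX).
by rewrite mulr_ge0// ltW.
Qed.

(** The event is contained in [X (j h) <= delta] for every [j], and these probabilities decay
    exponentially. *)
Lemma never_passing_null h : 0 < h ->
  P [set w | forall j, ~~ (delta < X (j%:R * h) w)] = 0%E.
Proof.
move=> h0; pose N := [set w | forall j, ~~ (delta < X (j%:R * h) w)].
have jh0 j : 0 <= j%:R * h by rewrite mulr_ge0// ltW.
have mX j : measurable [set w | X (j%:R * h) w <= delta].
  by apply: (measurable_le_level subX); exact: jh0.
have mN : measurable N by exact: measurable_never_passing.
rewrite -/N -(@fineK _ (P N)) ?fin_num_measure//; congr EFin; apply/eqP.
rewrite eq_le fine_ge0// andbT leNgt; apply/negP; set x := fine _ => x0.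
have bound j : x * (1 + j%:R * h * phi) <= expR 1.
  have : x <= expR (1 - j%:R * h * phi).
    apply: le_trans (q_decay (jh0 j)); rewrite fine_le ?fin_num_measure//.
    by apply: le_measure; rewrite ?inE// => w wN; rewrite /= leNgt; exact: wN.
  rewrite expRB ler_pdivlMr ?expR_gt0//; apply: le_trans.
  by apply: ler_wpM2l; [exact: ltW|exact: expR_ge1Dx].
have xhp : 0 < x * (h * phi) by rewrite !mulr_gt0.
have := bound (Num.truncn (expR 1 / (x * (h * phi)))).+1.
have := Num.Theory.truncnS_gt (expR 1 / (x * (h * phi))); rewrite ltr_pdivrMr//.
move: (_.+1%:R) => n; rewrite -mulrA mulrDr mulr1 mulrCA => n1 n2; lra.
Qed.

Lemma passage_time_ae_fin : {ae P, forall w, passage_time X delta w \is a fin_num}.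
Proof.
have h1 : 0 < 1 :> R by [].
exists [set w | forall j, ~~ (delta < X (j%:R * 1) w)]; split.
- exact: measurable_never_passing.
- exact: never_passing_null.
- move=> w /= nf j; apply/negP => jX; apply: nf; apply: passage_time_fin jX.
  by rewrite mulr1.
Qed.

(** Time is cut into slots of length 1 / phi. If the level is first exceeded at slot k + 1, then
    (phi T)^3 <= (k + 1)^3, one of the terms (i + 1)^3 1{X(i / phi) <= delta}, and [q_decay] makes
    the series of their expectations converge. *)
Lemma passage_time_cube_le :
  (\int[P]_w ((T w ^+ 3)%:E) <= (cube_const / phi ^+ 3)%:E)%E.
Proof.
have ih0 i : 0 <= i%:R / phi by rewrite divr_ge0// ltW.
pose f i w : \bar R := (i.+1%:R ^+ 3 * (X (i%:R / phi) w <= delta)%R%:R)%:E.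
have mX i : measurable [set w | X (i%:R / phi) w <= delta].
  exact: (measurable_le_level subX).
have mf i : measurable_fun setT (f i).
  apply/measurable_EFinP; apply: measurable_funM => //.
  exact: measurable_fun_boolr.
have f0 i w : (0 <= f i w)%E by rewrite lee_fin mulr_ge0// exprn_ge0.
have mT : measurable_fun setT (fun w => T w ^+ 3).
  by apply: measurable_funX; exact: measurable_fine_passage_time.
have mT' : measurable_fun setT (fun w => (phi * T w) ^+ 3).
  apply: measurable_funX; apply: measurable_funM => //.
  exact: measurable_fine_passage_time.
have p3 : 0 < phi ^+ 3 by rewrite exprn_gt0.
suff H : (\int[P]_w (((phi * T w) ^+ 3)%:E) <= cube_const%:E)%E.
  rewrite EFinM muleC lee_pdivlMl// -ge0_integralZl//; last 3 first.
  - exact/measurable_EFinP.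
  - by move=> w _; rewrite lee_fin exprn_ge0// fine_passage_time_ge0.
  - by rewrite lee_fin ltW.
  by under eq_integral do rewrite -EFinM -exprMn.
apply: (@le_trans _ _ (\int[P]_w (\sum_(0 <= i <oo) f i w))%E).
  apply: ge0_le_integral => //.
  - by move=> w _; rewrite lee_fin exprn_ge0// mulr_ge0 ?fine_passage_time_ge0// ltW.
  - exact/measurable_EFinP.
  - by apply: ge0_emeasurable_sum.
  move=> w _; have S0 : (0 <= \sum_(0 <= i <oo) f i w)%E by exact: nneseries_ge0.
  have [[i iX]|nX] := pselect (exists i, delta < X (i%:R / phi) w); last first.
    (* If the level is never exceeded, the passage time is infinite and [fine] turns it into 0, so
       the bound is trivial. *)
    suff -> : T w = 0 by rewrite mulr0 expr0n.
    rewrite /T (_ : passage_time X delta w = +oo%E)//.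
    apply/eqyP => A A0; pose i := (Num.truncn (A * phi)).+1.
    apply: (@le_trans _ _ (i%:R / phi)%:E).
      by rewrite lee_fin ler_pdivlMr// ltW// Num.Theory.truncnS_gt.
    apply: (passage_time_ge subX) => //; rewrite leNgt; apply/negP => iX.
    by apply: nX; exists i.
  have := ex_minnP (ex_intro (fun i => delta < X (i%:R / phi) w) i iX).
  case=> -[|k] kX kmin.
    have : T w <= 0 by have := fine_passage_time_le (ih0 0%N) kX; rewrite mul0r.
    have := fine_passage_time_ge0 w => t0 t1.
    by rewrite (_ : T w = 0) ?mulr0 ?expr0n//; apply/eqP; rewrite eq_le t1.
  have kX' : X (k%:R / phi) w <= delta.
    by rewrite leNgt; apply/negP => /kmin; rewrite ltnn.
  apply: (@le_trans _ _ (f k w)).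
    rewrite /f kX' mulr1 lee_fin lerXn2r ?nnegrE//; first by rewrite mulr_ge0 ?fine_passage_time_ge0// ltW.
    by rewrite mulrC -ler_pdivlMr//; exact: fine_passage_time_le kX.
  apply: le_trans (nneseries_lim_ge (u_ := f^~ w) k.+1 _) => //.
  by rewrite big_nat_recr//= leeDr// sume_ge0.
rewrite integral_nneseries//; apply: lime_le.
  by apply: is_cvg_nneseries => *; exact: integral_ge0.
apply: nearW => n; rewrite big_mkord.
apply: (@le_trans _ _ (\sum_(i < n) (i.+1%:R ^+ 3 * expR (1 - i%:R))%:E)%E).
  apply: lee_sum => -[i /= _] _; rewrite /f.
  under eq_integral do rewrite EFinM.
  have pw0 : 0 <= i.+1%:R ^+ 3 :> R by rewrite exprn_ge0.
  rewrite ge0_integralZl//; last by apply/measurable_EFinP; exact: measurable_fun_boolr.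
  rewrite [leRHS]EFinM; apply: lee_wpmul2l; first by rewrite lee_fin.
  have := q_decay (ih0 i); rewrite mulfVK ?gt_eqF// -lee_fin /q -(Rintegral_boolr P (mX i)).
  rewrite /Rintegral fineK//.
  exact: (integrable_fin_num measurableT (integrable_boolr P (mX i))).
by rewrite sumEFin lee_fin; exact: cube_sum_le.
Qed.

End passage_moments.

Section renewal_moments.
Context {R : realType} {d : measure_display} {Omega : measurableType d}.
Variables (P : probability Omega R) (X : R -> Omega -> R).
Hypothesis subX : subordinator P X.
Variables delta phi : R.
Hypothesis phi0 : 0 < phi.
Let T w := fine (passage_time X delta w).
Let q s := fine (P [set w | X s w <= delta]).
Hypothesis q_decay : forall s, 0 <= s -> q s <= expR (1 - s * phi).
Let U := \int[P]_w T w.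

Let T0 w : 0 <= T w.
Proof. exact: (fine_passage_time_ge0 subX). Qed.

Let mT : measurable_fun setT T.
Proof. exact: (measurable_fine_passage_time subX). Qed.

Lemma integrable_passage_cube :
  P.-integrable setT (EFin \o (fun w => `|T w| ^+ 3)).
Proof.
apply/integrableP; split.
  by apply/measurable_EFinP; apply: measurable_funX; exact: measurableT_comp.
apply: le_lt_trans (ltry (cube_const / phi ^+ 3)).
apply: le_trans (passage_time_cube_le subX phi0 q_decay).
apply: ge0_le_integral => //.
- apply: measurableT_comp => //; apply/measurable_EFinP.
  by apply: measurable_funX; exact: measurableT_comp.
- by apply/measurable_EFinP; apply: measurable_funX.
- by move=> w _ /=; rewrite lee_fin ger0_norm ?exprn_ge0// ger0_norm.
Qed.

Let integrable_pow i : (i <= 3)%N -> P.-integrable setT (EFin \o (fun w => T w ^+ i)).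
Proof. by move=> i3; apply: (integrable_pow_le mT i3); exact: integrable_passage_cube. Qed.

Lemma integrable_passage : P.-integrable setT (EFin \o T).
Proof. exact: (integrable_pow (isT : (1 <= 3)%N)). Qed.

Lemma Rintegral_passage_cube_le : \int[P]_w (T w ^+ 3) <= cube_const / phi ^+ 3.
Proof.
rewrite -lee_fin /Rintegral fineK; first exact: (passage_time_cube_le subX).
exact: (integrable_fin_num measurableT (integrable_pow (leqnn 3))).
Qed.

Lemma renewal_functionE : renewal_function P X delta = U%:E.
Proof.
rewrite /U /Rintegral fineK; last exact: (integrable_fin_num measurableT integrable_passage).
apply: ae_eq_integral => //.
- exact: (measurable_passage_time subX).
- exact/measurable_EFinP.
have [N [mN N0 H]] := passage_time_ae_fin subX phi0 q_decay.
exists N; split => // w /= nf; apply: H => /= pf; apply: nf => _.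
by rewrite /= /T fineK.
Qed.

Lemma integrable_centred_pow i : (i <= 3)%N ->
  P.-integrable setT (EFin \o (fun w => (U - T w) ^+ i)).
Proof.
move=> i3; apply: (@integrable_pow_le _ _ _ P (fun w => U - T w) _ i 3 i3).
  exact: measurable_funB.
have I := integrable_pow (leqnn 3).
have I2 : P.-integrable setT (EFin \o (fun w => T w ^+ 3 + `|U| ^+ 3)).
  by apply: integrableD_EFin => //; exact: finite_measure_integrable_cst.
apply: (le_integrable measurableT _ _ I2).
  apply/measurable_EFinP; apply: measurable_funX; apply: measurableT_comp => //.
  exact: measurable_funB.
have U0 : 0 <= U by apply: Rintegral_ge0 => w _; exact: T0.
move=> w _ /=; rewrite lee_fin [leRHS]ger0_norm ?addr_ge0 ?exprn_ge0//.
rewrite normrX normr_id (ger0_norm U0).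
have tw := T0 w; case: (ger0P (U - T w)) => h.
  apply: (@le_trans _ _ (U ^+ 3)); last by rewrite lerDr exprn_ge0.
  by rewrite lerXn2r ?nnegrE//; lra.
apply: (@le_trans _ _ (T w ^+ 3)); last by rewrite lerDl exprn_ge0.
by rewrite lerXn2r ?nnegrE//; lra.
Qed.

Lemma passage_varianceE : passage_variance P X delta = (\int[P]_w ((U - T w) ^+ 2))%:E.
Proof.
rewrite /passage_variance /variance covariance.unlock.
have -> : ('E_P[T] = U%:E)%E.
  rewrite unlock /U /Rintegral fineK//.
  exact: (integrable_fin_num measurableT integrable_passage).
rewrite unlock /Rintegral fineK.
  by apply: eq_integral => w _; congr EFin; rewrite -[LHS]/((T w - U) * (T w - U)); ring.
exact: (integrable_fin_num measurableT (integrable_centred_pow (isT : (2 <= 3)%N))).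
Qed.

Lemma Rintegral_centred : \int[P]_w (U - T w) = 0.
Proof.
rewrite RintegralB//; last exact: integrable_passage.
  by rewrite RintegralT_cst subrr.
exact: finite_measure_integrable_cst.
Qed.

(** On [X s <= delta] the passage time is at least [s], except where it is infinite and [fine] makes
    it 0; that happens only inside the null event [N], whose indicator restores the pointwise
    inequality. *)
Lemma passage_mean_ge s : 0 <= s -> s * q s <= U.
Proof.
move=> s0; have ml := measurable_le_level subX delta s0.
have h1 : 0 < 1 :> R by [].
pose N := [set w | forall j, ~~ (delta < X (j%:R * 1) w)].
have mN : measurable N by exact: (measurable_never_passing subX).
have N0 : \int[P]_w (w \in N)%:R = 0 :> R.
  rewrite (Rintegral_boolr P (b := fun w => w \in N)); last by rewrite set_mem_set.
  by rewrite set_mem_set (never_passing_null subX phi0 q_decay h1).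
have IN : P.-integrable setT (EFin \o (fun w => (w \in N)%:R : R)).
  by apply: integrable_boolr; rewrite set_mem_set.
rewrite /q -Rintegral_boolr// -(RintegralZl _ _ (integrable_boolr P ml))//.
rewrite -[leRHS]addr0 -(mulr0 s) -N0 -(RintegralZl _ _ IN)//.
rewrite -RintegralD//; last 2 first.
- exact: integrable_passage.
- exact: integrableZl_EFin IN.
apply: le_Rintegral => //.
- exact: integrableZl_EFin (integrable_boolr P ml).
- apply: integrableD_EFin; [exact: integrable_passage|exact: integrableZl_EFin IN].
move=> w _; have sN : 0 <= s * (w \in N)%:R by rewrite mulr_ge0.
case: (leP (X s w) delta) => [sX|_]; last by rewrite mulr0 addr_ge0.
have [wN|wN] := boolP (w \in N); first by rewrite lerDr.
rewrite mulr0 mulr1 addr0; apply: (fine_passage_time_ge subX) => //.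
have [j jX] : exists j : nat, delta < X (j%:R * 1) w.
  apply: contrapT => H; move: wN; rewrite notin_setE; apply => j.
  by apply/negP => jX; apply: H; exists j.
by apply: (passage_time_fin subX) jX; rewrite mulr1.
Qed.

(** From z <= 1 + z^3 with z = phi T. *)
Lemma passage_mean_le : U <= (1 + cube_const) / phi.
Proof.
have I3 := integrable_pow (leqnn 3).
have I1 : P.-integrable setT (EFin \o (fun=> 1 : R)) by exact: finite_measure_integrable_cst.
have I4 := integrableZl_EFin (phi ^+ 3) I3.
rewrite ler_pdivlMr// mulrC /U -(RintegralZl _ _ integrable_passage)//.
apply: (@le_trans _ _ (\int[P]_w (1 + phi ^+ 3 * T w ^+ 3))).
  apply: le_Rintegral => //; first exact: integrableZl_EFin integrable_passage.
    exact: integrableD_EFin.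
  move=> w _; rewrite -exprMn; have x0 : 0 <= phi * T w by rewrite mulr_ge0// ltW.
  have [x1|/ltW x1] := leP (phi * T w) 1; first by rewrite (le_trans x1)// lerDl exprn_ge0.
  by rewrite (@le_trans _ _ ((phi * T w) ^+ 3)) ?lerDr// ler_eXnr.
rewrite RintegralD// RintegralT_cst lerD2l RintegralZl//.
by rewrite mulrC -ler_pdivlMr ?exprn_gt0// Rintegral_passage_cube_le.
Qed.

(** On [delta < X s] the passage time is at most [s], hence at distance at least [U - s] below its
    mean. *)
Lemma passage_variance_ge s : 0 <= s -> s <= U ->
  (U - s) ^+ 2 * (1 - q s) <= \int[P]_w ((U - T w) ^+ 2).
Proof.
move=> s0 sU; have ml := measurable_gt_level subX delta s0.
have ml' := measurable_le_level subX delta s0.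
have -> : 1 - q s = \int[P]_w (delta < X s w)%R%:R.
  rewrite /q -Rintegral_boolr// -[X in X - _](RintegralT_cst P) -RintegralB//; last 2 first.
  - exact: finite_measure_integrable_cst.
  - exact: integrable_boolr.
  by apply: eq_Rintegral => w _; case: ltP => _; rewrite ?subr0 ?subrr.
rewrite -(RintegralZl _ _ (integrable_boolr P ml))//; apply: le_Rintegral => //.
- exact: integrableZl_EFin (integrable_boolr P ml).
- exact: integrable_centred_pow.
move=> w _; case: ltP => [sX|_]; last by rewrite mulr0 sqr_ge0.
have := fine_passage_time_le subX s0 sX => Ts.
by rewrite mulr1 lerXn2r ?nnegrE//; rewrite -/(T w) in Ts; lra.
Qed.

Lemma centred_cube_le : \int[P]_w (`|U - T w| ^+ 3) <= cube_const / phi ^+ 3 + U ^+ 3.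
Proof.
have U0 : 0 <= U by apply: Rintegral_ge0 => w _; exact: T0.
have I3 := integrable_pow (leqnn 3).
have IU : P.-integrable setT (EFin \o (fun=> U ^+ 3 : R)) by exact: finite_measure_integrable_cst.
apply: (@le_trans _ _ (\int[P]_w (T w ^+ 3 + U ^+ 3))); last first.
  by rewrite RintegralD// RintegralT_cst lerD2r Rintegral_passage_cube_le.
have Ic : P.-integrable setT (EFin \o (fun w => `|U - T w| ^+ 3)).
  rewrite (_ : EFin \o _ = abse \o (EFin \o (fun w => (U - T w) ^+ 3))).
    exact: integrable_abse (integrable_centred_pow (leqnn 3)).
  by apply/funext => w /=; rewrite normrX.
apply: le_Rintegral => //; first exact: integrableD_EFin.
move=> w _; have tw := T0 w; case: (ger0P (U - T w)) => h.
  apply: (@le_trans _ _ (U ^+ 3)); last by rewrite lerDr exprn_ge0.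
  by rewrite lerXn2r ?nnegrE//; lra.
apply: (@le_trans _ _ (T w ^+ 3)); last by rewrite lerDl exprn_ge0.
by rewrite lerXn2r ?nnegrE//; lra.
Qed.

End renewal_moments.

(** * Convergence in distribution from upper tails *)

Section upper_tails.
Context {R : realType} {d : measure_display} {Omega : measurableType d}.
Variables (P : probability Omega R) (Z : Omega -> R).
Hypothesis mZ : measurable_fun setT Z.

Lemma measurable_upper_tail x : measurable [set w | x < Z w].
Proof.
rewrite -[X in measurable X]setTI (_ : [set w | _] = Z @^-1` `]x, +oo[%classic).
  exact: mZ.
by apply/seteqP; split => w /=; rewrite in_itv/= andbT.
Qed.

Let G x := fine (P [set w | x < Z w]).

(** A Riemann-Stieltjes sum: f(Z) is replaced by its value at the right end of the cell of Z, with
    error at most [e] on the cells and [M] outside them. The sum involves the law of [Z] through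
    finitely many tails only. *)
Lemma Rintegral_step_approx (f : R -> R) (M e : R) (x : nat -> R) m :
  measurable_fun setT f -> (forall y, `|f y| <= M) -> 0 <= e ->
  {homo x : i j / (i <= j)%N >-> i <= j} ->
  (forall j y, (j < m)%N -> x j < y -> y <= x j.+1 -> `|f y - f (x j.+1)| <= e) ->
  `|\int[P]_w f (Z w) - \sum_(j < m) f (x j.+1) * (G (x j) - G (x j.+1))|
    <= e + M * (1 - (G (x 0%N) - G (x m))).
Proof.
move=> mf fM e0 xm osc.
pose c j w : R := (x j < Z w)%R%:R - (x j.+1 < Z w)%R%:R.
pose S k w := \sum_(j < k) f (x j.+1) * c j w.
have mb y : measurable [set w | (y < Z w)%R] by exact: measurable_upper_tail.
have Ib y := integrable_boolr P (mb y).
have Ic j : P.-integrable setT (EFin \o (fun w => f (x j.+1) * c j w)).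
  by apply: integrableZl_EFin; exact: integrableB_EFin.
have -> : \sum_(j < m) f (x j.+1) * (G (x j) - G (x j.+1)) = \int[P]_w S m w.
  rewrite (Rintegral_sumr (f := fun j w => f (x j.+1) * c j w))//.
  apply: eq_bigr => -[j /= _] _; rewrite RintegralZl//; last exact: integrableB_EFin.
  by rewrite RintegralB// !Rintegral_boolr.
have IS k : P.-integrable setT (EFin \o S k).
  exact: (integrable_sumr (f := fun j w => f (x j.+1) * c j w)).
have M0 : 0 <= M by exact: le_trans (fM 0).
have If : P.-integrable setT (EFin \o (fun w => f (Z w))).
  by apply: (@bounded_integrable _ _ _ P _ M) => //; exact: measurableT_comp.
have Sout k w : (Z w <= x 0%N) || (x k < Z w) -> S k w = 0.
  move=> out; apply: big1 => -[j /= jk] _; rewrite /c.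
  have x0j : x 0%N <= x j by exact: xm.
  have x0j' : x 0%N <= x j.+1 by exact: xm.
  have xjk : x j <= x k by apply: xm; exact: ltnW.
  have xjk' : x j.+1 <= x k by exact: xm.
  case/orP: out => out.
    by rewrite !ltNge (le_trans out x0j) (le_trans out x0j')/= subrr mulr0.
  by rewrite (le_lt_trans xjk out) (le_lt_trans xjk' out) subrr mulr0.
have Sin k w : (k <= m)%N -> x 0%N < Z w -> Z w <= x k -> `|f (Z w) - S k w| <= e.
  elim: k => [|k IH] km x0Z Zk; first by rewrite ltNge Zk in x0Z.
  rewrite /S big_ord_recr/= -/(S k w) /c (ltNge (x k.+1)) Zk subr0.
  have [Zk'|kZ] := leP (Z w) (x k); first by rewrite mulr0 addr0 IH// ltnW.
  by rewrite Sout ?kZ ?orbT// add0r mulr1 osc.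
rewrite -RintegralB//.
have ID : P.-integrable setT (EFin \o (fun w => f (Z w) - S m w)) by exact: integrableB_EFin.
apply: (le_trans (le_normr_Rintegral _ ID)) => //.
pose H w : R := 1 - ((x 0%N < Z w)%R%:R - (x m < Z w)%R%:R).
have I1 : P.-integrable setT (EFin \o (fun=> 1 : R)) by exact: finite_measure_integrable_cst.
have Ie : P.-integrable setT (EFin \o (fun=> e : R)) by exact: finite_measure_integrable_cst.
have Ixm : P.-integrable setT (EFin \o (fun w => (x 0%N < Z w)%R%:R - (x m < Z w)%R%:R : R)).
  exact: integrableB_EFin.
have IH : P.-integrable setT (EFin \o H) by exact: integrableB_EFin.
apply: (@le_trans _ _ (\int[P]_w (e + M * H w))); last first.
  rewrite RintegralD//; last exact: integrableZl_EFin.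
  rewrite RintegralT_cst lerD2l RintegralZl// ler_wpM2l//.
  by rewrite /H RintegralB// RintegralT_cst RintegralB// !Rintegral_boolr.
apply: le_Rintegral => //.
- rewrite (_ : EFin \o _ = abse \o (EFin \o (fun w => f (Z w) - S m w)))//.
  exact: integrable_abse.
- by apply: integrableD_EFin => //; exact: integrableZl_EFin.
move=> w _; rewrite /H; have x0m : x 0%N <= x m by exact: xm.
case: (ltP (x 0%N) (Z w)) => h0; last first.
  rewrite Sout ?h0// (ltNge (x m)) (le_trans h0 x0m)/= !subr0 mulr1.
  by rewrite (le_trans (fM _))// lerDr.
case: (ltP (x m) (Z w)) => hm.
  by rewrite Sout ?hm ?orbT// subrr !subr0 mulr1 (le_trans (fM _))// lerDr.
by rewrite subr0 subrr mulr0 addr0; exact: Sin.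
Qed.

End upper_tails.

(** Half a continuity radius for the position of [x] and half for [y] keep both near the same
    centre; compactness makes the radius uniform. *)
Lemma segment_uniform_continuity {R : realType} (f : R -> R) (a b e : R) :
  continuous f -> 0 < e -> exists2 r, 0 < r &
    forall x y, a <= x -> x <= b -> `|x - y| < r -> `|f y - f x| <= e.
Proof.
move=> cf e0; have /compact_near_coveringP cov := @segment_compact R a b.
pose osc (r x : R) := forall y, `|x - y| < r -> `|f y - f x| <= e.
have : \forall r \near 0^'+, `[a, b]%classic `<=` osc r.
  apply: cov => x _.
  have e2 : 0 < e / 2 by rewrite divr_gt0.
  have [r /= r0 rP] := cvgr_dist_le f (f x) (cf x) _ e2.
  have r2 : 0 < r / 2 by rewrite divr_gt0.
  have close z : `|x - z| < r -> `|f x - f z| <= e / 2 by exact: rP.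
  exists (ball x (r / 2), [set s : R | s < r / 2]) => /=.
    by split; [exact: nbhsx_ballx|exact: nbhs_right_lt].
  move=> [z s] [/= xz sr] y zy; rewrite /ball/= in xz.
  have xz' := close z (lt_trans xz _); have {}xz' : `|f x - f z| <= e / 2 by apply: xz'; lra.
  have xy : `|x - y| < r.
    by rewrite (le_lt_trans (ler_distD z _ _))//; lra.
  have := close y xy; rewrite distrC => yx.
  by rewrite (le_trans (ler_distD (f x) _ _))//; lra.
case=> r /= r0 rP; exists (r / 2) => [|x y ax xb]; first by rewrite divr_gt0.
apply: (rP (r / 2)); rewrite /= ?sub0r ?normrN ?in_itv/= ?ax ?xb ?divr_gt0//.
by rewrite gtr0_norm ?divr_gt0//; lra.
Qed.

(** The tails of [mu] select a segment carrying almost all the mass, and uniform continuity a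
    partition of it. Convergence of the tails at the partition points controls the Riemann-Stieltjes
    sums and also the mass of [Z i] outside the segment. *)
Theorem cvg_in_distribution_upper_tail {R : realType} {d : measure_display}
    {Omega : measurableType d} (P : probability Omega R) {I : Type}
    (F : set_system I) (Z : I -> Omega -> R)
    (mu : probability (measurableTypeR R) R) : Filter F ->
  (\forall i \near F, measurable_fun setT (Z i)) ->
  (forall x : R, fine (P [set w | x < Z i w]) @[i --> F] --> fine (mu [set y | x < y])) ->
  cvg_in_distribution P F Z mu.
Proof.
move=> FF mZ tails; split => // f cf [M0 [_ fM0]].
pose M := `|M0| + 1; have M1 : 0 < M by rewrite ltr_wpDl.
have fM y : `|f y| <= M by apply: fM0 => //; rewrite /M (le_lt_trans (ler_norm M0))// ltrDl.
have mf : measurable_fun setT f by exact: continuous_measurable_fun.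
pose idR (y : measurableTypeR R) : R := y.
have mid : measurable_fun setT idR by exact: (@measurable_id _ _ setT).
pose H x := fine (mu [set y | x < y]); pose G i x := fine (P [set w | x < Z i w]).
have Imu : mu.-integrable setT (EFin \o f) by exact: (@bounded_integrable _ _ _ mu f M).
have Emu : (\int[mu]_x (f x)%:E)%E = (\int[mu]_x f x)%:E.
  by rewrite /Rintegral fineK//; exact: (integrable_fin_num measurableT Imu).
rewrite Emu; suff cv : (\int[P]_w f (Z i w)) @[i --> F] --> \int[mu]_x f x.
  apply/fine_cvgP; split.
    near=> i; rewrite unlock; apply: integrable_fin_num => //.
    apply: (@bounded_integrable _ _ _ P (fun w => f (Z i w)) M) => //.
    by apply: measurableT_comp => //; near: i.
  rewrite (_ : fine \o _ = fun i => \int[P]_w f (Z i w))//.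
  by apply/funext => i; rewrite /= unlock.
apply/cvgrPdist_le => e e0.
(* Budget: e/8 + e/8 for the limit law, e/8 + e/4 for [Z i] and e/4 between the two sums, in all
   7e/8. *)
pose eta := e / (16 * M); have eta0 : 0 < eta by rewrite divr_gt0// mulr_gt0.
pose W : {RV mu >-> R} := mfun_Sub (mem_set mid).
have HW x : ccdf W x = mu [set y | x < y].
  rewrite /ccdf /distribution/= /pushforward/=; congr (mu _).
  by apply/seteqP; split => y /=; rewrite in_itv/= andbT.
have [K [K0 KP KN]] : exists K : R, [/\ 0 < K, H K <= eta & 1 - H (- K) <= eta].
  have [K1 [_ hK1]] : \forall x \near +oo, `|0 - H x| <= eta.
    have c : (fine \o ccdf W) x @[x --> +oo] --> (0 : R) by exact: fine_cvg (cvg_ccdfy0 W).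
    by apply: filterS (cvgr_dist_le _ _ c _ eta0) => x; rewrite /= HW.
  have [K2 [_ hK2]] : \forall x \near -oo, `|1 - H x| <= eta.
    have c : (fine \o ccdf W) x @[x --> -oo] --> (1 : R) by exact: fine_cvg (cvg_ccdfNy1 W).
    by apply: filterS (cvgr_dist_le _ _ c _ eta0) => x; rewrite /= HW.
  exists (`|K1| + `|K2| + 1); split; first by rewrite ltr_wpDl// addr_ge0.
    have : `|0 - H (`|K1| + `|K2| + 1)| <= eta.
      by apply: hK1; have := ler_norm K1; have := normr_ge0 K2; lra.
    by rewrite sub0r normrN ger0_norm// fine_ge0.
  apply: le_trans (ler_norm _) _; apply: hK2.
  by have := ler_norm (- K2); rewrite normrN; have := normr_ge0 K1; lra.
have e4 : 0 < e / 8 by rewrite divr_gt0.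
have [r r0 rP] := segment_uniform_continuity (- K) K cf e4.
pose m := (Num.truncn (2 * K / r)).+1; pose h := 2 * K / m%:R.
have m0 : 0 < m%:R :> R by rewrite ltr0n.
have hr : h < r.
  rewrite /h ltr_pdivrMr// -ltr_pdivrMl// mulrC; exact: Num.Theory.truncnS_gt.
have h0 : 0 < h by rewrite divr_gt0// mulr_gt0.
pose x (j : nat) := - K + j%:R * h.
have x0E : x 0%N = - K by rewrite /x mul0r addr0.
have xmE : x m = K by rewrite /x /h mulrC divfK ?gt_eqF//; lra.
have xm : {homo x : i j / (i <= j)%N >-> i <= j}.
  by move=> i j ij; rewrite lerD2l ler_wpM2r ?ler_nat// ltW.
have osc j y : (j < m)%N -> x j < y -> y <= x j.+1 -> `|f y - f (x j.+1)| <= e / 8.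
  move=> jm xy yx; apply: rP; first by rewrite -x0E; exact: xm.
    by rewrite -xmE; exact: xm.
  apply: le_lt_trans hr; rewrite ger0_norm ?subr_ge0//.
  have : x j.+1 = x j + h by rewrite /x -natr1; ring.
  lra.
pose S (g : R -> R) := \sum_(j < m) f (x j.+1) * (g (x j) - g (x j.+1)).
have e80 : 0 <= e / 8 by exact: ltW.
have Bmu : `|\int[mu]_y f y - S H| <= e / 8 + M * (1 - (H (- K) - H K)).
  by have := Rintegral_step_approx mu mid mf fM e80 xm osc; rewrite x0E xmE.
have Scvg : S (G i) @[i --> F] --> S H.
  apply: (@cvg_big R _ +%R 0 xpredT add_continuous _ F _
    (fun (j : 'I_m) i => f (x j.+1) * (G i (x j) - G i (x j.+1)))) => j _.
  by apply: cvgMr; apply: cvgB; exact: tails.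
have e2 : 0 < e / 4 by rewrite divr_gt0.
near=> i.
have mZi : measurable_fun setT (Z i) by near: i.
have Bi : `|\int[P]_w f (Z i w) - S (G i)| <= e / 8 + M * (1 - (G i (- K) - G i K)).
  by have := Rintegral_step_approx P mZi mf fM e80 xm osc; rewrite x0E xmE.
have c1 : `|S H - S (G i)| <= e / 4 by near: i; exact: cvgr_dist_le _ _ Scvg _ e2.
have c2 : `|H K - G i K| <= eta by near: i; exact: cvgr_dist_le _ _ (tails K) _ eta0.
have c3 : `|H (- K) - G i (- K)| <= eta by near: i; exact: cvgr_dist_le _ _ (tails (- K)) _ eta0.
have Meta : M * eta = e / 16 by rewrite /eta; field; rewrite gt_eqF.
have b1 : M * (1 - (H (- K) - H K)) <= e / 8.
  apply: (@le_trans _ _ (M * (2 * eta))); last by lra.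
  by apply: ler_wpM2l; [exact: ltW|lra].
have b2 : M * (1 - (G i (- K) - G i K)) <= e / 4.
  apply: (@le_trans _ _ (M * (4 * eta))); last by lra.
  apply: ler_wpM2l; first exact: ltW.
  by move: c2 c3; rewrite !ler_norml => /andP[? ?] /andP[? ?]; lra.
move: b1 b2 Bmu Bi c1.
move: (M * _) (M * _) => B1 B2.
move: (S H) (S (G i)) => s1 s2.
move: (\int[mu]_y f y) (\int[P]_w f (Z i w)) => i1 i2 b1 b2; rewrite !ler_norml => /andP[? ?] /andP[? ?] /andP[? ?].
by apply/andP; split; lra.
Unshelve. all: by end_near.
Qed.

(** * Normal approximation of the covering number *)

Section normal_upper_tail.
Context {R : realType}.

Definition normal_tail (x : R) : R := fine (normal_prob 0 1 [set y : R | x < y]).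

Lemma measurable_gt_set (x : R) : measurable ([set y | x < y] : set (measurableTypeR R)).
Proof.
rewrite (_ : [set _ | _] = `]x, +oo[%classic)//.
by apply/seteqP; split => y /=; rewrite in_itv/= andbT.
Qed.

(** The density is at most 1 / sqrt(2 pi) <= 1. *)
Lemma normal_tail_lipschitz x y : x <= y -> 0 <= normal_tail x - normal_tail y <= y - x.
Proof.
move=> xy; rewrite /normal_tail.
have mu_fin A : measurable A -> normal_prob 0 1 A \is a fin_num.
  by move=> mA; exact: fin_num_measure.
have mx := measurable_gt_set x; have my := measurable_gt_set y.
have mI : measurable (`]x, y]%classic : set (measurableTypeR R)) by exact: measurable_itv.
have E : [set z : R | x < z] = `]x, y]%classic `|` [set z | y < z].
  apply/seteqP; split => z /=; rewrite in_itv/=.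
    by case: (leP z y) => zy xz; [left; rewrite xz|right].
  by case=> [/andP[]//|]; exact: le_lt_trans.
rewrite E measureU//; last first.
  by apply/seteqP; split => z //= []; rewrite in_itv/= => /andP[_ zy]; rewrite ltNge zy.
rewrite fineD ?mu_fin// addrK fine_ge0//=.
rewrite -lee_fin fineK ?mu_fin//.
rewrite /normal_prob; apply: (@le_trans _ _ (\int[lebesgue_measure]_(z in `]x, y]) (cst 1%:E z)))%E.
  apply: ge0_le_integral => //.
  - by move=> z _; rewrite lee_fin normal_pdf_ge0.
  - apply/measurable_EFinP; apply: measurable_funTS; exact: measurable_normal_pdf.
  move=> z _; rewrite lee_fin (le_trans (normal_pdf_ub _ _ _))// ?oner_neq0// /normal_peak.
  have pi1 : 1 <= pi *+ 2 :> R by have := @pi_ge2 R; rewrite mulr2n; lra.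
  rewrite expr1n mul1r invf_le1 ?sqrtr_gt0; last by rewrite (lt_le_trans _ pi1).
  by rewrite -sqrtr1 ler_wsqrtr.
by rewrite integral_cst//= mul1e lebesgue_measure_itv/= lte_fin; case: ltP => // ?; rewrite lee_fin subr_ge0.
Qed.

Lemma normal_tail_dist x y : `|normal_tail x - normal_tail y| <= `|x - y|.
Proof.
case: (leP x y) => [|/ltW] xy; have /andP[h1 h2] := normal_tail_lipschitz xy.
  by rewrite ger0_norm// distrC ger0_norm ?subr_ge0.
by rewrite distrC ger0_norm// ger0_norm ?subr_ge0.
Qed.

Lemma measurable_step3_affine (v a : R) : measurable_fun setT (fun y : R => step3 ((y - v) / a)).
Proof.
apply: (@measurableT_comp _ _ _ _ _ _ step3).
  by apply: continuous_measurable_fun; exact: continuous_step3.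
by apply: measurable_funM => //; exact: measurable_funB.
Qed.

(** The rescaled step vanishes up to [v] and equals 1 from [v + 3 a] on, so it lies between two
    indicators. *)
Lemma normal_step3_bounds (v a : R) : 0 < a ->
  normal_tail (v + 3 * a) <= \int[normal_prob 0 1]_y step3 ((y - v) / a) <= normal_tail v.
Proof.
move=> a0; set N := normal_prob 0 1.
have Ib x : N.-integrable setT (EFin \o (fun y : measurableTypeR R => (x < y)%R%:R : R)).
  by apply: integrable_boolr; exact: measurable_gt_set.
have IS : N.-integrable setT (EFin \o (fun y : measurableTypeR R => step3 ((y - v) / a) : R)).
  apply: (@bounded_integrable _ _ _ N _ 1); first exact: measurable_step3_affine.
  by move=> y; have /andP[h1 h2] := step3_01 ((y - v) / a); rewrite ger0_norm.
have bE x : normal_tail x = \int[N]_y (x < y)%R%:R.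
  by rewrite (Rintegral_boolr N (b := fun y : measurableTypeR R => (x < y)%R))//; exact: measurable_gt_set.
rewrite !bE; apply/andP; split; apply: le_Rintegral => // y _.
  have /andP[h1 h2] := step3_01 ((y - v) / a).
  case: ltP => // vy; rewrite step3_ge3// ler_pdivlMr//; lra.
have /andP[h1 h2] := step3_01 ((y - v) / a).
by case: ltP => // vy; rewrite step3_le0// ler_pdivrMr// mul0r subr_le0.
Qed.

End normal_upper_tail.

(** The sign is reversed: a short sum of T is a large sum of (U - T) / b, so the nonincreasing test
    functions of time become increasing splines of the normalized sum. *)
Lemma iter_shift_mean_affine {R : realType} {d : measure_display} {Omega : measurableType d}
    (P : probability Omega R) (T : Omega -> R) (g : R -> R) (U b c x : R) n :
  iter n (shift_mean P T) (fun s => g ((c - s) / b)) x =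
  iter n (shift_mean P (fun w => (U - T w) / b)) g ((c - n%:R * U - x) / b).
Proof.
elim: n x => [|n IH] x; first by rewrite mul0r subr0.
rewrite !iterS /shift_mean; apply: eq_Rintegral => w _; rewrite IH; congr (iter n _ g _).
by rewrite -natr1; ring.
Qed.

Section range_tail.
Context {R : realType} {d : measure_display} {Omega : measurableType d}.
Variables (P : probability Omega R) (X : R -> Omega -> R).
Hypothesis subX : subordinator P X.
Variables t delta phi : R.
Hypothesis t0 : 0 < t.
Hypothesis delta0 : 0 < delta.
Hypothesis phi0 : 0 < phi.
Let T w := fine (passage_time X delta w).
Hypothesis q_decay : forall s, 0 <= s ->
  fine (P [set w | X s w <= delta]) <= expR (1 - s * phi).
Let U := \int[P]_w T w.
Let V := \int[P]_w ((U - T w) ^+ 2).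
Let tail y := fine (P [set w | y < range_covering_number X t delta w]).

Let mT : measurable_fun setT T.
Proof. exact: (measurable_fine_passage_time subX). Qed.

Let T0 w : 0 <= T w.
Proof. exact: (fine_passage_time_ge0 subX). Qed.

Section test_function.
Variable f : R -> R.
Hypothesis f01 : forall y, 0 <= f y <= 1.
Hypothesis mf : measurable_fun setT f.
Hypothesis df : {homo f : x y / x <= y >-> y <= x}.

Let mesh k : R := t / (2 ^ k)%:R.

Let mesh0 k : 0 < mesh k.
Proof. by rewrite divr_gt0// ltr0n expn_gt0. Qed.

Let mb k i : measurable [set w | delta < X (i%:R * mesh k) w].
Proof. by apply: (measurable_gt_level subX); rewrite mulr_ge0// ltW. Qed.

Let bS k w i : delta < X (i%:R * mesh k) w -> delta < X (i.+1%:R * mesh k) w.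
Proof.
move/lt_le_trans; apply; apply: (proj2 subX); first by rewrite mulr_ge0// ltW.
by rewrite ler_wpM2r ?ler_nat// ltW.
Qed.

Lemma range_tail_le y : 0 <= y -> (forall s, s <= t -> f s = 1) ->
  tail y <= iter (Num.truncn y) (shift_mean P T) f 0.
Proof.
move=> y0 f1; apply: (range_prob_le subX t0 delta0 y0) => k.
apply: (renewal_upper (b := fun i w => delta < X (i%:R * mesh k) w)
  (F := grid_prob P X delta (mesh k)) (mb k) (@bS k)
  (grid_prob0 P X delta (mesh k)) (grid_probS subX (ltW delta0) (mesh0 k)) mT _ (mesh0 k)) => //.
  by move=> i w /= iX; apply: (fine_passage_time_le subX) iX; rewrite mulr_ge0// ltW.
by move=> s; rewrite add0r mulrC divfK ?pnatr_eq0 -?lt0n ?expn_gt0//; exact: f1.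
Qed.

Lemma range_tail_ge y s : 0 <= y -> s < t -> (forall u, s < u -> f u = 0) ->
  iter (Num.truncn y) (shift_mean P T) f 0 <= tail y.
Proof.
move=> y0 st f0; set n := Num.truncn y.
have ts : 0 < t - s by rewrite subr_gt0.
(* The mesh is fine enough for [n] roundings to fit between [s] and [t]. *)
pose k := (Num.truncn (n%:R * t / (t - s))).+1.
have nh : n%:R * mesh k <= t - s.
  rewrite mulrA ler_pdivrMr ?ltr0n ?expn_gt0// -ler_pdivrMl//.
  rewrite mulrC; apply/ltW/(lt_le_trans (Num.Theory.truncnS_gt _)).
  by rewrite ler_nat; exact/ltnW/ltn_expl.
apply: le_trans (grid_prob_le_range subX t0 delta0 k y0).
(* Starting the clock at [- n * mesh k] cancels the rounding allowance of [renewal_lower]. *)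
rewrite -{1}(addNr (n%:R * mesh k)).
apply: (renewal_lower (P := P) (T := T) (b := fun i w => delta < X (i%:R * mesh k) w)
  (F := grid_prob P X delta (mesh k)) (mb k) (@bS k)
  (grid_prob0 P X delta (mesh k)) (grid_probS subX (ltW delta0) (mesh0 k)) mT T0
  _ (never_passing_null subX phi0 q_decay (mesh0 k)) (mesh0 k) f01 mf df).
  move=> i w; rewrite -leNgt => iX [j jX].
  apply: (fine_passage_time_ge subX) => //; first by rewrite mulr_ge0// ltW.
  by apply: (passage_time_fin subX) jX; rewrite mulr_ge0// ltW.
move=> u; rewrite [X in _ + X]mulrC divfK ?pnatr_eq0 -?lt0n ?expn_gt0// => tu.
by apply: f0; lra.
Qed.

End test_function.

(* The spline rises over a length 3 a; it is placed at v - 3 a for the upper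
   bound and at v + a, strictly beyond v, for the lower one. *)
Lemma range_tail_clt y n a : 0 <= y -> Num.truncn y = n.+1 -> 0 < V -> 0 < a ->
  `|tail y - normal_tail ((n.+1%:R * U - t) / (Num.sqrt V * Num.sqrt n.+1%:R))| <=
  4 * a + n.+1%:R * (2 / a ^+ 3 * ((\int[P]_w (`|U - T w| ^+ 3)) /
    (Num.sqrt V * Num.sqrt n.+1%:R) ^+ 3 + 12 * expR 2 * (Num.sqrt n.+1%:R)^-1 ^+ 3)).
Proof.
move=> y0 yn V0 a0; set m := n.+1%:R; set b := Num.sqrt V * Num.sqrt m.
have m0 : 0 < m by rewrite ltr0n.
have b0 : 0 < b by rewrite mulr_gt0 ?sqrtr_gt0.
set v := (m * U - t) / b.
pose Y w := (U - T w) / b.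
have mY : measurable_fun setT Y by apply: measurable_funM => //; exact: measurable_funB.
have IC i := integrable_centred_pow subX phi0 q_decay (i := i).
have I3 : P.-integrable setT (EFin \o (fun w => `|U - T w| ^+ 3)).
  rewrite (_ : EFin \o _ = abse \o (EFin \o (fun w => (U - T w) ^+ 3))).
    exact: integrable_abse (IC _ (leqnn 3)).
  by apply/funext => w /=; rewrite normrX.
have Y3 w : `|Y w| ^+ 3 = (b ^+ 3)^-1 * `|U - T w| ^+ 3.
  by rewrite normrM (gtr0_norm (_ : 0 < b^-1)) ?invr_gt0// exprMn exprVn mulrC.
have IY3 : P.-integrable setT (EFin \o (fun w => `|Y w| ^+ 3)).
  by under [X in EFin \o X]eq_fun do rewrite Y3; exact: integrableZl_EFin.
have EY3 : \int[P]_w (`|Y w| ^+ 3) = (\int[P]_w (`|U - T w| ^+ 3)) / b ^+ 3.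
  by under eq_Rintegral do rewrite Y3; rewrite RintegralZl// mulrC.
have EY1 : \int[P]_w Y w = 0.
  rewrite RintegralZr//; last exact: (IC 1%N).
  by rewrite (Rintegral_centred subX phi0 q_decay) mul0r.
have EY2 : \int[P]_w (Y w ^+ 2) = n.+1%:R^-1.
  under eq_Rintegral do rewrite /Y exprMn.
  rewrite RintegralZr//; last exact: IC.
  rewrite -/V exprVn exprMn !sqr_sqrtr ?ltW// -/m; field.
  by rewrite !gt_eqF.
pose Phi w := \int[normal_prob 0 1]_z step3 ((z - w) / a).
have clt w := clt_step3 w mY IY3 EY1 EY2 a0.
set err := n.+1%:R * _ in clt.
have affE w : iter (Num.truncn y) (shift_mean P T) (fun s => step3 (((m * U - s) / b - w) / a)) 0 =
    iter n.+1 (shift_mean P Y) (fun z => step3 ((z - w) / a)) 0.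
  rewrite yn (iter_shift_mean_affine P T (fun z => step3 ((z - w) / a)) U).
  by rewrite /m subrr subr0 mul0r.
have f01 w s : 0 <= step3 (((m * U - s) / b - w) / a) <= 1 by exact: step3_01.
have mf (w : R) : measurable_fun setT (fun s : R => step3 (((m * U - s) / b - w) / a)).
  apply: (@measurableT_comp _ _ _ _ _ _ step3).
    by apply: continuous_measurable_fun; exact: continuous_step3.
  apply: measurable_funM => //; apply: measurable_funB => //.
  by apply: measurable_funM => //; exact: measurable_funB.
have df (w : R) : {homo (fun s : R => step3 (((m * U - s) / b - w) / a)) : p q / p <= q >-> q <= p}.
  move=> p q pq; apply: step3_nondecreasing; rewrite ler_pM2r ?invr_gt0// lerD2r ler_pM2r ?invr_gt0//.
  by rewrite lerD2l lerN2.
have up : tail y <= Phi (v - 3 * a) + err.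
  have := range_tail_le (f01 (v - 3 * a)) (mf _) (@df _) y0; rewrite affE => H.
  have {}H : tail y <= iter n.+1 (shift_mean P Y) (fun z => step3 ((z - (v - 3 * a)) / a)) 0.
    apply: H => s st; rewrite step3_ge3// ler_pdivlMr//.
    suff : v <= (m * U - s) / b by lra.
    by rewrite ler_pM2r ?invr_gt0// lerD2l lerN2.
  by have := clt (v - 3 * a); rewrite ler_norml -/(Phi _) => /andP[h1 h2]; lra.
have lo : Phi (v + a) - err <= tail y.
  have tb : t - a * b < t by rewrite ltrBlDr ltrDl mulr_gt0.
  have := range_tail_ge (f01 (v + a)) (mf _) (@df _) y0 tb; rewrite affE => H.
  have {}H : iter n.+1 (shift_mean P Y) (fun z => step3 ((z - (v + a)) / a)) 0 <= tail y.
    apply: H => s st; rewrite step3_le0// ler_pdivrMr// mul0r subr_le0.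
    rewrite ler_pdivrMr// mulrDl divfK ?gt_eqF//; lra.
  by have := clt (v + a); rewrite ler_norml -/(Phi _) => /andP[h1 h2]; lra.
(* The Lipschitz bound costs 3 a on the upper side, and 4 a on the lower one, where the spline
   reaches 1 at [v + 4 a]. *)
have /andP[_ u1] := normal_step3_bounds (v - 3 * a) a0.
have /andP[l1 _] := normal_step3_bounds (v + a) a0.
have h1 : v - 3 * a <= v by rewrite gerBl mulr_ge0// ltW.
have h2 : v <= v + a + 3 * a by lra.
have /andP[_ u2] := normal_tail_lipschitz h1.
have /andP[_ l2] := normal_tail_lipschitz h2.
rewrite -EY3 -/err -/(Phi _) -/(Phi _) in u1 l1 *.
by rewrite ler_norml; apply/andP; split; lra.
Qed.

End range_tail.

(* Here u is the square root of the mean of T, s its standard deviation and m3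
   its third absolute central moment; rounding y to an integer and the normal
   approximation both cost O(u). *)
Lemma clt_error_small {R : realType} (t x c C K e : R) :
  0 < t -> 0 < c -> 0 <= C -> 0 <= K -> 0 < e ->
  exists2 a, 0 < a & exists2 u0, 0 < u0 & forall u s y m3 : R,
    0 < u -> u <= u0 -> c * u ^+ 2 <= s -> s <= C * u ^+ 2 ->
    0 <= m3 -> m3 <= K * (u ^+ 2) ^+ 3 ->
    y = t / u ^+ 2 + x * (Num.sqrt t * ((u ^+ 3)^-1 * s)) ->
    0 <= y /\ exists2 n, Num.truncn y = n.+1 &
    `|(n.+1%:R * u ^+ 2 - t) / (s * Num.sqrt n.+1%:R) - x| +
    (4 * a + n.+1%:R * (2 / a ^+ 3 * (m3 / (s * Num.sqrt n.+1%:R) ^+ 3 +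
      12 * expR 2 * (Num.sqrt n.+1%:R)^-1 ^+ 3))) <= e.
Proof.
move=> t0 c0 C0 K0 e0; set tau := Num.sqrt t.
have tau0 : 0 < tau by rewrite sqrtr_gt0.
have tauE : t = tau ^+ 2 by rewrite sqr_sqrtr// ltW.
have a0 : 0 < e / 12 by rewrite divr_gt0.
exists (e / 12) => //; set a := e / 12 in a0 *.
(* [B * u] bounds the distance of y u^2 from t, [L * u] the displacement of the abscissa [x] by
   rounding, and [D / sqrt(n + 1)] the replacement error. The choice of [a] makes 4 a = e/3. *)
pose B := `|x| * tau * C; have B0 : 0 <= B by rewrite !mulr_ge0// ltW.
pose L := (`|x| * ((B + 1) / tau) + c^-1) * (2 / tau).
have L0 : 0 <= L by rewrite mulr_ge0 ?addr_ge0 ?mulr_ge0 ?divr_ge0 ?addr_ge0 ?invr_ge0// ltW.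
pose D := 2 / a ^+ 3 * (K / c ^+ 3 + 12 * expR 2).
have D0 : 0 <= D.
  rewrite mulr_ge0 ?divr_ge0 ?exprn_ge0 ?addr_ge0 ?divr_ge0 ?exprn_ge0 ?mulr_ge0 ?expR_ge0//; exact: ltW.
(* Each [Qi] encodes one smallness demand in the form u Qi <= 1: u (B + 1) <= 3/4 tau^2, L u <= e/3
   and D (2 / tau) u <= e/3. The additional 1 in the sum gives u <= 1. *)
pose Q1 := (B + 1) * (4 / 3 / tau ^+ 2).
pose Q2 := L * (3 / e); pose Q3 := D * (2 / tau) * (3 / e).
have tau2 : 0 <= 2 / tau by rewrite divr_ge0// ltW.
have e3 : 0 <= 3 / e by rewrite divr_ge0// ltW.
have Q10 : 0 <= Q1 by rewrite mulr_ge0 ?addr_ge0 ?divr_ge0 ?exprn_ge0// ltW.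
have Q20 : 0 <= Q2 by rewrite mulr_ge0.
have Q30 : 0 <= Q3 by rewrite mulr_ge0// mulr_ge0.
have Q0 : 0 < 1 + Q1 + Q2 + Q3 by lra.
exists (1 + Q1 + Q2 + Q3)^-1; first by rewrite invr_gt0.
move=> u s y m3 u0 uQ cs sC m30 m3K yE.
have {}uQ : u * (1 + Q1 + Q2 + Q3) <= 1 by rewrite -ler_pdivlMr// div1r.
have [q1 q2 q3] : [/\ 0 <= u * Q1, 0 <= u * Q2 & 0 <= u * Q3].
  by split; rewrite mulr_ge0// ltW.
rewrite !mulrDr mulr1 in uQ.
have u1 : u <= 1 by lra.
have uB : u * (B + 1) <= 3 / 4 * tau ^+ 2.
  have : u * Q1 <= 1 by lra.
  rewrite /Q1 mulrA mulrA ler_pdivrMr ?exprn_gt0// mul1r; lra.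
have uL : L * u <= e / 3.
  have : u * Q2 <= 1 by lra.
  rewrite /Q2 mulrA mulrA ler_pdivrMr// mul1r; lra.
have uD : D * (2 / tau) * u <= e / 3.
  have : u * Q3 <= 1 by lra.
  rewrite /Q3 mulrA [X in X <= _]mulrA ler_pdivrMr// mul1r; lra.
have u20 : 0 < u ^+ 2 by rewrite exprn_gt0.
pose r := s / u ^+ 2; have sE : s = r * u ^+ 2 by rewrite /r divfK ?gt_eqF.
have cr : c <= r by rewrite ler_pdivlMr.
have rC : r <= C by rewrite ler_pdivrMr.
have r0 : 0 < r by exact: lt_le_trans cr.
clearbody r.
have yu : y * u ^+ 2 = tau ^+ 2 + x * tau * r * u.
  by rewrite yE tauE sE; field; rewrite gt_eqF.
have xB : `|x * tau * r * u| <= B * u.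
  rewrite !normrM (gtr0_norm tau0) (gtr0_norm r0) (gtr0_norm u0).
  apply: ler_wpM2r; first exact: ltW.
  by apply: ler_wpM2l => //; rewrite mulr_ge0// ltW.
have u2u : u ^+ 2 <= u by rewrite expr2 ler_piMr// ltW.
have /andP[xB1 xB2] : - (B * u) <= x * tau * r * u <= B * u by rewrite -ler_norml.
have tau20 : 0 < tau ^+ 2 by rewrite exprn_gt0.
have yu1 : u ^+ 2 + tau ^+ 2 / 4 <= y * u ^+ 2 by rewrite yu; lra.
have y1 : 1 <= y by rewrite -(ler_pM2r u20) mul1r; lra.
have y0 : 0 <= y by lra.
split=> //; have := truncn_itv y0.
have : (0 < Num.truncn y)%N by rewrite truncn_gt0.
case: (Num.truncn y) => // n _ /andP[n1 n2]; exists n => //.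
set m : R := n.+1%:R in n1 *.
have m0 : 0 < m by rewrite ltr0n.
have {}n2 : y < m + 1 by rewrite /m natr1.
pose q := Num.sqrt m; have q0 : 0 < q by rewrite sqrtr_gt0.
have qE : m = q ^+ 2 by rewrite sqr_sqrtr// ltW.
(* z^2 is the mean of n + 1 passage times, so [z] should be close to [tau]; [th] below is the
   fractional part of y lost by truncation. *)
rewrite -/q; pose z := u * q; have z0 : 0 < z by rewrite mulr_gt0.
pose th := y - m; have th0 : 0 <= th by rewrite subr_ge0.
have th1 : th <= 1 by rewrite /th; lra.
have zE : z ^+ 2 = tau ^+ 2 + x * tau * r * u - th * u ^+ 2.
  by rewrite -yu /th /z qE; ring.
have thu : th * u ^+ 2 <= u by apply: le_trans u2u; rewrite ler_piMl// ltW.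
have thu0 : 0 <= th * u ^+ 2 by rewrite mulr_ge0// ltW.
have zt : tau / 2 <= z.
  rewrite -(@ler_pXn2r _ 2)// ?nnegrE ?divr_ge0 ?(ltW z0) ?(ltW tau0)//.
  rewrite exprMn exprVn zE (_ : 2 ^+ 2 = 4 :> R); last by rewrite expr2; ring.
  lra.
have ztau : `|tau - z| <= (B + 1) * u / tau.
  rewrite ler_pdivlMr//; apply: (@le_trans _ _ (`|tau - z| * (tau + z))).
    by apply: ler_wpM2l => //; rewrite lerDl ltW.
  rewrite -(gtr0_norm (_ : 0 < tau + z)) ?addr_gt0// -normrM -subr_sqr zE.
  by rewrite ler_norml; apply/andP; split; lra.
have vE : (m * u ^+ 2 - t) / (s * q) - x = (x * (tau - z) - th * u / r) / z.
  have -> : m * u ^+ 2 - t = x * tau * r * u - th * u ^+ 2.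
    by rewrite tauE qE -exprMn mulrC -/z zE; ring.
  by rewrite sE /z; field; rewrite !gt_eqF.
have iz : z^-1 <= 2 / tau.
  by rewrite -[2 / tau]invrK lef_pV2 ?posrE ?invr_gt0 ?divr_gt0// invf_div.
have h1 : `|(m * u ^+ 2 - t) / (s * q) - x| <= e / 3.
  apply: le_trans uL; rewrite vE normrM (gtr0_norm (_ : 0 < z^-1)) ?invr_gt0//.
  have -> : L * u = ((`|x| * ((B + 1) * u / tau)) + u / c) * (2 / tau) by rewrite /L; ring.
  apply: ler_pM => //; first by rewrite invr_ge0 ltW.
  apply: (le_trans (ler_normB _ _)); apply: lerD; first by rewrite normrM ler_wpM2l.
  rewrite ger0_norm; last by rewrite !mulr_ge0 ?invr_ge0// ltW.
  apply: ler_pM; rewrite ?invr_ge0 ?mulr_ge0 ?(ltW u0) ?(ltW r0)//.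
    by rewrite ler_piMl// ltW.
  by rewrite lef_pV2 ?posrE.
have h2 : m * (2 / a ^+ 3 * (m3 / (s * q) ^+ 3 + 12 * expR 2 * q^-1 ^+ 3)) <= e / 3.
  apply: le_trans uD.
  have m3q : m3 / (s * q) ^+ 3 <= K / c ^+ 3 * q^-1 ^+ 3.
    rewrite [(s * q) ^+ 3]exprMn invfM mulrA exprVn; apply: ler_wpM2r.
      by rewrite invr_ge0 exprn_ge0// ltW.
    have s0 : 0 < s by apply: lt_le_trans cs; rewrite mulr_gt0.
    rewrite ler_pdivrMr ?exprn_gt0// mulrAC ler_pdivlMr ?exprn_gt0//.
    apply: (@le_trans _ _ (K * (u ^+ 2) ^+ 3 * c ^+ 3)).
      by apply: ler_wpM2r => //; rewrite exprn_ge0// ltW.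
    rewrite -mulrA -exprMn; apply: ler_wpM2l => //.
    rewrite mulrC in cs; apply: lerXn2r; rewrite ?nnegrE// ?mulr_ge0//; exact: ltW.
  apply: (@le_trans _ _ (D / q)); last first.
    have -> : q^-1 = z^-1 * u by rewrite /z; field; rewrite !gt_eqF.
    rewrite -(mulrA D); apply: ler_wpM2l => //.
    by apply: ler_wpM2r => //; exact: ltW.
  have -> : D / q = m * (2 / a ^+ 3 * ((K / c ^+ 3 + 12 * expR 2) * q^-1 ^+ 3)).
    by rewrite /D qE; field; rewrite !gt_eqF.
  apply: ler_wpM2l; first exact: ltW.
  apply: ler_wpM2l; first by rewrite divr_ge0 ?exprn_ge0// ltW.
  by rewrite [leRHS]mulrDl lerD2r.
have -> : 4 * a = e / 3 by rewrite /a; field.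
lra.
Qed.

(** * Moments of the passage time in units of its mean *)

Section passage_moment_bounds.
Context {R : realType} {d : measure_display} {Omega : measurableType d}.
Variables (P : probability Omega R) (X : R -> Omega -> R).
Hypothesis subX : subordinator P X.
Variables delta phi A phiA : R.
Let T w := fine (passage_time X delta w).
Let q s := fine (P [set w | X s w <= delta]).
Let U := \int[P]_w T w.
Let V := \int[P]_w ((U - T w) ^+ 2).
Let M3 := \int[P]_w (`|U - T w| ^+ 3).
Hypothesis phi0 : 0 < phi.
Hypothesis q_decay : forall s, 0 <= s -> q s <= expR (1 - s * phi).
Hypothesis q_slow : forall s, 0 <= s -> 1 - q s <= 2 * (s * phi).

(* 512 = 8^3, from the lower bound 1 / (8 phi) on the mean. *)
Definition moment_const : R := 512 * cube_const + 1.

Lemma cube_const_ge0 : 0 <= cube_const :> R.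
Proof.
by rewrite divr_ge0 ?mulr_ge0 ?expR_ge0// subr_ge0 -expR0 ler_expR oppr_le0.
Qed.

Lemma moment_const_ge0 : 0 <= moment_const.
Proof. by rewrite /moment_const; have := cube_const_ge0; lra. Qed.

(** At s = 1 / (4 phi), [q_slow] leaves probability at least 1/2 of not having passed. *)
Let U_lower : (8 * phi)^-1 <= U.
Proof.
have s0 : 0 <= (4 * phi)^-1 by rewrite invr_ge0 mulr_ge0// ltW.
have := passage_mean_ge subX phi0 q_decay s0; rewrite -/(q _) -/U; apply: le_trans.
have := q_slow s0; have -> : 2 * ((4 * phi)^-1 * phi) = 2^-1 by field; rewrite gt_eqF.
move=> q2; have {}q2 : 2^-1 <= q (4 * phi)^-1 by lra.
have -> : (8 * phi)^-1 = (4 * phi)^-1 * 2^-1 by field; rewrite gt_eqF.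
exact: ler_wpM2l.
Qed.

Lemma passage_mean_gt0 : 0 < U.
Proof. by apply: lt_le_trans U_lower; rewrite invr_gt0 mulr_gt0. Qed.

Lemma centred_cube_le_mean : M3 <= moment_const * U ^+ 3.
Proof.
apply: (le_trans (centred_cube_le subX phi0 q_decay)).
have : ((8 * phi)^-1) ^+ 3 <= U ^+ 3.
  apply: lerXn2r; rewrite ?nnegrE ?(ltW passage_mean_gt0)//.
  by rewrite invr_ge0 mulr_ge0// ltW.
rewrite -/U /moment_const => /(ler_wpM2l cube_const_ge0).
have -> : cube_const / phi ^+ 3 = 512 * (cube_const * ((8 * phi)^-1) ^+ 3).
  by field; rewrite gt_eqF.
move: (_^-1 ^+ 3) => z; have -> : (512 * cube_const + 1) * U ^+ 3 = 512 * (cube_const * U ^+ 3) + U ^+ 3.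
  by ring.
by move: (cube_const * z) (cube_const * U ^+ 3) => z1 z2; lra.
Qed.

(** Interpolation: z^2 <= U^2 + z^3 / U, according to whether z <= U, reduces this to the third
    moment. *)
Lemma passage_variance_le : V <= (1 + moment_const) * U ^+ 2.
Proof.
have U0 := passage_mean_gt0.
have IC i := integrable_centred_pow subX phi0 q_decay (i := i).
have I3 : P.-integrable setT (EFin \o (fun w => `|U - T w| ^+ 3)).
  rewrite (_ : EFin \o _ = abse \o (EFin \o (fun w => (U - T w) ^+ 3))).
    exact: integrable_abse (IC _ (leqnn 3)).
  by apply/funext => w /=; rewrite normrX.
have IU : P.-integrable setT (EFin \o (fun=> U ^+ 2 : R)).
  exact: finite_measure_integrable_cst.
apply: (@le_trans _ _ (\int[P]_w (U ^+ 2 + U^-1 * `|U - T w| ^+ 3))).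
  apply: le_Rintegral => //; first exact: IC.
    by apply: integrableD_EFin => //; exact: integrableZl_EFin.
  move=> w _; rewrite -real_normK ?num_real//; set z := `|_|.
  have z0 : 0 <= z by exact: normr_ge0.
  have [zU|/ltW Uz] := leP z U.
    rewrite -[leLHS]addr0; apply: lerD.
      by apply: lerXn2r; rewrite ?nnegrE// ltW.
    by rewrite mulr_ge0 ?invr_ge0 ?exprn_ge0// ltW.
  rewrite -[leLHS]add0r; apply: lerD; first exact: sqr_ge0.
  by rewrite ler_pdivlMl// [leRHS]exprS ler_wpM2r// sqr_ge0.
rewrite RintegralD//; last exact: integrableZl_EFin.
rewrite RintegralT_cst RintegralZl// mulrDl mul1r lerD2l -/M3.
by rewrite ler_pdivrMl// mulrCA -exprS centred_cube_le_mean.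
Qed.

(* The factor 32 makes U / 2 * phiA >= 2 * A, so that T exceeds half its mean
   with probability at most exp (- A). *)
Lemma passage_variance_ge_mean : 0 < A -> 32 * A * phi <= phiA ->
  (forall s, 0 <= s -> q s <= expR (A - s * phiA)) ->
  (1 - expR (- A)) / 4 * U ^+ 2 <= V.
Proof.
move=> A0 Aphi qA; have U0 := passage_mean_gt0.
have s0 : 0 <= U / 2 by rewrite divr_ge0// ltW.
have sU : U / 2 <= U by lra.
apply: le_trans (passage_variance_ge subX phi0 q_decay s0 sU).
rewrite -/U -/(q _).
have -> : (U - U / 2) ^+ 2 * (1 - q (U / 2)) = (1 - q (U / 2)) / 4 * U ^+ 2 by field.
apply: ler_wpM2r; first exact: sqr_ge0.
rewrite ler_wpM2r// lerD2l lerN2; apply: (le_trans (qA _ s0)).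
rewrite ler_expR.
have h : 2 * A <= U / 2 * phiA; last by lra.
have -> : 2 * A = (8 * phi)^-1 / 2 * (32 * A * phi) by field; rewrite gt_eqF.
apply: ler_pM => //; first by rewrite divr_ge0 ?invr_ge0 ?mulr_ge0// ltW.
  by rewrite !mulr_ge0// ltW.
by rewrite ler_wpM2r.
Qed.

End passage_moment_bounds.

Lemma characteristics_laplace {R : realType} {d : measure_display}
    {Omega : measurableType d} (P : probability Omega R) (X : R -> Omega -> R)
    (Pi : {measure set (measurableTypeR R) -> \bar R}) (lambda : R) :
  has_characteristics P X 0 Pi -> 0 < lambda ->
  \int[P]_w expR (- (lambda * X 1 w)) =
  expR (- fine (laplace_exponent 0 Pi lambda)).
Proof.
move=> [_ levyPi lap] l0; rewrite /Rintegral; have := lap lambda (ltW l0).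
rewrite unlock => ->; rewrite -[in LHS](fineK (laplace_exponent_fin levyPi l0)).
by [].
Qed.

Lemma powR_neg3_2 {R : realType} (u : R) : 0 <= u -> (u ^+ 2) `^ (- (3 / 2)) = (u ^+ 3)^-1.
Proof.
move=> u0; rewrite -powR_mulrn// -powRrM mulrN powRN (_ : 2%:R * (3 / 2) = 3%:R :> R); last by field.
by rewrite powR_mulrn.
Qed.

Unset Implicit Arguments.
Set Strict Implicit.
Set Printing Implicit Defensive.

Theorem theorem2p3 (R : realType) (d : measure_display)
    (Omega : measurableType d) (P : probability Omega R)
    (X : R -> Omega -> R) (Pi : {measure set (measurableTypeR R) -> \bar R}) :
  subordinator P X ->
  has_characteristics P X 0 Pi ->
  Pi `]0%R, +oo[%classic = +oo%E ->
  (1 < limf_einf (fun delta : R =>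
         integrated_tail Pi (2 * delta)%R / integrated_tail Pi delta)
       (0^'+))%E ->
  forall t : R, 0 < t ->
    cvg_in_distribution P (0^'+)
      (fun (delta : R) (w : Omega) =>
         (range_covering_number X t delta w - t * centering P X delta) /
         (Num.sqrt t * scaling P X delta))
      (normal_prob 0 1).
Proof.
move=> subX chX Pi_inf tail_growth t t0; have [_ levyPi _] := chX.
have [A A0 [e1 e10 growth]] := laplace_exponent_growth levyPi tail_growth (ler0n R 32).
apply: cvg_in_distribution_upper_tail.
  near=> delta; apply: measurable_funM => //; apply: measurable_funB => //.
  by apply: (measurable_range_covering_number subX t0); near: delta; exact: nbhs_right_gt.
move=> x; apply/cvgrPdist_le => e e0.
have [K KE] : exists K : R, K = moment_const by exists moment_const.
have K0 : 0 <= K by rewrite KE moment_const_ge0.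
have K1 : 0 <= 1 + K by rewrite addr_ge0.
pose c := Num.sqrt ((1 - expR (- A)) / 4).
have c20 : 0 < (1 - expR (- A)) / 4.
  by rewrite divr_gt0// subr_gt0 -expR0 ltr_expR oppr_lt0.
have c0 : 0 < c by rewrite sqrtr_gt0.
pose C := Num.sqrt (1 + K); have C0 : 0 <= C by exact: sqrtr_ge0.
have [a a0 [u0 u00 small]] := clt_error_small x t0 c0 C0 K0 e0.
(* Once phi >= L, [passage_mean_le] gives U <= u0^2, the smallness required by [clt_error_small];
   the 1 keeps phi positive. *)
pose L := 1 + (1 + cube_const) / u0 ^+ 2.
have [e2 e20 large] := laplace_exponent_large levyPi Pi_inf L.
near=> delta.
have delta0 : 0 < delta by near: delta; exact: nbhs_right_gt.
have d1 : delta < e1 by near: delta; exact: nbhs_right_lt.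
have d2 : delta < e2 by near: delta; exact: nbhs_right_lt.
have dn0 : delta != 0 by exact: lt0r_neq0.
have di0 : 0 < delta^-1 by rewrite invr_gt0.
have Ad0 : 0 < A / delta by rewrite divr_gt0.
pose phi := fine (laplace_exponent 0 Pi delta^-1).
pose phiA := fine (laplace_exponent 0 Pi (A / delta)).
have phiL : L <= phi by exact: large.
have L1 : 1 <= L by rewrite lerDl divr_ge0 ?addr_ge0 ?cube_const_ge0 ?exprn_ge0 ?(ltW u00).
have phi0 : 0 < phi by rewrite (lt_le_trans _ phiL)// (lt_le_trans _ L1).
have phiAL : 32 * A * phi <= phiA by exact: growth.
have phiA0 : 0 <= phiA.
  apply: le_trans phiAL; apply: mulr_ge0; last exact: ltW.
  by apply: mulr_ge0; [exact: ler0n|exact: ltW].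
pose q s := fine (P [set w | X s w <= delta]).
have q_decay s : 0 <= s -> q s <= expR (1 - s * phi).
  move=> s0; rewrite -[X in expR (X - _)](mulVf dn0).
  exact: (prob_le_laplace subX (ltW di0) (ltW phi0) (characteristics_laplace chX di0)).
have qA s : 0 <= s -> q s <= expR (A - s * phiA).
  move=> s0; rewrite -[X in expR (X - _)](divfK dn0 A).
  exact: (prob_le_laplace subX (ltW Ad0) phiA0 (characteristics_laplace chX Ad0)).
(* At lambda = 1 / delta, (1 - 1/e) P(X_s > delta) <= 1 - e^(-s phi) <= s phi, and 1 - 1/e >=
   1/2. *)
have q_slow s : 0 <= s -> 1 - q s <= 2 * (s * phi).
  move=> s0; have ml := measurable_le_level subX delta s0.
  have := prob_gt_laplace subX (ltW di0) (ltW phi0) (characteristics_laplace chX di0) delta s0.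
  have -> : fine (P [set w | delta < X s w]) = 1 - q s.
    rewrite (_ : [set w | delta < X s w] = ~` [set w | X s w <= delta]); last first.
      by apply/seteqP; split => w /=; rewrite ltNge => /negP.
    by rewrite probability_setC// fineB ?fin_num_measure.
  rewrite (mulVf dn0); have q1 : 0 <= 1 - q s.
    rewrite subr_ge0 -lee_fin /q fineK; first exact: probability_le1.
    exact: fin_num_measure.
  have h1 := expR_ge1Dx (- (s * phi)).
  have h2 : expR (- 1) <= 2^-1 :> R.
    rewrite expRN lef_pV2 ?posrE ?expR_gt0//; have := @expR_ge1Dx R 1; lra.
  have h3 : 2^-1 * (1 - q s) <= (1 - expR (- 1)) * (1 - q s) by apply: ler_wpM2r => //; lra.
  lra.
pose U := \int[P]_w fine (passage_time X delta w).
pose V := \int[P]_w ((U - fine (passage_time X delta w)) ^+ 2).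
have U0 : 0 < U := passage_mean_gt0 subX phi0 q_decay q_slow.
have V1 : (1 - expR (- A)) / 4 * U ^+ 2 <= V.
  exact: (passage_variance_ge_mean subX phi0 q_decay q_slow A0 phiAL qA).
have V2 : V <= (1 + K) * U ^+ 2.
  by rewrite KE; exact: (passage_variance_le subX phi0 q_decay q_slow).
have V0 : 0 < V by rewrite (lt_le_trans _ V1)// mulr_gt0// exprn_gt0.
pose u := Num.sqrt U; have u_gt0 : 0 < u by rewrite sqrtr_gt0.
have uE : u ^+ 2 = U by rewrite sqr_sqrtr// ltW.
have uu0 : u <= u0.
  rewrite -(@ler_pXn2r _ 2)// ?nnegrE ?(ltW u_gt0) ?(ltW u00)// uE.
  apply: (le_trans (passage_mean_le subX phi0 q_decay)).
  have : (1 + cube_const) / u0 ^+ 2 <= phi by apply: le_trans phiL; rewrite lerDr.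
  move: (1 + _) => b; rewrite ler_pdivrMr ?exprn_gt0// mulrC => ?.
  by rewrite (ler_pdivrMr _ _ phi0).
pose s := Num.sqrt V.
have cs : c * u ^+ 2 <= s.
  rewrite uE /c -[U](ger0_norm (ltW U0)) -sqrtr_sqr -sqrtrM ?(ltW c20)//.
  exact: ler_wsqrtr.
have sC : s <= C * u ^+ 2.
  rewrite uE /C -[U](ger0_norm (ltW U0)) -sqrtr_sqr -sqrtrM//.
  exact: ler_wsqrtr.
(* The level that N must exceed for the normalized variable to exceed [x]. *)
pose y := t / u ^+ 2 + x * (Num.sqrt t * ((u ^+ 3)^-1 * s)).
have M30 : 0 <= \int[P]_w (`|U - fine (passage_time X delta w)| ^+ 3).
  by apply: Rintegral_ge0 => w _; rewrite exprn_ge0.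
have M3 : \int[P]_w (`|U - fine (passage_time X delta w)| ^+ 3) <= K * (u ^+ 2) ^+ 3.
  by rewrite uE KE; exact: (centred_cube_le_mean subX phi0 q_decay q_slow).
have [y0 [n yn]] := small u s y _ u_gt0 uu0 cs sC M30 M3 erefl.
have := range_tail_clt subX t0 delta0 phi0 q_decay y0 yn V0 a0.
rewrite -/U -/V -/s uE.
have -> : [set w | x < (range_covering_number X t delta w - t * centering P X delta) /
         (Num.sqrt t * scaling P X delta)] = [set w | y < range_covering_number X t delta w].
  have scE : scaling P X delta = (u ^+ 3)^-1 * s.
    rewrite /scaling (renewal_functionE subX phi0 q_decay) (passage_varianceE subX phi0 q_decay).
    by rewrite /= -/U -/V -{1}uE powR_neg3_2// ltW.
  have sc0 : 0 < Num.sqrt t * ((u ^+ 3)^-1 * s).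
    by rewrite !mulr_gt0 ?invr_gt0 ?exprn_gt0 ?sqrtr_gt0.
  have cE : centering P X delta = U^-1.
    by rewrite /centering (renewal_functionE subX phi0 q_decay).
  apply/seteqP; split => w /=; rewrite scE cE ltr_pdivlMr// ltrBrDl /y uE//.
set tl := fine (P _); set v := (n.+1%:R * U - t) / (s * Num.sqrt n.+1%:R); set err := 4 * a + _ => h1 h2.
(* [v] is the abscissa after truncating y to the integer n + 1; the Lipschitz tail pays for |v - x|,
   and [h2] bounds both costs together. *)
rewrite -/(normal_tail x) (le_trans (ler_distD (normal_tail v) _ _))//.
rewrite (le_trans _ h2)//; apply: lerD; last by rewrite distrC.
by rewrite distrC; exact: normal_tail_dist.
Unshelve. all: by end_near.
Qed.
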